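(* Let $\alpha\in(0,1)$, $T>0$, let $\Omega\subset\mathbb{R}^d$ ($d\in\{1,2,3\}$) be a bounded Lipschitz domain, and let $\mathcal{L}$ be a linear second-order elliptic operator in the spatial variable such that, for some $\lambda\in\mathbb{R}$, $\langle \mathcal{L}v,v\rangle\ge\lambda\|v\|^2$ for all $v\in H^1_0(\Omega)$. Consider the problem $$D_t^\alpha u+\mathcal{L}u=f(x,t)\ \text{ for }(x,t)\in\Omega\times(0,T],\qquad u(\cdot,0)=u_0\ \text{ in }\Omega,\qquad u=0\ \text{ on }\partial\Omega\text{ for }t>0 .$$ Suppose that a unique solution $u$ of this problem and its approximation $u_h$ are in $L_\infty(0,t;L_2(\Omega))\cap W^{1,\infty}(\epsilon,t;L_2(\Omega))$ for any $0<\epsilon<t\le T$, and also in $H^1_0(\Omega)$ for any $t>0$, while $u_h(\cdot,0)=u_0$ and $R_h(\cdot,t)=(D_t^\alpha+\mathcal{L})u_h(\cdot,t)-f(\cdot,t)$ for $t>0$. If $$\|R_h(\cdot,t)\|\le (D_t^\alpha+\lambda)\mathcal{E}(t)\qquad\text{for all }t>0$$ for some barrier function $\mathcal{E}$ with $\mathcal{E}(t)\ge0$ for all $t\ge0$, then $\|(u_h-u)(\cdot,t)\|\le\mathcal{E}(t)$ for all $t\ge0$.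
   Context: Times $t$ are restricted to $[0,T]$, where the problem is posed. $\langle\cdot,\cdot\rangle$ and $\|\cdot\|$ are the inner product and norm of $L_2(\Omega)$. The barrier $\mathcal{E}$ is a scalar function of $t$. $D_t^\alpha$ is the Caputo derivative of order $\alpha$ in time: $D_t^\alpha v(\cdot,t):=\frac1{\Gamma(1-\alpha)}\int_0^t(t-s)^{-\alpha}\,\partial_s v(\cdot,s)\,ds$ for $t>0$, where $\Gamma$ is the Gamma function. For less smooth functions, including functions discontinuous at $t=0$, one may take as an alternative definition the formula obtained by integration by parts: $$\Gamma(1-\alpha)\,D_t^\alpha v(\cdot,t)=t^{-\alpha}\{v(\cdot,t)-v(\cdot,0)\}+\int_0^t\alpha(t-s)^{-\alpha-1}\{v(\cdot,t)-v(\cdot,s)\}\,ds .$$ The same definitions are used for $D_t^\alpha\mathcal{E}$. *)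

(* Defs.v *)
From HB Require Import structures.
From mathcomp Require Import all_boot all_order all_algebra.
From mathcomp Require Import all_classical all_reals all_analysis.

Set Implicit Arguments.
Unset Strict Implicit.
Unset Printing Implicit Defensive.
Import Order.TTheory GRing.Theory Num.Theory.
Import numFieldNormedType.Exports.

Local Open Scope classical_set_scope.
Local Open Scope ring_scope.

(* R^n is given the sigma-algebra generated by the coordinates, as n.-tuple R is
   in the library; it is the Borel one. *)
Definition rV_display : measure_display -> measure_display.
Proof. exact. Qed.

Section measurable_rV.
Variables (R : realType) (n : nat).

Let coors : 'I_n -> 'rV[R]_n -> measurableTypeR R := fun i v => v ord0 i.

Let rV_set0 : g_sigma_preimage coors set0.
Proof. exact: sigma_algebra0. Qed.

Let rV_setC A : g_sigma_preimage coors A -> g_sigma_preimage coors (~` A).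
Proof. exact: sigma_algebraC. Qed.

Let rV_bigcup (F : _^nat) : (forall i, g_sigma_preimage coors (F i)) ->
  g_sigma_preimage coors (\bigcup_i (F i)).
Proof. exact: sigma_algebra_bigcup. Qed.

HB.instance Definition _ := @isMeasurable.Build (rV_display R.-ocitv)
  'rV[R]_n (g_sigma_preimage coors) rV_set0 rV_setC rV_bigcup.

End measurable_rV.

Section measurable_rV_lemmas.
Variable R : realType.

Lemma measurable_coord n (i : 'I_n) :
  measurable_fun [set: 'rV[R]_n] (fun v : 'rV[R]_n => v ord0 i).
Proof.
move=> _ Y mY; rewrite setTI; apply: sub_sigma_algebra => /=.
rewrite -bigcup_seq/=; exists i => /=; first by rewrite mem_index_enum.
by exists Y => //; rewrite setTI.
Qed.

Lemma measurable_fun_rVP d (T : measurableType d) n (f : T -> 'rV[R]_n) :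
  (forall i, measurable_fun [set: T] (fun x => f x ord0 i)) ->
  measurable_fun [set: T] f.
Proof.
move=> mf _ Y mY; rewrite setTI; move: Y mY; apply: smallest_sub.
  split => [|A|F] /=.
  - by rewrite preimage_set0.
  - by rewrite setTD => mA; rewrite -preimage_setC; exact: measurableC.
  - by move=> mF; rewrite preimage_bigcup; exact: bigcup_measurable.
move=> A; rewrite -bigcup_seq => -[i _ [B mB <-]] /=.
by have := mf i measurableT _ mB; rewrite !setTI.
Qed.

Definition cons_rV n (p : R * 'rV[R]_n) : 'rV[R]_n.+1 := row_mx p.1%:M p.2.

Definition uncons_rV n (v : 'rV[R]_n.+1) : R * 'rV[R]_n :=
  (v ord0 ord0, \row_j v ord0 (lift ord0 j)).

Lemma cons_rV0 n p : @cons_rV n p ord0 ord0 = p.1.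
Proof.
have -> : ord0 = lshift n (ord0 : 'I_1) :> 'I_(1 + n) by exact: val_inj.
by rewrite [LHS]row_mxEl mxE.
Qed.

Lemma cons_rV_lift n p j : @cons_rV n p ord0 (lift ord0 j) = p.2 ord0 j.
Proof.
have -> : lift ord0 j = rshift 1 j :> 'I_(1 + n) by exact: val_inj.
by rewrite [LHS]row_mxEr.
Qed.

Lemma cons_rVK n : cancel (@cons_rV n) (@uncons_rV n).
Proof.
move=> p; rewrite /uncons_rV cons_rV0; case: p => x v /=; congr pair.
by apply/rowP => j; rewrite mxE cons_rV_lift.
Qed.

Lemma measurable_cons_rV n : measurable_fun setT (@cons_rV n).
Proof.
apply: measurable_fun_rVP => i; have [j ->|->] := unliftP ord0 i.
  under eq_fun do rewrite cons_rV_lift.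
  exact: (measurableT_comp (@measurable_coord n j)).
by under eq_fun do rewrite cons_rV0; exact: measurable_fst.
Qed.

Lemma measurable_uncons_rV n : measurable_fun setT (@uncons_rV n).
Proof.
apply/measurable_fun_pairP; split; first exact: measurable_coord.
apply: measurable_fun_rVP => j.
under eq_fun do rewrite /= mxE; exact: measurable_coord.
Qed.

End measurable_rV_lemmas.

Section lebesgue_rV.
Variable R : realType.
Local Open Scope ereal_scope.

Section step.
Variables (n : nat) (m : {sigma_finite_measure set 'rV[R]_n -> \bar R}).

Definition lebesgue_rV_step : set 'rV[R]_n.+1 -> \bar R :=
  pushforward (@lebesgue_measure R \x m) (@cons_rV R n).

Let mcons A : measurable A -> measurable (@cons_rV R n @^-1` A).
Proof. by move=> mA; rewrite -[X in measurable X]setTI; exact: measurable_cons_rV. Qed.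

Let step0 : lebesgue_rV_step set0 = 0.
Proof. by rewrite /lebesgue_rV_step /pushforward preimage_set0 measure0. Qed.

Let step_ge0 A : 0 <= lebesgue_rV_step A.
Proof. by rewrite /lebesgue_rV_step /pushforward measure_ge0. Qed.

Let step_sigma_additive : semi_sigma_additive lebesgue_rV_step.
Proof.
move=> F mF tF mUF; rewrite /lebesgue_rV_step /pushforward preimage_bigcup.
apply: measure_semi_sigma_additive.
- by move=> k; exact: mcons.
- apply/trivIsetP => /= i j _ _ ij; rewrite -preimage_setI.
  by move/trivIsetP : tF => /(_ _ _ _ _ ij) ->//; rewrite preimage_set0.
- by rewrite -preimage_bigcup; exact: mcons.
Qed.

HB.instance Definition _ := isMeasure.Build _ _ _ lebesgue_rV_step
  step0 step_ge0 step_sigma_additive.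

Let lebesgue_rV_step_sigma_finite : sigma_finite setT lebesgue_rV_step.
Proof.
have /sigma_finiteP[F [FT ndF Foo]] := sigma_finiteT (@lebesgue_measure R).
have /sigma_finiteP[G [GT ndG Goo]] := sigma_finiteT m.
exists (fun k => @uncons_rV R n @^-1` (F k `*` G k)).
  apply/seteqP; split => // v _.
  have [i _ Fi] : (\bigcup_k F k) (v ord0 ord0) by rewrite -FT.
  have [j _ Gj] : (\bigcup_k G k) (uncons_rV v).2 by rewrite -GT.
  exists (maxn i j) => //; split.
  - by have /subsetPset := ndF i (maxn i j) (leq_maxl i j); apply.
  - by have /subsetPset := ndG j (maxn i j) (leq_maxr i j); apply.
move=> k; have [mF Fk] := Foo k; have [mG Gk] := Goo k; split.
  have := @measurable_uncons_rV R n measurableT _ (measurableX mF mG).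
  by rewrite setTI.
rewrite /lebesgue_rV_step /pushforward -comp_preimage.
rewrite (_ : _ \o _ = id); last by apply/funext => p; rewrite /= cons_rVK.
rewrite preimage_id product_measure1E// lte_mul_pinfty//.
by rewrite ge0_fin_numE.
Qed.

HB.instance Definition _ := Measure_isSigmaFinite.Build _ _ _ lebesgue_rV_step
  lebesgue_rV_step_sigma_finite.
End step.

Fixpoint lebesgue_rV n : {sigma_finite_measure set 'rV[R]_n -> \bar R} :=
  match n with
  | 0 => dirac (0%R : 'rV[R]_0)
  | k.+1 => lebesgue_rV_step (lebesgue_rV k)
  end.

Lemma measurable_box n (A : 'I_n -> set (measurableTypeR R)) :
  (forall i, measurable (A i)) ->
  measurable [set v : 'rV[R]_n | forall i, A i (v ord0 i)].
Proof.
move=> mA; rewrite (_ : mkset _ =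
    \bigcap_(i in [set: 'I_n]) ((fun v : 'rV[R]_n => v ord0 i) @^-1` A i)).
  apply: fin_bigcap_measurable => // i _.
  by have := @measurable_coord R n i measurableT _ (mA i); rewrite setTI.
by apply/seteqP; split => [v Av i _|v Av i]; exact: Av.
Qed.

Lemma lebesgue_rV_box n (A : 'I_n -> set (measurableTypeR R)) :
  (forall i, measurable (A i)) ->
  lebesgue_rV n [set v : 'rV[R]_n | forall i, A i (v ord0 i)] =
  \prod_(i < n) lebesgue_measure (A i).
Proof.
elim: n A => [A _|n IH A mA].
  rewrite big_ord0 /= diracE (_ : _ \in _ = true)//.
  by apply/mem_set => -[].
rewrite big_ord_recl -IH => [|i]; last exact: mA.
rewrite [LHS]/= /lebesgue_rV_step /pushforward.
rewrite (_ : _ @^-1` _ = A ord0 `*`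
    [set v : 'rV[R]_n | forall i, A (lift ord0 i) (v ord0 i)]).
  rewrite product_measure1E//.
  exact: (@measurable_box n (fun i => A (lift ord0 i))).
apply/seteqP; split => [[x v] /= Av|[x v] /= [Ax Av] i].
  split=> [|i]; first by have := Av ord0; rewrite cons_rV0.
  by have := Av (lift ord0 i); rewrite cons_rV_lift.
by have [j ->|->] := unliftP ord0 i; rewrite ?cons_rV_lift ?cons_rV0.
Qed.

End lebesgue_rV.

Section function_spaces.
Variables (R : realType) (d : nat) (Omega : set 'rV[R]_d).
Local Notation X := 'rV[R]_d.
Local Notation mu := (lebesgue_rV R d).
Implicit Types (v w : X -> R) (g h : 'I_d -> X -> R).

(* Elements of L_2(Omega) are represented by functions on R^d, of which only
   the values on Omega matter, up to almost everywhere equality. *)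
Definition L2 v : Prop := v \_ Omega \in Lfun mu 2%:E.

Definition L2norm v : R := fine ('N[mu]_2%:E[EFin \o v \_ Omega]).

Definition L2inner v w : R := \int[mu]_(x in Omega) (v x * w x).

Definition Linf v : Prop :=
  measurable_fun setT (v \_ Omega) /\
  exists M : R, \forall x \ae mu, Omega x -> `|v x| <= M.

Definition partial (i : 'I_d) v : X -> R := 'D_(delta_mx ord0 i) v.

(* C_c^infty(Omega) *)
Definition test_function v : Prop :=
  [/\ forall s : seq 'I_d, continuous (foldr partial v s),
      forall (s : seq 'I_d) (i : 'I_d) (x : X),
        derivable (foldr partial v s) x (delta_mx ord0 i),
      compact (closure [set x | v x != 0]) &
      closure [set x | v x != 0] `<=` Omega].

Definition weak_gradient v g : Prop :=
  forall (i : 'I_d) (phi : X -> R), test_function phi ->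
    L2inner v (partial i phi) = - L2inner (g i) phi.

(* v is in H^1(Omega), with weak gradient g *)
Definition H1 v g : Prop :=
  [/\ L2 v, forall i, L2 (g i) & weak_gradient v g].

(* v is in H^1_0(Omega), the closure of C_c^infty(Omega) in H^1(Omega), with
   weak gradient g *)
Definition H10 v g : Prop :=
  H1 v g /\
  exists phi : nat -> X -> R,
    [/\ forall k, test_function (phi k),
        L2norm (phi k \- v) @[k --> \oo] --> 0 &
        forall i, L2norm (partial i (phi k) \- g i) @[k --> \oo] --> 0].

Definition dotp (x y : X) : R := \sum_(i < d) x ord0 i * y ord0 i.

(* Near each boundary point, Omega is the part above the graph, in some unit
   direction nu, of a Lipschitz function of the orthogonal projection onto the
   hyperplane orthogonal to nu. *)
Definition lipschitz_boundary : Prop :=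
  forall z : X, closure Omega z -> ~ Omega z ->
  exists (r : R) (nu : X) (gamma : X -> R),
    [/\ 0 < r, dotp nu nu = 1, lipschitz gamma &
        forall y, `|y - z| < r ->
          (Omega y <-> gamma (y - dotp y nu *: nu) < dotp y nu)].

Definition bounded_lipschitz_domain : Prop :=
  [/\ open Omega, connected Omega, Omega !=set0, bounded_set Omega &
      lipschitz_boundary].

(* The operator
     L u = - sum_i d_i (sum_j a_ij d_j u + e_i u) + sum_i b_i d_i u + c u. *)
Record operator := Operator {
  op_a : 'I_d -> 'I_d -> X -> R ;
  op_e : 'I_d -> X -> R ;
  op_b : 'I_d -> X -> R ;
  op_c : X -> R }.

Definition elliptic (L : operator) : Prop :=
  [/\ forall i j, Linf (op_a L i j), forall i, Linf (op_e L i),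
      forall i, Linf (op_b L i), Linf (op_c L) &
      exists2 theta : R, 0 < theta &
        \forall x \ae mu, Omega x -> forall xi : 'I_d -> R,
          theta * \sum_i xi i ^+ 2 <=
          \sum_i \sum_j op_a L i j x * xi j * xi i].

(* The pairing < L v, w > of H^{-1}(Omega) and H^1_0(Omega), where g and h are
   the gradients of v and w. *)
Definition pairing (L : operator) v g w h : R :=
  \int[mu]_(x in Omega)
    (\sum_i (\sum_j op_a L i j x * g j x + op_e L i x * v x) * h i x
     + (\sum_i op_b L i x * g i x + op_c L x * v x) * w x).

End function_spaces.

Section bochner.
Variables (R : realType) (d : nat) (Omega : set 'rV[R]_d).
Local Notation X := 'rV[R]_d.
Local Notation leb := (@lebesgue_measure R).
Local Notation L2 := (L2 Omega).
Local Notation L2norm := (L2norm Omega).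
Implicit Types (F G : R -> X -> R).

(* The data of the simple function sf_fun below, with values in L_2(Omega) *)
Record simple_function := SimpleFunction {
  sf_size : nat ;
  sf_set : 'I_sf_size -> set (measurableTypeR R) ;
  sf_val : 'I_sf_size -> X -> R ;
  sf_measurable : forall i, measurable (sf_set i) ;
  sf_L2 : forall i, L2 (sf_val i) }.

Arguments sf_set _ _ : clear implicits.
Arguments sf_val _ _ : clear implicits.

Definition sf_fun (S : simple_function) (s : R) (x : X) : R :=
  \sum_i \1_(sf_set S i) s * sf_val S i x.

Definition sf_integral (a b : R) (S : simple_function) (x : X) : R :=
  \sum_i fine (leb (sf_set S i `&` `]a, b[)) * sf_val S i x.

Definition strongly_measurable (a b : R) F : Prop :=
  (\forall s \ae leb, a < s < b -> L2 (F s)) /\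
  exists S : nat -> simple_function,
    \forall s \ae leb, a < s < b ->
      L2norm (sf_fun (S k) s \- F s) @[k --> \oo] --> 0.

(* w is the Bochner integral of F over (a, b): the limit of the integrals of
   simple functions approximating F in L_1(a, b; L_2(Omega)) *)
Definition bochner_integral (a b : R) F (w : X -> R) : Prop :=
  [/\ strongly_measurable a b F, L2 w &
      exists S : nat -> simple_function,
        (\int[leb]_(s in `]a, b[) (L2norm (sf_fun (S k) s \- F s))%:E)%E
          @[k --> \oo] --> 0%E /\
        L2norm (sf_integral a b (S k) \- w) @[k --> \oo] --> 0].

(* L_infty(a, b; L_2(Omega)) *)
Definition Linf_time (a b : R) F : Prop :=
  strongly_measurable a b F /\
  exists M : R, \forall s \ae leb, a < s < b -> L2norm (F s) <= M.

(* W^{1,infty}(a, b; L_2(Omega)): the primitives of functions G in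
   L_infty(a, b; L_2(Omega)). As F is defined at every time, the continuous
   representative is meant. *)
Definition W1inf_time (a b : R) F : Prop :=
  Linf_time a b F /\
  exists2 G, Linf_time a b G &
    forall s t : R, a <= s -> s < t -> t <= b ->
      bochner_integral s t G (F t \- F s).

End bochner.

Section caputo.
Variable R : realType.
Local Notation leb := (@lebesgue_measure R).

Definition Gamma (x : R) : R :=
  \int[leb]_(s in `]0, +oo[) (s `^ (x - 1) * expR (- s)).

(* w is D_t^alpha v(t), for a function v of time with values in L_2(Omega). The
   formula without derivatives is used, as v may be discontinuous at 0. *)
Definition caputo d (Omega : set 'rV[R]_d) (alpha : R)
    (v : R -> 'rV[R]_d -> R) (t : R) (w : 'rV[R]_d -> R) : Prop :=
  exists2 J : 'rV[R]_d -> R,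
    bochner_integral Omega 0 t
      (fun s x => alpha * (t - s) `^ (- alpha - 1) * (v t x - v s x)) J &
    forall x, w x =
      (Gamma (1 - alpha))^-1 * (t `^ (- alpha) * (v t x - v 0 x) + J x).

Definition caputo_kernel (alpha : R) (E : R -> R) (t s : R) : R :=
  alpha * (t - s) `^ (- alpha - 1) * (E t - E s).

Definition caputo_defined (alpha : R) (E : R -> R) (t : R) : Prop :=
  leb.-integrable `]0, t[ (EFin \o caputo_kernel alpha E t).

(* D_t^alpha E(t), for a scalar function E such that caputo_defined alpha E t *)
Definition scalar_caputo (alpha : R) (E : R -> R) (t : R) : R :=
  (Gamma (1 - alpha))^-1 *
  (t `^ (- alpha) * (E t - E 0)
   + \int[leb]_(s in `]0, t[) caputo_kernel alpha E t s).

End caputo.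

Section problem.
Variables (R : realType) (d : nat) (Omega : set 'rV[R]_d).
Variables (alpha T : R) (L : operator R d).
Local Notation X := 'rV[R]_d.
Implicit Types (f v u : R -> X -> R).

Definition regular v : Prop :=
  [/\ forall t : R, 0 <= t <= T -> L2 Omega (v t),
      forall eps t : R, 0 < eps -> eps < t -> t <= T ->
        Linf_time Omega 0 t v /\ W1inf_time Omega eps t v &
      forall t : R, 0 < t <= T -> exists g, H10 Omega (v t) g].

Definition initial_value v (u0 : X -> R) : Prop :=
  \forall x \ae lebesgue_rV R d, Omega x -> v 0 x = u0 x.

(* (D_t^alpha + L) v(t) - f(t) = r, as elements of H^{-1}(Omega) *)
Definition is_residual f v (t : R) (r : X -> R) : Prop :=
  exists (w : X -> R) (g : 'I_d -> X -> R),
    [/\ caputo Omega alpha v t w, H10 Omega (v t) g &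
        forall phi h, H10 Omega phi h ->
          L2inner Omega w phi + pairing Omega L (v t) g phi h
          - L2inner Omega (f t) phi = L2inner Omega r phi].

(* The boundary condition is the membership of u(t) in H^1_0(Omega) required by
   is_residual. *)
Definition is_solution f (u0 : X -> R) u : Prop :=
  initial_value u u0 /\
  forall t : R, 0 < t <= T -> is_residual f u t (cst 0).

Definition is_unique_solution f (u0 : X -> R) u : Prop :=
  is_solution f u0 u /\
  forall v, regular v -> is_solution f u0 v ->
  forall t : R, 0 <= t <= T ->
    \forall x \ae lebesgue_rV R d, Omega x -> v t x = u t x.

End problem.

(* Main.v *)
Require Import Defs.
From mathcomp Require Import all_boot all_order all_algebra.
From mathcomp Require Import all_classical all_reals all_analysis.
From mathcomp Require Import measurable_realfun ring lra.
Import Order.TTheory GRing.Theory Num.Theory.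
Import numFieldNormedType.Exports.
Local Open Scope classical_set_scope.
Local Open Scope ring_scope.

(** Write [w(t)] for the norm of [e(t) = (uh - u)(t)]. Testing the difference of
    the equations for [uh] and [u] at time [t] with [e(t)], and bounding
    [<e(s), e(t)> <= w(s) w(t)] in the Caputo derivative, gives
    [(D^alpha + lambda) w <= |Rh| <= (D^alpha + lambda) E] at each [t] with
    [w(t) > 0]. Hence [p = max(w - E, 0)] is bounded and satisfies
      [t^-alpha p(t) + int_0^t alpha (t-s)^(-alpha-1) (p(t) - p(s)) ds <= Lam p(t)]
    with [Lam = |lambda| Gamma(1 - alpha)], and one has to show that [p = 0].

    As [E], hence [p], need not be continuous, [p] may have no maximum, and the
    argument is made on the continuous function
      [Q(t) = int_0^t (t-s)^-alpha p(s) ds - Lam int_0^t p(s) ds].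
    Let [V] be its primitive. If [Q] is positive somewhere, it has a point [t]
    such that [Q(a) <= Q(t) - e (t - a)] for all [a <= t], for some [e > 0], so
    that [h Q(t) - (V(t) - V(t - h)) >= e h^2 / 2]; but the left-hand side
    divided by [h^2] has, as [h] tends to 0, a limit which the inequality for
    [p] makes nonpositive. Hence [Q <= 0]. As [r^-alpha >= Lam + 1] for small
    [r], this forces [int p = 0], first near 0 and then step by step on [0, T].
    So [p = 0] almost everywhere, and if [p(t) > 0] then the integral in the
    inequality would diverge. *)

Set Implicit Arguments.
Unset Strict Implicit.

(** * Powers and fractional integrals *)

(** Formally the inequality for p says that Q' <= 0, with Q(0) = 0: up to the term in Lam, its
    left-hand side is the Marchaud form of the derivative of int_0^t (t-s)^-alpha p(s) ds. But Q is
    not known to be differentiable, so Q'(t) is replaced by 2 h^-2 (h Q(t) - (V(t) - V(t - h))).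
    This is an integral of 2 h^-2 k_h(t-s) p(s), and 2 h^-2 k_h(r) tends to -alpha r^(-alpha-1),
    which is not integrable at r = 0. Dominated convergence therefore needs the factor p(s) - p(t),
    against which the Caputo kernel is integrable at every t. The remaining p(t) int k_h is p(t)
    times the same difference for the constant density 1, which is bounded in closed form; in the
    limit it supplies p(t) (t^-alpha - Lam). As the limit comes out only nonpositive, a plain
    maximum of Q would give no contradiction; the slope e makes it strict, and it is obtained by
    maximizing Q(t) - e t instead of Q. *)

Lemma ge0_FTC2_oo (R : realType) (f F : R -> R) (a b : R) : a < b ->
  {in `]a, b[, forall x, is_derive x (1 : R) F (f x)} ->
  {in `]a, b[, continuous f} -> {within `[a, b], continuous F} ->
  {in `]a, b[, forall x, 0 <= f x} ->
  (\int[@lebesgue_measure R]_(x in `]a, b[) (f x)%:E = (F b - F a)%:E)%E.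
Proof.
move=> ab dF cf cF f0.
(* [f] may blow up at both ends, so the interval is exhausted by compact ones and the integrals pass
   to the limit by monotone convergence. The denominator starts at 3 so that [2 * h n < b - a] and
   each compact interval is nondegenerate. *)
pose h (n : nat) : R := (b - a) / n.+3%:R.
have h0 n : 0 < h n by rewrite divr_gt0// subr_gt0.
have hlt n : 2 * h n < b - a.
  rewrite /h mulrCA gtr_pMr ?subr_gt0// ltr_pdivrMr// mul1r.
  by rewrite -[2]/(2%:R) ltr_nat.
have hS m n : (m <= n)%N -> h n <= h m.
  move=> mn; rewrite /h ler_pM2l ?subr_gt0// lef_pV2 ?posrE//.
  by rewrite ler_nat !ltnS.
have hcvg : h n @[n --> \oo] --> (0 : R).
  rewrite -[X in _ --> X](mulr0 (b - a)); apply: cvgMr.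
  have := @cvg_harmonic R; rewrite -(cvg_shiftn 2) /=.
  by apply: cvg_trans; apply: near_eq_cvg; apply: nearW => n /=; rewrite addn2.
pose S n : set (measurableTypeR R) := `[a + h n, b - h n]%classic.
have SE : `]a, b[%classic = \bigcup_n S n.
  apply/seteqP; split => x /=.
    rewrite in_itv/= => /andP[ax xb].
    have /cvgrPdist_lt/(_ (Num.min (x - a) (b - x))) := hcvg.
    rewrite lt_min !subr_gt0 ax xb => /(_ isT)[n _ /(_ n (leqnn _))].
    rewrite sub0r normrN gtr0_norm// lt_min => /andP[h1 h2].
    by exists n => //; rewrite /S/= in_itv/=; apply/andP; split; lra.
  move=> [n _]; rewrite /S/= !in_itv/= => /andP[h1 h2].
  by have := h0 n; lra.
have mf : measurable_fun (`]a, b[ : set (measurableTypeR R)) (EFin \o f).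
  apply/measurable_EFinP; apply: open_continuous_measurable_fun => //.
  by move=> x; rewrite inE; apply: cf.
have lim1 : (\int[@lebesgue_measure R]_(x in S n) (f x)%:E @[n --> \oo] -->
    \int[@lebesgue_measure R]_(x in `]a, b[) (f x)%:E)%E.
  rewrite SE; apply: ge0_nondecreasing_set_cvg_integral.
  - apply/nondecreasing_seqP => n; apply/subsetPset => x.
    rewrite /S/= !in_itv/= => /andP[h1 h2].
    by have := hS n n.+1 (leqnSn _); lra.
  - by move=> n; exact: measurable_itv.
  - move=> n; apply: measurable_funS mf => //.
    by rewrite SE; exact: bigcup_sup.
  - move=> n x Sx; rewrite lee_fin; apply: f0.
    by have : `]a, b[%classic x by rewrite SE; exists n.
have inS n x : x \in `[a + h n, b - h n] -> x \in `]a, b[.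
  by rewrite !in_itv/= => /andP[h1 h2]; have := h0 n; lra.
have lim2 : ((F (b - h n) - F (a + h n))%:E @[n --> \oo] --> (F b - F a)%:E)%E.
  apply: cvg_EFin; first exact: nearW.
  have [_ cFa cFb] := (continuous_within_itvP _ ab).1 cF.
  apply: cvgB.
    have /cvg_at_leftP := cFb; apply; split=> [n|]; first by have := h0 n; lra.
    by rewrite -[X in _ --> X]subr0; apply: cvgB => //; exact: cvg_cst.
  have /cvg_at_rightP := cFa; apply; split=> [n|]; first by have := h0 n; lra.
  by rewrite -[X in _ --> X]addr0; apply: cvgD => //; exact: cvg_cst.
have eqI n : (\int[@lebesgue_measure R]_(x in S n) (f x)%:E =
    (F (b - h n) - F (a + h n))%:E)%E.
  have hn := h0 n; have h2n := hlt n.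
  have cFab x : x \in `]a, b[ -> {for x, continuous F}.
    by move=> /dF[dx _]; exact/differentiable_continuous/derivable1_diffP.
  rewrite /S (@continuous_FTC2 _ f F) ?EFinB//.
  - by lra.
  - apply: continuous_in_subspaceT => x; rewrite inE/= => xS.
    by apply: cf; exact: inS xS.
  - split.
    + move=> x xS; have [] := dF x => //; apply: (inS n).
      exact: subset_itv_oo_cc xS.
    + by apply: cvg_at_right_filter; apply: cFab; rewrite in_itv/=; lra.
    + by apply: cvg_at_left_filter; apply: cFab; rewrite in_itv/=; lra.
  - move=> x xS; have [//|_ <-] := dF x; last by rewrite derive1E.
    by apply: (inS n); exact: subset_itv_oo_cc xS.
have {lim1} := lim1; rewrite (eq_cvg _ _ eqI) => lim1.
exact: (cvg_unique _ lim1 lim2).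
Qed.

Section power.
Variable R : realType.
Implicit Types a b t x : R.

Lemma continuous_powR b x : 0 < x -> {for x, continuous (fun y : R => y `^ b)}.
Proof.
move=> x0; apply/differentiable_continuous/derivable1_diffP.
by apply: derivable_powR; rewrite in_itv/= andbT.
Qed.

Lemma within_continuous_powR b x y : 0 < b -> 0 <= x -> x < y ->
  {within `[x, y], continuous (fun z : R => z `^ b)}.
Proof.
move=> b0 x0 xy; apply/continuous_within_itvP => //; split.
- move=> z; rewrite in_itv/= => /andP[xz zy].
  by apply: continuous_powR; exact: le_lt_trans xz.
- move: x0; rewrite le_eqVlt => /predU1P[<-|x0].
    by rewrite powR0 ?gt_eqF//; exact: powR_cvg0.
  by apply: cvg_at_right_filter; exact: continuous_powR.
- by apply: cvg_at_left_filter; apply: continuous_powR; exact: le_lt_trans xy.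
Qed.

Lemma le_powR b x y : 0 <= b -> 0 <= x -> x <= y -> x `^ b <= y `^ b.
Proof.
by move=> b0 x0 xy; apply: ge0_ler_powR; rewrite ?nnegrE// (le_trans x0).
Qed.

Lemma le_powR_neg b x y : b <= 0 -> 0 < x -> x <= y -> y `^ b <= x `^ b.
Proof.
move=> b0 x0 xy; rewrite -[b]opprK powRN [leRHS]powRN.
rewrite lef_pV2 ?posrE ?powR_gt0 ?(lt_le_trans x0)//.
by apply: le_powR => //; [rewrite oppr_ge0|exact: ltW].
Qed.

Lemma powRS b x : 0 < x -> x `^ (b + 1) = x * x `^ b.
Proof.
move=> x0; rewrite powRD; last by apply/implyP => _; rewrite gt_eqF.
by rewrite mulrC powRr1// ltW.
Qed.

Lemma is_derive_powRB b t x : x < t ->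
  is_derive x (1 : R) (fun s : R => (t - s) `^ b) (- (b * (t - x) `^ (b - 1))).
Proof.
move=> xt.
have H : is_derive x (1 : R) (fun s : R => t - s) (- 1).
  by rewrite -[X in is_derive _ _ _ X]add0r; exact: is_deriveB.
have H' : is_derive (t - x) (1 : R) (@powR R ^~ b) (b * (t - x) `^ (b - 1)).
  by apply: is_derive1_powR; rewrite subr_gt0.
have := @is_derive1_comp R (@powR R ^~ b) (fun s : R => t - s) x _ _ H' H.
by rewrite mulrN1.
Qed.

Lemma is_derive_primitive_powR b x : b != -1 -> 0 < x ->
  is_derive x (1 : R) (fun s : R => (b + 1)^-1 * s `^ (b + 1)) (x `^ b).
Proof.
move=> b1 x0; have b10 : b + 1 != 0 by rewrite addr_eq0.
have := is_derive1_powR (b + 1) x0; rewrite addrK => H.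
have := @is_deriveZ R R^o R^o (@powR R ^~ (b + 1)) (b + 1)^-1 x 1 _ H.
by rewrite /GRing.scale/= mulKf.
Qed.

Lemma is_derive_primitive_powRB b t x : b != -1 -> x < t ->
  is_derive x (1 : R) (fun s : R => - ((b + 1)^-1 * (t - s) `^ (b + 1))) ((t - x) `^ b).
Proof.
move=> b1 x0; have b10 : b + 1 != 0 by rewrite addr_eq0.
have := is_derive_powRB (b + 1) x0; rewrite addrK => H.
have := @is_deriveZ R R^o R^o _ (- (b + 1)^-1) x 1 _ H.
rewrite /GRing.scale/= mulrNN mulKf//; congr is_derive.
by apply/funext => s; exact: mulNr.
Qed.

Lemma within_continuous_powRB b t x y : 0 < b -> x < y -> y <= t ->
  {within `[x, y], continuous (fun z : R => (t - z) `^ b)}.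
Proof.
move=> b0 xy yt.
have ct (z : R) : (t - u) @[u --> z] --> t - z.
  by apply: cvgB => //; exact: cvg_cst.
have cp z : z < t -> {for z, continuous (fun z : R => (t - z) `^ b)}.
  move=> zt; apply: (@continuous_comp _ _ _ (fun u => t - u) (@powR R ^~ b)).
    exact: ct.
  by apply: continuous_powR; rewrite subr_gt0.
apply/continuous_within_itvP => //; split.
- move=> z; rewrite in_itv/= => /andP[xz zy].
  by apply: cp; lra.
- by apply: cvg_at_right_filter; apply: cp; lra.
- move: yt; rewrite le_eqVlt => /predU1P[->|yt]; last first.
    by apply: cvg_at_left_filter; exact: cp.
  apply/cvg_at_leftP => u [ut uc].
  rewrite subrr powR0 ?gt_eqF//.
  have /cvg_at_rightP := powR_cvg0 b0; apply; split=> [n|].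
    by rewrite subr_gt0.
  by rewrite -[X in _ --> X](subrr t); apply: cvgB => //; exact: cvg_cst.
Qed.
End power.

(** * Integrals of real-valued functions *)

Section real_integrals.
Context d (T : measurableType d) (R : realType).
Variable mu : {measure set T -> \bar R}.
Implicit Types (D : set T) (f g : T -> R).

Lemma integrable_domination D f g : measurable D -> measurable_fun D f ->
  mu.-integrable D (EFin \o g) -> (forall x, D x -> `|f x| <= g x) ->
  mu.-integrable D (EFin \o f).
Proof.
move=> mD mf ig fg; apply: le_integrable ig => //.
  exact/measurable_EFinP.
move=> x Dx /=; rewrite lee_fin.
by apply: (le_trans (fg _ Dx)); exact: ler_norm.
Qed.

Lemma bounded_integrable D f (M : R) : measurable D -> (mu D < +oo)%E ->
  measurable_fun D f -> (forall x, D x -> `|f x| <= M) ->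
  mu.-integrable D (EFin \o f).
Proof.
move=> mD Doo mf fM; apply: measurable_bounded_integrable => //.
exists M; split; first exact: num_real.
by move=> N MN x Dx /=; apply: (le_trans (fM _ Dx)); exact: ltW.
Qed.

Lemma RintegralN D f : measurable D -> mu.-integrable D (EFin \o f) ->
  \int[mu]_(x in D) (- f x) = - \int[mu]_(x in D) f x.
Proof.
move=> mD fi; rewrite -mulN1r -RintegralZl//.
by apply: eq_Rintegral => x _; rewrite mulN1r.
Qed.

Lemma integrable_RZl D f k : measurable D -> mu.-integrable D (EFin \o f) ->
  mu.-integrable D (EFin \o (fun x => k * f x)).
Proof. by move=> mD fi; exact: (integrableZl mD k fi). Qed.

Lemma integrable_RD D f g : measurable D -> mu.-integrable D (EFin \o f) ->
  mu.-integrable D (EFin \o g) ->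
  mu.-integrable D (EFin \o (fun x => f x + g x)).
Proof. by move=> mD fi gi; exact: (integrableD mD fi gi). Qed.

Lemma integrable_RB D f g : measurable D -> mu.-integrable D (EFin \o f) ->
  mu.-integrable D (EFin \o g) ->
  mu.-integrable D (EFin \o (fun x => f x - g x)).
Proof. by move=> mD fi gi; exact: (integrableB mD fi gi). Qed.

Lemma integrable_R_measurable D f : mu.-integrable D (EFin \o f) ->
  measurable_fun D f.
Proof. by move=> /measurable_int /measurable_EFinP. Qed.

Lemma integrable_Rsub D1 D2 f : measurable D1 -> measurable D2 ->
  D2 `<=` D1 -> mu.-integrable D1 (EFin \o f) -> mu.-integrable D2 (EFin \o f).
Proof. by move=> m1 m2 s; exact: integrableS. Qed.

Lemma le_Rintegral_subset D1 D2 f : measurable D1 -> measurable D2 ->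
  D1 `<=` D2 -> mu.-integrable D2 (EFin \o f) -> (forall x, D2 x -> 0 <= f x) ->
  \int[mu]_(x in D1) f x <= \int[mu]_(x in D2) f x.
Proof.
move=> m1 m2 s fi f0; rewrite /Rintegral fine_le//.
- by apply: integrable_fin_num => //; exact: integrable_Rsub fi.
- exact: integrable_fin_num.
- apply: ge0_subset_integral => //; first exact: measurable_int fi.
Qed.
End real_integrals.

(** * One-sided second-order Taylor bounds *)

Section taylor2.
Variable R : realType.

(** The mean value theorem is used twice, first for [F1] and then for the remainder [G], so that
    [F2] need only be bounded, not continuous. *)
Lemma taylor2_backward_le (F F1 F2 : R -> R) (x h c : R) : 0 < h ->
  (forall y, x - h <= y <= x -> is_derive y (1 : R) F (F1 y)) ->
  (forall y, x - h <= y <= x -> is_derive y (1 : R) F1 (F2 y)) ->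
  (forall y, x - h <= y <= x -> F2 y <= c) ->
  F (x - h) - F x + h * F1 x <= c * h ^+ 2 / 2.
Proof.
move=> h0 dF dF1 F2c.
have lip y : x - h <= y <= x -> F1 x - F1 y <= c * (x - y).
  move=> /andP[hy]; rewrite le_eqVlt => /predU1P[->|yx]; first by rewrite !subrr mulr0.
  have [||z + ->] := @MVT R F1 F2 y x yx.
  - by move=> z; rewrite in_itv/= => /andP[? ?]; apply: dF1; lra.
  - apply: derivable_within_continuous => z; rewrite in_itv/= => /andP[? ?].
    by apply: ex_derive; apply: dF1; lra.
  rewrite in_itv/= => /andP[? ?]; rewrite ler_pM2r ?subr_gt0//.
  by apply: F2c; lra.
(* [G] is nondecreasing on [[x - h, x]], since [lip] says exactly that its derivative [G1] is
   nonnegative there; comparing its two end values gives the claim. *)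
pose G y := F y - (y - x) * F1 x - c / 2 * (y - x) ^+ 2.
pose G1 y := F1 y - F1 x - c * (y - x).
have dG y : x - h <= y <= x -> is_derive y (1 : R) G (G1 y).
  move=> hy; have dFy := dF _ hy.
  have d1 : is_derive y (1 : R) (fun y : R => y - x) 1.
    by rewrite -[X in is_derive _ _ _ X]subr0; exact: is_deriveB.
  have d2 : is_derive y (1 : R) (fun y : R => (y - x) * F1 x) (F1 x).
    have := @is_deriveM R R^o (fun y : R => y - x) (cst (F1 x)) y 1 _ _ d1 (is_derive_cst _ _ _).
    by rewrite scaler0 add0r /GRing.scale/= mulr1.
  have d3 : is_derive y (1 : R) (fun y : R => (y - x) ^+ 2) (2 * (y - x)).
    have := @is_deriveX R R^o (fun y : R => y - x) 2 y 1 _ d1.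
    by rewrite /GRing.scale/= mulr1 expr1.
  have d4 : is_derive y (1 : R) (fun y : R => c / 2 * (y - x) ^+ 2) (c * (y - x)).
    have := @is_deriveZ R R^o R^o _ (c / 2) y 1 _ d3.
    by rewrite /GRing.scale/= mulrA mulfVK.
  exact: is_deriveB (is_deriveB dFy d2) d4.
have hx : x - h < x by lra.
have [||z + e] := @MVT R G G1 _ _ hx.
- by move=> z; rewrite in_itv/= => /andP[? ?]; apply: dG; lra.
- apply: derivable_within_continuous => z; rewrite in_itv/= => /andP[? ?].
  by apply: ex_derive; apply: dG; lra.
rewrite in_itv/= => /andP[hz zx].
have G10 : 0 <= G1 z.
  rewrite /G1; have := lip z; rewrite (ltW hz) (ltW zx) => /(_ isT).
  by lra.
have : 0 <= G x - G (x - h) by rewrite e mulr_ge0//; lra.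
by rewrite /G; lra.
Qed.

Lemma taylor2_backward_ge (F F1 F2 : R -> R) (x h c : R) : 0 < h ->
  (forall y, x - h <= y <= x -> is_derive y (1 : R) F (F1 y)) ->
  (forall y, x - h <= y <= x -> is_derive y (1 : R) F1 (F2 y)) ->
  (forall y, x - h <= y <= x -> c <= F2 y) ->
  c * h ^+ 2 / 2 <= F (x - h) - F x + h * F1 x.
Proof.
move=> h0 dF dF1 F2c.
have := @taylor2_backward_le (- F) (- F1) (- F2) x h (- c) h0.
move=> /(_ (fun y H => is_deriveN (dF y H))) /(_ (fun y H => is_deriveN (dF1 y H))).
rewrite !fctE => H; have : forall y, x - h <= y <= x -> - F2 y <= - c.
  by move=> y hy; rewrite lerN2; exact: F2c.
by move/H; lra.
Qed.
End taylor2.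

(** * Integrals of powers of t - s *)

Section power_integral.
Variable R : realType.
Implicit Types a b c s t : R.
Notation leb := (@lebesgue_measure R).

Lemma lebesgue_oo_lty (a b : R) : (leb `]a, b[%classic < +oo)%E.
Proof. by rewrite lebesgue_measure_itv/=; case: ifP => _; rewrite ?ltry// -EFinB ltry. Qed.

Lemma measurable_powRB b t (D : set (measurableTypeR R)) :
  measurable_fun D (fun s : measurableTypeR R => (t - s) `^ b).
Proof.
apply: measurable_funTS; apply: (measurableT_comp (measurable_powR b)).
exact: measurable_funB.
Qed.

(** For [b < 0] and [c = t] the integrand is unbounded at the right end, which is why the
    fundamental theorem is needed on open intervals. *)
Lemma integral_powRB_oo b a c t : -1 < b -> a < c -> c <= t ->
  (\int[leb]_(s in `]a, c[) ((t - s) `^ b)%:E =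
   ((b + 1)^-1 * ((t - a) `^ (b + 1) - (t - c) `^ (b + 1)))%:E)%E.
Proof.
move=> b1 ac ct.
rewrite (@ge0_FTC2_oo R _ (fun s => - ((b + 1)^-1 * (t - s) `^ (b + 1))))//.
- by congr EFin; rewrite opprK mulrBr addrC.
- move=> x; rewrite in_itv/= => /andP[ax xc].
  by apply: is_derive_primitive_powRB; [rewrite gt_eqF|lra].
- move=> x; rewrite in_itv/= => /andP[ax xc].
  apply/differentiable_continuous/derivable1_diffP.
  by apply: ex_derive; apply: is_derive_powRB; lra.
- have := @within_continuous_powRB R (b + 1) t a c.
  have b10 : 0 < b + 1 by lra.
  move=> /(_ b10 ac ct) H x.
  apply: cvgN; apply: cvgMr; exact: H.
- by move=> x _; exact: powR_ge0.
Qed.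

Lemma integrable_powRB_oo b a c t : -1 < b -> a < c -> c <= t ->
  leb.-integrable `]a, c[ (EFin \o (fun s => (t - s) `^ b)).
Proof.
move=> b1 ac ct; apply/integrableP; split.
  by apply/measurable_EFinP; exact: measurable_powRB.
under eq_integral do rewrite /= ger0_norm ?powR_ge0//.
by rewrite integral_powRB_oo// ltry.
Qed.

(* The cutoff lets all the integrals below range over one fixed interval. *)
Definition cut (c b t s : R) := if s < c then (t - s) `^ b else 0.

Lemma cutE c b t s : cut c b t s = ((fun s => (t - s) `^ b) \_ `]-oo, c[) s.
Proof.
rewrite /cut patchE; case: ifPn => sc.
  by rewrite mem_set//= in_itv.
by rewrite memNset//= in_itv/=; exact/negP.
Qed.

Lemma cut_ge0 c b t s : 0 <= cut c b t s.
Proof. by rewrite /cut; case: ifP => // _; exact: powR_ge0. Qed.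

Lemma setI_oo_Ny (c T : R) : c <= T ->
  `]0, T[%classic `&` `]-oo, c[%classic = `]0, c[%classic.
Proof.
move=> cT; apply/seteqP; split => x /=; rewrite !in_itv/=.
  by move=> [/andP[-> _] ->].
by move=> /andP[-> xc]; split => //; exact: lt_le_trans xc cT.
Qed.

Variable T : R.

Lemma integrable_cut c b t : -1 < b -> 0 <= c <= t -> t <= T ->
  leb.-integrable `]0, T[ (EFin \o cut c b t).
Proof.
move=> b1 /andP[c0 ct] tT.
have -> : EFin \o cut c b t = (EFin \o (fun s => (t - s) `^ b)) \_ `]-oo, c[.
  by rewrite restrict_EFin; apply/funext => s /=; rewrite cutE.
apply/integrable_restrict => //; rewrite setI_oo_Ny ?(le_trans ct)//.
move: c0; rewrite le_eqVlt => /predU1P[<-|c0].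
  by rewrite set_itvoo0; exact: integrable_set0.
exact: integrable_powRB_oo.
Qed.

Lemma Rintegral_cut c b t : -1 < b -> 0 <= c <= t -> t <= T ->
  \int[leb]_(s in `]0, T[) cut c b t s =
  (b + 1)^-1 * (t `^ (b + 1) - (t - c) `^ (b + 1)).
Proof.
move=> b1 /andP[c0 ct] tT.
under eq_Rintegral do rewrite cutE.
rewrite -Rintegral_mkcondr setI_oo_Ny ?(le_trans ct)//.
move: c0; rewrite le_eqVlt => /predU1P[<-|c0].
  by rewrite set_itvoo0 Rintegral_set0 subr0 subrr mulr0.
by rewrite /Rintegral integral_powRB_oo// subr0.
Qed.

End power_integral.

(** * Convolution of a bounded density with a power *)

Section fractional_convolution.
Variable R : realType.
Implicit Types a b c s t h : R.
Notation leb := (@lebesgue_measure R).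
Variables (T M : R) (p : R -> R).
Let D : set (measurableTypeR R) := `]0, T[%classic.
Hypothesis mp : measurable_fun D (p : measurableTypeR R -> R).
Hypothesis p0 : forall s, 0 < s < T -> 0 <= p s.
Hypothesis pM : forall s, 0 < s < T -> p s <= M.

Let mD : measurable D. Proof. exact: measurable_itv. Qed.

(** Up to the factor Gamma(b + 1), the Riemann-Liouville fractional integral of order b + 1 of
    [p]. *)
Definition conv b t := \int[leb]_(s in D) (cut t b t s * p s).

(** Replaces unfolding once [conv] has been made opaque. *)
Lemma convE b t : conv b t = \int[leb]_(s in D) (cut t b t s * p s).
Proof. by []. Qed.

Lemma integrable_mulp (g : R -> R) : leb.-integrable D (EFin \o g) ->
  leb.-integrable D (EFin \o (fun s => g s * p s)).
Proof.
move=> gi; apply: (@integrable_domination _ _ _ leb D _ (fun s => M * `|g s|)) => //.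
- by apply: measurable_funM => //; exact: integrable_R_measurable gi.
- by apply: (integrable_RZl (mu := leb)) => //; exact: integrable_norm gi.
- move=> s; rewrite /D/= in_itv/= => sT; rewrite normrM mulrC.
  by apply: ler_wpM2r => //; rewrite ger0_norm; [exact: pM|exact: p0].
Qed.

Lemma integrable_conv b t : -1 < b -> 0 <= t <= T ->
  leb.-integrable D (EFin \o (fun s => cut t b t s * p s)).
Proof.
move=> b1 /andP[t0 tT]; apply: integrable_mulp; apply: integrable_cut => //.
by rewrite t0 lexx.
Qed.

Lemma M_ge0 : 0 < T -> 0 <= M.
Proof.
move=> T0; have hT : 0 < T / 2 < T by apply/andP; split; lra.
exact: le_trans (p0 hT) (pM hT).
Qed.

Lemma conv_holder b t t' : -1 < b <= 0 -> 0 <= t -> t <= t' -> t' <= T -> 0 < T ->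
  `|conv b t' - conv b t| <= M * (2 * ((b + 1)^-1 * (t' - t) `^ (b + 1))).
Proof.
move=> /andP[b1 b0] t0 tt' t'T T0.
have t'0 : 0 <= t' <= T by lra.
have tT : 0 <= t <= T by lra.
have b10 : 0 < b + 1 by lra.
(* [g] dominates the change of the kernel and has an explicit integral. For [s < t] the kernel
   decreases from [(t - s)^b] to [(t' - s)^b], as [b <= 0], and [g] is that decrease; for
   [t <= s < t'] it is the new kernel. Its integral is (b+1)^-1 (t^(b+1) - t'^(b+1) + 2
   (t'-t)^(b+1)), where the first two terms together are nonpositive. *)
pose g s := cut t b t s + cut t' b t' s - 2 * cut t b t' s.
have i1 : leb.-integrable D (EFin \o cut t b t) by apply: integrable_cut; lra.
have i2 : leb.-integrable D (EFin \o cut t' b t') by apply: integrable_cut; lra.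
have i3 : leb.-integrable D (EFin \o cut t b t') by apply: integrable_cut; lra.
have i3' := integrable_RZl 2 mD i3.
have i12 := integrable_RD mD i1 i2.
have ig : leb.-integrable D (EFin \o g) by exact: integrable_RB.
rewrite /conv -RintegralB//; [|exact: integrable_conv..].
have ile : leb.-integrable D
    (EFin \o (fun s => cut t' b t' s * p s - cut t b t s * p s)).
  by apply: integrable_RB => //; exact: integrable_conv.
apply: (le_trans (le_normr_Rintegral mD ile)).
apply: (@le_trans _ _ (\int[leb]_(s in D) (M * g s))).
  apply: le_Rintegral.
  - by [].
  - exact: integrable_norm ile.
  - exact: (integrable_RZl (mu := leb)).
  move=> s; rewrite /D/= in_itv/= => sT.
  rewrite -mulrBl normrM mulrC [ `|p s| ]ger0_norm ?p0//.
  have gs : `|cut t' b t' s - cut t b t s| <= g s.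
    rewrite /g /cut; case: ifPn => st'; last first.
      have -> : (s < t) = false by apply/negbTE; move: st'; rewrite -!leNgt; lra.
      by rewrite !(mulr0, subr0, addr0) normr0.
    case: ifPn => st; last first.
      by rewrite !(mulr0, subr0, add0r) ger0_norm// powR_ge0.
    have : (t' - s) `^ b <= (t - s) `^ b.
      by apply: le_powR_neg; lra.
    by move=> le; rewrite ler0_norm ?subr_le0//; lra.
  apply: ler_pM => //; [exact: p0|exact: pM].
rewrite RintegralZl//.
apply: ler_wpM2l; first exact: M_ge0.
rewrite /g RintegralB//.
rewrite RintegralD//.
rewrite RintegralZl//.
rewrite !Rintegral_cut//; try lra.
rewrite !subrr powR0 ?gt_eqF// !subr0 -mulrDr mulrCA -mulrBr mulrCA.
rewrite ler_pM2l ?invr_gt0//.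
have : t `^ (b + 1) <= t' `^ (b + 1) by apply: le_powR; lra.
by lra.
Qed.
End fractional_convolution.

(** A Riemann sum argument: the increments of [V] are added over a uniform partition of
    [[t - h, t]], with [Q] bounded at the left end of each step. Only the upper bound on increments
    by left-end values is used, neither the differentiability of [V] nor an integral of [Q]. *)
Lemma le_sub_of_left_slopes (R : realType) (V Q omega : R -> R) (t h e : R) :
  0 < h <= t -> 0 <= e ->
  (forall a b, 0 <= a -> a < b -> b <= t ->
    V b - V a <= (b - a) * (Q a + omega (b - a))) ->
  (forall a, 0 <= a <= t -> Q a <= Q t - e * (t - a)) ->
  omega (h / n.+1%:R) @[n --> \oo] --> (0 : R) ->
  V t - V (t - h) <= h * Q t - e * h ^+ 2 / 2.
Proof.
move=> /andP[h0 ht] e0 VQ Qe om0.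
have step n : V t - V (t - h) <= h * Q t - e * h ^+ 2 / 2 + h * omega (h / n.+1%:R).
  set dl := h / n.+1%:R; pose a (j : nat) := t - h + j%:R * dl.
  have n0 : (0 : R) < n.+1%:R by rewrite ltr0n.
  have dl0 : 0 < dl by rewrite divr_gt0.
  have dlh : n.+1%:R * dl = h by rewrite /dl mulrCA divff ?mulr1// gt_eqF.
  have aj (j : nat) : (j <= n.+1)%N -> a j <= t.
      move=> jn; have : j%:R * dl <= n.+1%:R * dl by rewrite ler_pM2r// ler_nat.
    by rewrite dlh /a; lra.
  (* The subtracted term is [e] times the sum of [dl * (h - i * dl)] over [i < j]. *)
  have main (j : nat) : (j <= n.+1)%N -> V (a j) - V (a 0%N) <=
      j%:R * dl * (Q t + omega dl) -
      e * (j%:R * dl * h - dl ^+ 2 * (j%:R * (j%:R - 1)) / 2).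
    elim: j => [_|j IH jn]; first by rewrite subrr !(mul0r, mulr0, subr0).
    have {}IH := IH (ltnW jn).
    have a0 : 0 <= a j.
      by rewrite /a addr_ge0 ?subr_ge0// mulr_ge0// ltW.
    have aS : a j.+1 = a j + dl by rewrite /a -natr1; ring.
    have := VQ (a j) (a j.+1) a0; rewrite {1}aS ltrDl => /(_ dl0 (aj _ jn)).
    have -> : a j.+1 - a j = dl by rewrite aS; ring.
    have : dl * Q (a j) <= dl * (Q t - e * (h - j%:R * dl)).
      rewrite ler_pM2l//; have := Qe (a j); rewrite a0 (aj _ (ltnW jn)) => /(_ isT).
      by have -> : t - a j = h - j%:R * dl by rewrite /a; ring.
    have -> : j.+1%:R = j%:R + 1 :> R by rewrite natr1.
    by move: (j%:R : R) IH => J IH; lra.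
  have := main n.+1 (leqnn _); rewrite /a mul0r addr0 dlh subrK.
  (* At [j = n.+1] that sum is [h^2 / 2 + h * dl / 2]; the excess over the triangle has the
     favourable sign and is dropped. *)
  have -> : dl ^+ 2 * (n.+1%:R * (n.+1%:R - 1)) = h * (h - dl).
    by rewrite -{1 2}dlh; ring.
  have : 0 <= e * h * dl by rewrite !mulr_ge0// ltW.
  by nra.
apply/ler_addgt0Pr => x x0.
have /cvgrPdist_lt/(_ (x / h)) := om0.
rewrite divr_gt0// => /(_ isT)[n _ /(_ n (leqnn _))].
rewrite sub0r normrN => omx.
apply: (le_trans (step n)); rewrite lerD2l.
have : omega (h / n.+1%:R) < x / h by exact: le_lt_trans (ler_norm _) omx.
by rewrite ltr_pdivlMr// mulrC => /ltW.
Qed.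

(** The point is a maximum point of the tilted function [Q t - e * t], which lies to the right of 0
    because the tilt is too small to cancel the positive value at [t1]. *)
Lemma left_second_difference (R : realType) (V Q omega : R -> R) (t1 : R) :
  0 < t1 -> {within `[0, t1], continuous Q} -> Q 0 = 0 -> 0 < Q t1 ->
  (forall a b, 0 <= a -> a < b -> b <= t1 ->
    V b - V a <= (b - a) * (Q a + omega (b - a))) ->
  (forall h, 0 < h -> omega (h / n.+1%:R) @[n --> \oo] --> (0 : R)) ->
  exists t e, [/\ 0 < t <= t1, 0 < e & forall h, 0 < h <= t ->
    e * h ^+ 2 / 2 <= h * Q t - (V t - V (t - h))].
Proof.
move=> t10 cQ Q0 Q1 VQ om0.
(* With this slope the tilted function equals [Q t1 / 2 > 0] at [t1] and vanishes at 0. *)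
pose e := Q t1 / (2 * t1).
have e0 : 0 < e by rewrite divr_gt0// mulr_gt0.
have cG : {within `[0, t1], continuous (fun t => Q t - e * t)}.
  move=> x; apply: cvgB; first exact: cQ.
  by apply: continuous_subspaceT => y; apply: cvgMr; exact: cvg_id.
have [t tt1 tmax] := EVT_max (ltW t10) cG.
have et1 : e * t1 = Q t1 / 2 by rewrite /e; field; rewrite gt_eqF.
have Gt : 0 < Q t - e * t.
  have := tmax t1; rewrite in_itv/= lexx ltW// => /(_ isT).
  by rewrite et1; lra.
move: tt1; rewrite in_itv/= => /andP[t0 tt1].
have t0' : 0 < t.
  rewrite lt_neqAle t0 andbT; apply/eqP => t00.
  by move: Gt; rewrite -t00 Q0 mulr0 subrr ltxx.
exists t, e; split => // [|h hT]; first by rewrite t0'.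
have H1 a b : 0 <= a -> a < b -> b <= t ->
    V b - V a <= (b - a) * (Q a + omega (b - a)).
  by move=> a0 ab bt; apply: VQ => //; exact: le_trans tt1.
have H2 a : 0 <= a <= t -> Q a <= Q t - e * (t - a).
  move=> /andP[a0 a_t]; have := tmax a; rewrite in_itv/= a0 (le_trans a_t)// => /(_ isT).
  by lra.
have [h0 _] := andP hT.
by have := le_sub_of_left_slopes hT (ltW e0) H1 H2 (om0 h h0); lra.
Qed.

(** * Second differences of the kernels and their limit *)

Section kernel.
Variables (R : realType) (alpha : R).
Hypothesis alpha01 : 0 < alpha < 1.

Let a1 : 1 - alpha != 0. Proof. by case/andP: alpha01 => ? ?; rewrite gt_eqF// subr_gt0. Qed.
Let a2 : 2 - alpha != 0. Proof. by case/andP: alpha01 => ? ?; rewrite gt_eqF//; lra. Qed.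

(* concavity of r^(1-alpha)/(1-alpha) *)
Lemma powR_increment (r h : R) : 0 < r -> 0 <= h ->
  (1 - alpha)^-1 * ((r + h) `^ (1 - alpha) - r `^ (1 - alpha)) <= h * r `^ (- alpha).
Proof.
move=> r0; rewrite le_eqVlt => /predU1P[<-|h0].
  by rewrite addr0 subrr mulr0 mul0r.
have rh : r < r + h by rewrite ltrDl.
have dF (y : R) : 0 < y -> is_derive y (1 : R)
    (fun y => (1 - alpha)^-1 * y `^ (1 - alpha)) (y `^ (- alpha)).
  move=> y0; have := @is_derive_primitive_powR R (- alpha) y.
  by rewrite addrC; apply => //; case/andP: alpha01 => ? ?; rewrite gt_eqF// ltrN2.
pose F (y : R) := (1 - alpha)^-1 * y `^ (1 - alpha).
pose f (y : R) := y `^ (- alpha).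
have [||z + e] := @MVT R F f r (r + h) rh.
- by move=> y; rewrite in_itv/= => /andP[ry _]; apply: dF; exact: lt_trans ry.
- apply: derivable_within_continuous => y; rewrite in_itv/= => /andP[ry _].
  by apply: ex_derive; apply: dF; exact: lt_le_trans ry.
rewrite in_itv/= => /andP[rz _].
rewrite mulrBr [leLHS]e addrAC subrr add0r mulrC ler_pM2l//.
by case/andP: alpha01 => ? ?; apply: le_powR_neg; lra.
Qed.

(* [kern] and [tent] are the second differences of the kernels of [fracV]: see
   [fracQV_kernel]. *)
Definition kern (h r : R) :=
  h * r `^ (- alpha) - (1 - alpha)^-1 * r `^ (1 - alpha) +
  (if h < r then (1 - alpha)^-1 * (r - h) `^ (1 - alpha) else 0).

Definition tent (h r : R) := h - r + (if h < r then r - h else 0).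

(** With F(y) = y^(1-alpha) / (1-alpha), [kern h r] is F(r - h) - F(r) + h F'(r), and F'' is
    increasing, so on [[r - h, r]] it lies between its end values. *)
Lemma kern_taylor (h r : R) : 0 < h -> h < r ->
  - (alpha * (r - h) `^ (- alpha - 1)) * h ^+ 2 / 2 <= kern h r <=
  - (alpha * r `^ (- alpha - 1)) * h ^+ 2 / 2.
Proof.
move=> h0 hr; rewrite /kern hr.
have a0 : 0 < alpha by case/andP: alpha01.
pose F (y : R) := (1 - alpha)^-1 * y `^ (1 - alpha).
pose F1 (y : R) := y `^ (- alpha).
pose F2 (y : R) := - (alpha * y `^ (- alpha - 1)).
have pos (y : R) : r - h <= y <= r -> 0 < y by move=> /andP[? _]; lra.
have dF (y : R) : r - h <= y <= r -> is_derive y (1 : R) F (F1 y).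
  move=> /pos y0; have := @is_derive_primitive_powR R (- alpha) y.
  by rewrite addrC; apply => //; case/andP: alpha01 => ? ?; rewrite gt_eqF// ltrN2.
have dF1 (y : R) : r - h <= y <= r -> is_derive y (1 : R) F1 (F2 y).
  by move=> /pos y0; have := is_derive1_powR (- alpha) y0; rewrite mulNr.
have mono (x y : R) : 0 < x -> x <= y -> F2 x <= F2 y.
  move=> x0 xy; rewrite /F2 lerN2 ler_pM2l//.
  by apply: le_powR_neg => //; lra.
have -> : h * r `^ (- alpha) - (1 - alpha)^-1 * r `^ (1 - alpha) +
    (1 - alpha)^-1 * (r - h) `^ (1 - alpha) = F (r - h) - F r + h * F1 r.
  by rewrite /F /F1; ring.
apply/andP; split.
  apply: (taylor2_backward_ge h0 dF dF1) => y /[dup] /pos y0 /andP[ry _].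
  by apply: mono => //; lra.
apply: (taylor2_backward_le h0 dF dF1) => y /[dup] /pos y0 /andP[_ yr].
exact: mono.
Qed.

Lemma kern_small (h r : R) : 0 < h -> 0 < r -> r <= 2 * h ->
  `|kern h r| <= (2 + 8 * (1 - alpha)^-1) * h ^+ 2 * r `^ (- alpha - 1).
Proof.
move=> h0 r0 rh; have [al0 al1] := andP alpha01.
have ia : 0 < (1 - alpha)^-1 by rewrite invr_gt0 subr_gt0.
have e1 : r `^ (- alpha) = r * r `^ (- alpha - 1) by rewrite -powRS// subrK.
have e2 : r `^ (1 - alpha) = r ^+ 2 * r `^ (- alpha - 1).
  by rewrite addrC powRS// e1 expr2 mulrA.
set P := r `^ (- alpha - 1) in e1 e2 *.
have P0 : 0 <= P by exact: powR_ge0.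
rewrite /kern e1 e2.
set X := if _ then _ else _.
have X0 : 0 <= X by rewrite /X; case: ifP => // _; rewrite mulr_ge0 ?powR_ge0// ltW.
have XU : X <= (1 - alpha)^-1 * (r ^+ 2 * P).
  rewrite /X; case: ifPn => hr; last by rewrite !mulr_ge0 ?sqr_ge0// ltW.
  by rewrite ler_pM2l// -e2; apply: le_powR; lra.
have r2 : r ^+ 2 * P <= 4 * h ^+ 2 * P by apply: ler_wpM2r => //; nra.
have hr2 : h * (r * P) <= 2 * h ^+ 2 * P by rewrite mulrA; apply: ler_wpM2r => //; nra.
have hr0 : 0 <= h * (r * P) by rewrite !mulr_ge0// ltW.
have rP0 : 0 <= r ^+ 2 * P by rewrite mulr_ge0// sqr_ge0.
rewrite ler_norml; apply/andP; split; nra.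
Qed.

(** Gives, uniformly in [h], the Caputo kernel as a majorant of [kern h r / h^2], as dominated
    convergence requires. *)
Lemma kern_bound : exists2 C : R, 0 < C & forall h r : R, 0 < h -> 0 < r ->
  `|kern h r| <= C * (h ^+ 2 * (alpha * r `^ (- alpha - 1))).
Proof.
have [al0 al1] := andP alpha01.
have ia : 0 < (1 - alpha)^-1 by rewrite invr_gt0 subr_gt0.
have iv : 0 < alpha^-1 by rewrite invr_gt0.
pose C1 := (2 + 8 * (1 - alpha)^-1) * alpha^-1.
(* For [r > 2 * h] one has [r - h >= r / 2], so this constant compares the power at [r - h] in
   [kern_taylor] with the power at [r]. *)
pose C2 : R := 2^-1 `^ (- alpha - 1).
have C10 : 0 < C1 by rewrite /C1 mulr_gt0//; lra.
have C20 : 0 < C2 by rewrite powR_gt0.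
exists (C1 + C2) => [|h r h0 r0]; first by rewrite addr_gt0.
have P0 : 0 <= r `^ (- alpha - 1) by exact: powR_ge0.
set P := r `^ (- alpha - 1) in P0 *.
have h2 : 0 < h ^+ 2 by rewrite exprn_gt0.
have B0 : 0 <= h ^+ 2 * (alpha * P) by rewrite !mulr_ge0// ltW.
have [rh|hr] := leP r (2 * h).
  apply: (le_trans (kern_small h0 r0 rh)); rewrite -/P [leRHS]mulrDl.
  have -> : C1 * (h ^+ 2 * (alpha * P)) = (2 + 8 * (1 - alpha)^-1) * h ^+ 2 * P.
    by rewrite /C1; field; rewrite a1 gt_eqF.
  by rewrite lerDl mulr_ge0// ltW.
have /(kern_taylor h0)/andP[lo up] : h < r by lra.
have : (r - h) `^ (- alpha - 1) <= C2 * P.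
  rewrite /C2 /P -powRM; [|lra..].
  by apply: le_powR_neg; lra.
set Z := (r - h) `^ _ in lo *; move=> ZP.
have : alpha * Z * h ^+ 2 <= alpha * (C2 * P) * h ^+ 2.
  by rewrite ler_pM2r// ler_pM2l.
have : 0 <= C1 * (h ^+ 2 * (alpha * P)) by rewrite mulr_ge0// ltW.
have : 0 <= C2 * (h ^+ 2 * (alpha * P)) by rewrite mulr_ge0// ltW.
rewrite -/P in up *; move=> ? ? ?.
by rewrite ler_norml; apply/andP; split; lra.
Qed.

End kernel.

Section dominated.
Context d (T : measurableType d) (R : realType).
Variable mu : {measure set T -> \bar R}.

Lemma Rintegral_dominated_cvg (D : set T) (f_ : nat -> T -> R) (f g : T -> R) :
  measurable D -> (forall n, measurable_fun D (f_ n)) -> measurable_fun D f ->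
  (forall x, D x -> f_ n x @[n --> \oo] --> f x) ->
  mu.-integrable D (EFin \o g) ->
  (forall n x, D x -> `|f_ n x| <= g x) ->
  \int[mu]_(x in D) f_ n x @[n --> \oo] --> \int[mu]_(x in D) f x.
Proof.
move=> mD mf_ mf f_f ig f_g.
have [] := @dominated_convergence _ _ _ mu D mD (fun n => EFin \o f_ n)
  (EFin \o f) (EFin \o g).
- by move=> n; exact/measurable_EFinP.
- exact/measurable_EFinP.
- apply: aeW => x Dx; apply: cvg_EFin; first exact: nearW.
  exact: f_f.
- exact: ig.
- by apply: aeW => x Dx n /=; rewrite lee_fin; exact: f_g.
move=> fi _ c; apply: fine_cvg.
by rewrite /Rintegral fineK//; exact: integrable_fin_num.
Qed.
End dominated.

Section kernel_limit.
Variables (R : realType) (alpha : R).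
Hypothesis alpha01 : 0 < alpha < 1.

Lemma kern_sub_tent_bound (Lam t : R) : 0 <= Lam -> 0 < t ->
  exists2 C : R, 0 <= C & forall h r : R, 0 < h -> 0 < r <= t ->
  `|kern alpha h r - Lam * tent h r| <= C * (h ^+ 2 * (alpha * r `^ (- alpha - 1))).
Proof.
move=> L0 t0; have [al0 al1] := andP alpha01.
have [C C0 CP] := kern_bound alpha01.
pose C' := Lam * (t `^ alpha * alpha^-1).
have C'0 : 0 <= C' by rewrite !mulr_ge0 ?powR_ge0 ?invr_ge0// ltW.
exists (C + C') => [|h r h0 /andP[r0 rt]]; first by rewrite addr_ge0// ltW.
apply: (le_trans (ler_normB _ _)); rewrite mulrDl; apply: lerD; first exact: CP.
rewrite normrM (ger0_norm L0) /C' -mulrA; apply: ler_wpM2l => //.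
have -> : t `^ alpha * alpha^-1 * (h ^+ 2 * (alpha * r `^ (- alpha - 1))) =
    h ^+ 2 * (t `^ alpha * r `^ (- alpha - 1)) by field; rewrite gt_eqF.
have P0 : 0 <= h ^+ 2 * (t `^ alpha * r `^ (- alpha - 1)).
  by rewrite mulr_ge0 ?sqr_ge0// mulr_ge0 ?powR_ge0.
rewrite /tent; case: ifPn => hr.
  by rewrite (_ : h - r + (r - h) = 0) ?normr0//; ring.
rewrite -leNgt in hr; rewrite addr0 ger0_norm ?subr_ge0//.
(* Here [r <= h], so [h - r <= h <= h^2 / r]; the factor 1/r is less singular than the Caputo
   kernel, and [r <= t] turns the spare power into the constant [t^alpha]. *)
apply: (@le_trans _ _ (h ^+ 2 * r^-1)).
  by rewrite ler_pdivlMr//; nra.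
rewrite ler_wpM2l ?sqr_ge0//.
have -> : r^-1 = r `^ alpha * r `^ (- alpha - 1).
  rewrite -powRD; last by apply/implyP => _; rewrite gt_eqF.
  by rewrite (_ : alpha + (- alpha - 1) = -1) ?powR_inv1 ?ltW//; ring.
by rewrite ler_wpM2r ?powR_ge0//; apply: le_powR => //; exact: ltW.
Qed.

(** Once [h n < r] the tent vanishes, and both Taylor bounds on [kern] divided by [h n ^+ 2] have
    the same limit. *)
Lemma kern_sub_tent_cvg (Lam r : R) (h : nat -> R) : 0 < r -> (forall n, 0 < h n) ->
  h n @[n --> \oo] --> (0 : R) ->
  (h n ^+ 2)^-1 * (kern alpha (h n) r - Lam * tent (h n) r) @[n --> \oo] -->
  - (alpha * r `^ (- alpha - 1)) / 2.
Proof.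
move=> r0 h0 hc; have [al0 al1] := andP alpha01.
have hr : \forall n \near \oo, h n < r.
  have /cvgrPdist_lt/(_ r r0) := hc; apply: filterS => n.
  by rewrite sub0r normrN gtr0_norm.
apply: (@squeeze_cvgr _ _ _ _ (fun n => - (alpha * (r - h n) `^ (- alpha - 1)) / 2)
  (fun=> - (alpha * r `^ (- alpha - 1)) / 2)).
- near=> n; have hn : h n < r by near: n.
  have hn0 := h0 n; have [/andP[lo up]] := kern_taylor alpha01 hn0 hn.
  have -> : tent (h n) r = 0 by rewrite /tent hn; ring.
  rewrite mulr0 subr0 [X in _ <= X <= _]mulrC.
  by rewrite ler_pdivlMr ?exprn_gt0// ler_pdivrMr ?exprn_gt0//; apply/andP; split; lra.
- apply: cvgMl; apply: cvgN; apply: cvgMr.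
  have ct : r - h n @[n --> \oo] --> r.
    by rewrite -[X in _ --> X]subr0; apply: cvgB => //; exact: cvg_cst.
  exact: (cvg_comp _ _ ct (@continuous_powR R (- alpha - 1) r r0)).
- exact: cvg_cst.
Unshelve. all: by end_near.
Qed.
End kernel_limit.

(** * The constant density 1 *)

Section cst1.
Variable R : realType.
Notation leb := (@lebesgue_measure R).

Lemma conv_cst1 (T b t : R) : -1 < b -> 0 <= t <= T ->
  conv T (cst 1) b t = (b + 1)^-1 * t `^ (b + 1).
Proof.
move=> b1 /andP[t0 tT]; rewrite /conv.
under eq_Rintegral do rewrite mulr1.
rewrite Rintegral_cut ?t0 ?lexx// subrr powR0 ?subr0// gt_eqF//.
by rewrite -ltrBlDr sub0r.
Qed.

(** The left-hand side is h Q(t) - (V(t) - V(t - h)) for the density 1. Its fractional part is a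
    second-order Taylor remainder of a double primitive of y^-alpha, which is at most (t - h)^-alpha
    on the step; the part with [Lam] is quadratic and exact. *)
Lemma second_primitive_bound (alpha Lam t h : R) : 0 < alpha < 1 -> 0 < h < t ->
  h * ((1 - alpha)^-1 * t `^ (1 - alpha) - Lam * t) -
  ((1 - alpha)^-1 * ((2 - alpha)^-1 * t `^ (2 - alpha)) - Lam * (2^-1 * t ^+ 2) -
   ((1 - alpha)^-1 * ((2 - alpha)^-1 * (t - h) `^ (2 - alpha)) -
    Lam * (2^-1 * (t - h) ^+ 2)))
  <= h ^+ 2 / 2 * ((t - h) `^ (- alpha) - Lam).
Proof.
move=> /andP[al0 al1] /andP[h0 ht].
pose F (y : R) := (1 - alpha)^-1 * ((2 - alpha)^-1 * y `^ (2 - alpha)).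
pose F1 (y : R) := (1 - alpha)^-1 * y `^ (1 - alpha).
pose F2 (y : R) := y `^ (- alpha).
have dF (y : R) : 0 < y -> is_derive y (1 : R) F (F1 y).
  move=> y0; have := @is_derive_primitive_powR R (1 - alpha) y.
  have -> : 1 - alpha + 1 = 2 - alpha by ring.
  move=> /(_ (_ : 1 - alpha != -1) y0) H.
  by apply: (@is_deriveZ R R^o R^o); apply: H; rewrite gt_eqF//; lra.
have dF1 (y : R) : 0 < y -> is_derive y (1 : R) F1 (F2 y).
  move=> y0; have := @is_derive_primitive_powR R (- alpha) y.
  by rewrite addrC; apply => //; rewrite gt_eqF// ltrN2.
have pos (y : R) : t - h <= y <= t -> 0 < y by move=> /andP[? _]; lra.
have := @taylor2_backward_le R F F1 F2 t h ((t - h) `^ (- alpha)) h0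
  (fun y H => dF y (pos y H)) (fun y H => dF1 y (pos y H)).
have H2 (y : R) : t - h <= y <= t -> F2 y <= (t - h) `^ (- alpha).
  by move=> /andP[hy _]; apply: le_powR_neg; lra.
move=> /(_ H2); rewrite /F /F1.
set A := _ * (_ * t `^ _); set B := _ * (_ * (t - h) `^ _); set C := _ * t `^ _.
set E := (t - h) `^ _; lra.
Qed.
End cst1.

(** * The space L_2 *)

Section square_integrable.
Context d (T : measurableType d) (R : realType).
Variable mu : {measure set T -> \bar R}.
Implicit Types f g : T -> R.
Let nm f := fine ('N[mu]_2%:E[EFin \o f])%E.

Lemma Lfun2_measurable f : f \in Lfun mu 2%:E -> measurable_fun setT f.
Proof. by rewrite inE => /andP[/[!inE]/=]. Qed.

Lemma Lfun2_fin_norm f : f \in Lfun mu 2%:E -> ('N[mu]_2%:E[EFin \o f] < +oo)%E.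
Proof. by rewrite inE => /andP[_ /[!inE]/=]. Qed.

Lemma Lfun2_mul_integrable f g : f \in Lfun mu 2%:E -> g \in Lfun mu 2%:E ->
  mu.-integrable setT (EFin \o (fun x => f x * g x)).
Proof. by move=> f2 g2; apply/Lfun1_integrable; exact: Lfun2_mul_Lfun1. Qed.

Lemma Rintegral_sqr_Lnorm f : f \in Lfun mu 2%:E ->
  \int[mu]_x (f x * f x) = nm f ^+ 2.
Proof.
move=> f2; have := powR_Lnorm mu (EFin \o f) (_ : 2 != 0 :> R).
move=> /(_ (lt0r_neq0 (ltr0n _ 2))).
have Nfin : ('N[mu]_2%:E[EFin \o f] \is a fin_num)%E.
  by rewrite ge0_fin_numE ?Lnorm_ge0//; exact: Lfun2_fin_norm.
rewrite -(fineK Nfin) -/(nm f) poweR_EFin powR_mulrn; last by rewrite fine_ge0 ?Lnorm_ge0.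
move=> e; rewrite /Rintegral -[RHS]/(fine (nm f ^+ 2)%:E) e; congr fine.
apply: eq_integral => x _ /=.
by rewrite powR_mulrn// -normrX ger0_norm ?sqr_ge0// expr2.
Qed.

Lemma Rintegral_mul_le_Lnorm f g : f \in Lfun mu 2%:E -> g \in Lfun mu 2%:E ->
  `|\int[mu]_x (f x * g x)| <= nm f * nm g.
Proof.
move=> f2 g2; have ifg := Lfun2_mul_integrable f2 g2.
have fin h : h \in Lfun mu 2%:E -> ('N[mu]_2%:E[EFin \o h] \is a fin_num)%E.
  by move=> h2; rewrite ge0_fin_numE ?Lnorm_ge0//; exact: Lfun2_fin_norm.
apply: (le_trans (le_normr_Rintegral measurableT ifg)).
have := hoelder mu (Lfun2_measurable f2) (Lfun2_measurable g2)
  (ltr0n _ 2 : 0 < 2 :> R) (ltr0n _ 2 : 0 < 2 :> R).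
move=> /(_ _) h.
have {h} := h (_ : 2^-1 + 2^-1 = 1); have -> : 2^-1 + 2^-1 = 1 :> R by field.
move=> /(_ erefl); rewrite Lnorm1 -(fineK (fin f f2)) -(fineK (fin g g2)) -EFinM => h.
rewrite /Rintegral -[leRHS]/(fine (nm f * nm g)%:E); apply: fine_le => //.
by apply: integrable_fin_num => //; exact: integrable_norm ifg.
Qed.
End square_integrable.

Section L2_space.
Variables (R : realType) (d : nat) (Omega : set 'rV[R]_d).
Local Notation X := 'rV[R]_d.
Local Notation mu := (lebesgue_rV R d).
Local Notation L2 := (L2 Omega).
Local Notation L2norm := (L2norm Omega).
Local Notation L2inner := (L2inner Omega).
Implicit Types (v w z : X -> R) (k : R).

Let le12 : (1 <= 2%:E :> \bar R)%E. Proof. by rewrite lee_fin ler1n. Qed.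

Lemma L2D v w : L2 v -> L2 w -> L2 (fun x => v x + w x).
Proof.
rewrite /L2 => v2 w2.
have -> : (fun x => v x + w x) \_ Omega = (v \_ Omega) + (w \_ Omega).
  by apply/funext => x; rewrite !fctE !patchE; case: ifP => // _; rewrite addr0.
exact: (Lfun_addr_closed mu le12).2.
Qed.

Lemma L2Z k v : L2 v -> L2 (fun x => k * v x).
Proof.
rewrite /L2 => v2.
have -> : (fun x => k * v x) \_ Omega = k \o* (v \_ Omega).
  by apply/funext => x; rewrite /= !patchE; case: ifP => // _; rewrite ?mul0r// mulrC.
by apply: Lfun_scale => //; rewrite ler1n.
Qed.

Lemma L2N v : L2 v -> L2 (fun x => - v x).
Proof.
move=> v2; have := L2Z (-1) v2.
by congr L2; apply/funext => x; rewrite mulN1r.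
Qed.

Lemma L2B v w : L2 v -> L2 w -> L2 (fun x => v x - w x).
Proof. by move=> v2 w2; apply: L2D => //; exact: L2N. Qed.

Lemma L2_0 : L2 (cst 0).
Proof.
rewrite /L2 (_ : cst 0 \_ Omega = 0); first exact: (Lfun_addr_closed mu le12).1.
by apply/funext => x; rewrite patchE; case: ifP.
Qed.

Lemma L2norm_ge0 v : 0 <= L2norm v.
Proof. by rewrite /L2norm fine_ge0 ?Lnorm_ge0. Qed.

Lemma L2innerE v w : L2inner v w = \int[mu]_x ((v \_ Omega) x * (w \_ Omega) x).
Proof.
rewrite /L2inner Rintegral_mkcond; apply: eq_Rintegral => x _.
by rewrite !patchE; case: ifP => // _; rewrite mulr0.
Qed.

Lemma L2inner_integrable v w : L2 v -> L2 w ->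
  mu.-integrable setT (EFin \o (fun x => (v \_ Omega) x * (w \_ Omega) x)).
Proof. exact: Lfun2_mul_integrable. Qed.

Lemma L2inner_sym v w : L2inner v w = L2inner w v.
Proof. by rewrite !L2innerE; apply: eq_Rintegral => x _; rewrite mulrC. Qed.

Lemma L2inner_self v : L2 v -> L2inner v v = L2norm v ^+ 2.
Proof. by move=> v2; rewrite L2innerE Rintegral_sqr_Lnorm. Qed.

Lemma L2inner_le v w : L2 v -> L2 w -> `|L2inner v w| <= L2norm v * L2norm w.
Proof. by move=> v2 w2; rewrite L2innerE; exact: Rintegral_mul_le_Lnorm. Qed.

Lemma L2innerDl v w z : L2 v -> L2 w -> L2 z ->
  L2inner (fun x => v x + w x) z = L2inner v z + L2inner w z.
Proof.
move=> v2 w2 z2; rewrite !L2innerE -RintegralD//; [|exact: L2inner_integrable..].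
apply: eq_Rintegral => x _; rewrite !patchE; case: ifP => // _; first by rewrite mulrDl.
by rewrite !mulr0 addr0.
Qed.

Lemma L2innerZl k v z : L2 v -> L2 z ->
  L2inner (fun x => k * v x) z = k * L2inner v z.
Proof.
move=> v2 z2; rewrite !L2innerE -RintegralZl//; last exact: L2inner_integrable.
apply: eq_Rintegral => x _; rewrite !patchE; case: ifP => // _; first by rewrite mulrA.
by rewrite !mulr0.
Qed.

Lemma L2innerBl v w z : L2 v -> L2 w -> L2 z ->
  L2inner (fun x => v x - w x) z = L2inner v z - L2inner w z.
Proof.
move=> v2 w2 z2; rewrite -[- L2inner w z]mulN1r -L2innerZl// -L2innerDl//; last exact: L2Z.
by congr L2inner; apply/funext => x; rewrite mulN1r.
Qed.

Lemma L2normZ k v : L2 v -> L2norm (fun x => k * v x) = `|k| * L2norm v.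
Proof.
move=> v2; apply/eqP; rewrite -(@eqrXn2 _ 2)// ?mulr_ge0 ?L2norm_ge0//.
rewrite exprMn -L2inner_self; last exact: L2Z.
rewrite -L2inner_self// L2innerZl//; last exact: L2Z.
by rewrite L2inner_sym L2innerZl// mulrA -expr2 real_normK// num_real.
Qed.

Lemma L2normD v w : L2 v -> L2 w ->
  L2norm (fun x => v x + w x) <= L2norm v + L2norm w.
Proof.
move=> v2 w2; have vw2 := L2D v2 w2.
rewrite -(@ler_pXn2r _ 2)// ?nnegrE ?addr_ge0 ?L2norm_ge0//.
rewrite -L2inner_self// L2innerDl// !(L2inner_sym _ (fun x => _ + _)) !L2innerDl//.
rewrite !L2inner_self// (L2inner_sym w v).
have := le_trans (ler_norm _) (L2inner_le v2 w2).
by move: (L2inner v w) (L2norm v) (L2norm w) => a b c; lra.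
Qed.

Lemma L2normN v : L2 v -> L2norm (fun x => - v x) = L2norm v.
Proof.
move=> v2; rewrite -[RHS]mul1r -[1]normr1 -normrN -L2normZ//.
by congr L2norm; apply/funext => x; rewrite mulN1r.
Qed.

Lemma L2normB v w : L2 v -> L2 w ->
  L2norm (fun x => v x - w x) <= L2norm v + L2norm w.
Proof. by move=> v2 w2; rewrite -(L2normN w2); apply: L2normD => //; exact: L2N. Qed.

Lemma L2norm_distC v w : L2 v -> L2 w ->
  L2norm (fun x => v x - w x) = L2norm (fun x => w x - v x).
Proof.
move=> v2 w2; rewrite -L2normN; last exact: L2B.
by congr L2norm; apply/funext => x; rewrite opprB.
Qed.

Lemma L2norm_dist v w : L2 v -> L2 w ->
  `|L2norm v - L2norm w| <= L2norm (fun x => v x - w x).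
Proof.
move=> v2 w2.
have key v' w' : L2 v' -> L2 w' -> L2norm v' - L2norm w' <= L2norm (fun x => v' x - w' x).
  move=> v2' w2'; rewrite lerBlDr.
  rewrite (_ : v' = (fun x => (v' x - w' x) + w' x)); last by apply/funext => x; rewrite subrK.
  rewrite [leRHS](_ : _ = L2norm (fun x => v' x - w' x) + L2norm w'); last first.
    by congr (L2norm _ + _); apply/funext => x; rewrite addrK.
  by apply: L2normD => //; exact: L2B.
rewrite ler_norml key// andbT lerNl opprB.
by rewrite L2norm_distC//; exact: key.
Qed.

Lemma L2_ae_eq v w : L2 v -> L2 w -> (\forall x \ae mu, Omega x -> v x = w x) ->
  L2norm (fun x => v x - w x) = 0.
Proof.
move=> v2 w2 vw; have vw2 := L2B v2 w2.
apply/eqP; rewrite -(@eqrXn2 _ 2) ?L2norm_ge0// expr0n/= -L2inner_self// L2innerE.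
apply/eqP; rewrite /Rintegral (ae_eq_integral (cst 0%E))//.
- by rewrite integral0.
- exact: measurable_int (L2inner_integrable vw2 vw2).
- apply: filterS vw => x vw _ /=; rewrite patchE; case: ifPn => [/set_mem Ox|_].
    by rewrite vw// subrr mulr0.
  by rewrite mulr0.
Qed.

End L2_space.

(** * Test functions and H^1_0 *)

Section measurable_rV_topology.
Variables (R : realType) (d : nat).
Local Notation X := 'rV[R]_d.
Implicit Types (U : set X).

(** The sigma-algebra is generated by the coordinates, so an open set is written as a countable
    union of boxes with rational centres and half-sides 1/(n+1). *)
Lemma open_measurable_rV U : open U -> measurable U.
Proof.
move=> oU.
pose box (q : 'rV[rat]_d) (n : nat) : set X :=
  [set v | forall i, `]ratr (q ord0 i) - n.+1%:R^-1, ratr (q ord0 i) + n.+1%:R^-1[%classic (v ord0 i)].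
have mbox q n : measurable (box q n).
  by apply: (@measurable_box R d (fun i => `]ratr (q ord0 i) - n.+1%:R^-1,
    ratr (q ord0 i) + n.+1%:R^-1[%classic)) => i; exact: measurable_itv.
pose B (k : nat) : set X :=
  if @unpickle ('rV[rat]_d * nat)%type k is Some qn then
    if `[< box qn.1 qn.2 `<=` U >] then box qn.1 qn.2 else set0
  else set0.
have -> : U = \bigcup_k B k.
  apply/seteqP; split => [x Ux|x [k _]]; last first.
    rewrite /B; case: unpickle => // -[q n] /=; case: asboolP => // + bx.
    exact.
  have /nbhs_ballP[e /= e0 xeU] : nbhs x U by exact: open_nbhs_nbhs.
  (* Half of [e], because a point of the box is reached from [x] through the rational centre, at the
     cost of two half-sides. *)
  have [n ne] : exists n : nat, n.+1%:R^-1 < e / 2.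
    have /cvgrPdist_lt/(_ (e / 2)) := @cvg_harmonic R.
    rewrite divr_gt0// => /(_ isT)[n _ /(_ n (leqnn _))].
    by rewrite sub0r normrN ger0_norm ?invr_ge0// => ?; exists n.
  have qP i : {q : rat | x ord0 i - n.+1%:R^-1 < ratr q < x ord0 i + n.+1%:R^-1}.
    apply/cid; have n0 : 0 < n.+1%:R^-1 :> R by rewrite invr_gt0.
    have /rat_in_itvoo[q] : x ord0 i - n.+1%:R^-1 < x ord0 i + n.+1%:R^-1.
      by rewrite ltrBlDr -addrA ltrDl addr_gt0.
    by rewrite in_itv/= => ?; exists q.
  pose q : 'rV[rat]_d := \row_i projT1 (qP i).
  have qE i : x ord0 i - n.+1%:R^-1 < ratr (q ord0 i) < x ord0 i + n.+1%:R^-1.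
    by rewrite mxE; exact: projT2 (qP i).
  exists (pickle (q, n)) => //; rewrite /B pickleK /=.
  case: asboolP => [_ i /=|[]].
    have /andP[h1 h2] := qE i.
    by rewrite in_itv/= ltrBlDr h2/= -ltrBlDr.
  move=> y yb; apply: xeU; split => // j i; rewrite ord1 /ball/=.
  have := yb i; rewrite /= in_itv/= => /andP[h1 h2]; have /andP[h3 h4] := qE i.
  move: h1 h2 h3 h4 ne; move: (ratr _) (x _ _) (y _ _) (n.+1%:R^-1) => r a b c *.
  by rewrite ltr_norml; apply/andP; split; lra.
apply: bigcupT_measurable => k; rewrite /B; case: unpickle => // -[q n] /=.
by case: asboolP.
Qed.

Lemma continuous_measurable_rV (f : X -> R) :
  continuous f -> measurable_fun setT f.
Proof.
move=> /continuousP cf; apply: (measurability _ (RGenOpens.measurableE R)).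
move=> _ [_ [a [b ->] <-]]; rewrite setTI; apply: open_measurable_rV.
exact/cf/interval_open.
Qed.

End measurable_rV_topology.

Section test_functions.
Variables (R : realType) (d : nat) (Omega : set 'rV[R]_d).
Local Notation X := 'rV[R]_d.
Local Notation mu := (lebesgue_rV R d).
Local Notation L2 := (L2 Omega).
Local Notation L2norm := (L2norm Omega).
Local Notation L2inner := (L2inner Omega).
Implicit Types (v w phi psi : X -> R) (g h : 'I_d -> X -> R).

Lemma bounded_set_lebesgue_lty (K : set X) : bounded_set K ->
  exists B : set X, [/\ measurable B, K `<=` B & (mu B < +oo)%E].
Proof.
move=> [M [_ /(_ (M + 1))]]; rewrite ltrDl ltr01 => /(_ isT) KM.
exists [set v | forall i, `[- (M + 1), M + 1]%classic (v ord0 i)]; split.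
- apply: (@measurable_box R d (fun=> `[- (M + 1), M + 1]%classic)) => i.
  exact: measurable_itv.
- move=> x Kx i /=; rewrite in_itv/= -ler_norml.
  apply: le_trans (KM _ Kx).
  rewrite [leRHS]/Num.Def.normr/= mx_normrE.
  by apply/bigmax_geP; right => /=; exists (ord0, i).
- rewrite (@lebesgue_rV_box R d (fun=> `[- (M + 1), M + 1]%classic)); last first.
    by move=> i; exact: measurable_itv.
  suff /andP[] : (0 <= \prod_(i < d) lebesgue_measure `[(- (M + 1))%R, (M + 1)%R] < +oo)%E by [].
  apply: (big_ind (fun z : \bar R => (0 <= z < +oo)%E)).
  - by rewrite lee_fin ler01 ltry.
  - move=> y z /andP[y0 yoo] /andP[z0 zoo].
    by rewrite mule_ge0//= lte_mul_pinfty// ge0_fin_numE.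
  move=> i _; rewrite measure_ge0/=.
  by rewrite lebesgue_measure_itv/=; case: ifP => _; rewrite ?ltry// -EFinB ltry.
Qed.

Lemma continuous_compact_support_L2 v : continuous v ->
  compact (closure [set x | v x != 0]) -> closure [set x | v x != 0] `<=` Omega ->
  L2 v.
Proof.
set K := closure _ => cv cK KO.
have v0 x : ~ K x -> v x = 0.
  by move=> Kx; apply/eqP/negP => /negP vx; apply: Kx; exact: subset_closure.
have vE : v \_ Omega = v.
  apply/funext => x; rewrite patchE; case: ifPn => // /negP Ox.
  by rewrite v0// => /KO Ox'; apply: Ox; rewrite inE.
have [B [mB KB Boo]] := bounded_set_lebesgue_lty (compact_bounded cK).
have [M vM] : exists M, forall x, `|v x| <= M.
  have /compact_bounded[M [_ /(_ (M + 1))]] : compact (v @` K).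
    apply: continuous_compact => //; exact: continuous_subspaceT.
  rewrite ltrDl ltr01 => /(_ isT) HM.
  exists (Num.max (M + 1) 0) => x; rewrite le_max.
  have [Kx|/v0 ->] := pselect (K x); last by rewrite normr0 lexx orbT.
  by apply/orP; left; apply: HM; exists x.
have mv : measurable_fun setT v by exact: continuous_measurable_rV.
rewrite /L2 vE inE; apply/andP; split; rewrite inE//=.
rewrite /finite_norm unlock; apply: poweR_lty => /=.
apply: (@le_lt_trans _ _ (\int[mu]_x ((M ^+ 2)%:E * (\1_B x)%:E))%E).
  apply: ge0_le_integral => //.
  - by apply/measurable_EFinP; apply: (measurableT_comp (measurable_powR _)); exact: measurableT_comp.
  - by apply/measurable_EFinP; apply: measurable_funM.
  - move=> x _; rewrite powR_mulrn// -EFinM lee_fin indicE.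
    have [Bx|Bx] := pselect (B x).
      rewrite mem_set// mulr1 ler_pXn2r ?nnegrE//; exact: le_trans (vM x).
    by rewrite memNset// mulr0 v0 ?normr0 ?expr0n// => /KB.
rewrite ge0_integralZl//.
- by rewrite integral_indic// setIT lte_mul_pinfty// lee_fin sqr_ge0.
- exact/measurable_EFinP.
- by rewrite lee_fin sqr_ge0.
Qed.

Lemma partialB (i : 'I_d) v w x : derivable v x (delta_mx ord0 i) ->
  derivable w x (delta_mx ord0 i) ->
  partial i (fun y => v y - w y) x = partial i v x - partial i w x.
Proof. by move=> dv dw; rewrite /partial -deriveB. Qed.

Lemma test_function_partialB phi psi (s : seq 'I_d) :
  test_function Omega phi -> test_function Omega psi ->
  foldr (@partial R d) (fun x => phi x - psi x) s =
  (fun x => foldr (@partial R d) phi s x - foldr (@partial R d) psi s x).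
Proof.
move=> [_ dphi _ _] [_ dpsi _ _]; elim: s => [//|i s IH] /=.
by rewrite IH; apply/funext => x; rewrite partialB.
Qed.

Lemma test_functionB phi psi : test_function Omega phi ->
  test_function Omega psi -> test_function Omega (fun x => phi x - psi x).
Proof.
move=> tphi tpsi; have fE s := test_function_partialB s tphi tpsi.
case: tphi => c1 d1 k1 s1; case: tpsi => c2 d2 k2 s2.
have sub : closure [set x | phi x - psi x != 0] `<=`
    closure [set x | phi x != 0] `|` closure [set x | psi x != 0].
  rewrite -closureU; apply: closure_subset => x /=.
  by have [->|] := eqVneq (phi x) 0; [rewrite sub0r oppr_eq0; right|left].
split.
- by move=> s; rewrite fE => x; have h1 := c1 s x; have h2 := c2 s x; exact: (cvgB h1 h2).
- by move=> s i x; rewrite fE; have h1 := d1 s i x; have h2 := d2 s i x; exact: (derivableB h1 h2).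
- apply: (subclosed_compact (@closed_closure _ _) _ sub).
  exact: compactU.
- by move=> x /sub[/s1|/s2].
Qed.

Lemma test_function_L2 phi : test_function Omega phi -> L2 phi.
Proof.
by move=> [c _ k s]; apply: continuous_compact_support_L2 => //; exact: (c [::]).
Qed.

(** Off the closed support the function is locally zero, so the derivative has its support in the
    same compact set. *)
Lemma test_function_partial_L2 phi i : test_function Omega phi -> L2 (partial i phi).
Proof.
move=> [c dd k s].
have sub : [set x | partial i phi x != 0] `<=` closure [set x | phi x != 0].
  move=> x /= px; apply: contrapT => nx; move/negP: px; apply.
  have near0 : \forall y \near x, phi y = cst 0 y.
    have oC : open (~` closure [set x | phi x != 0]) by exact: closed_openC (@closed_closure _ _).
    have : nbhs x (~` closure [set x | phi x != 0]) by exact: open_nbhs_nbhs.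
    apply: filterS => y ny; apply/eqP/negP => /negP py; apply: ny.
    exact: subset_closure.
  apply/eqP; rewrite /partial (@near_eq_derive _ _ _ _ (cst 0) x _ near0).
  exact: derive_cst.
have sub' : closure [set x | partial i phi x != 0] `<=` closure [set x | phi x != 0].
  by move=> x /(closure_subset sub); exact: (@closed_closure _ _).
apply: continuous_compact_support_L2.
- exact: (c [:: i]).
- exact: (subclosed_compact (@closed_closure _ _) k sub').
- exact: subset_trans s.
Qed.

Lemma weak_gradientB v w g h : L2 v -> L2 w -> (forall i, L2 (g i)) ->
  (forall i, L2 (h i)) -> weak_gradient Omega v g -> weak_gradient Omega w h ->
  weak_gradient Omega (fun x => v x - w x) (fun i x => g i x - h i x).
Proof.
move=> v2 w2 g2 h2 vg wh i phi tphi.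
have p2 := test_function_L2 tphi; have dp2 := test_function_partial_L2 i tphi.
by rewrite !L2innerBl// vg// wh//; ring.
Qed.

(** Makes the error at a fixed time an admissible test function in both residual equations; the
    approximating test functions are subtracted term by term. *)
Lemma H10B v w g h : H10 Omega v g -> H10 Omega w h ->
  H10 Omega (fun x => v x - w x) (fun i x => g i x - h i x).
Proof.
move=> [[v2 g2 vg] [phi [tphi phiv phig]]] [[w2 h2 wh] [psi [tpsi psiw psih]]].
have cvg_sum (a b : nat -> X -> R) (y z : X -> R) : (forall k, L2 (a k)) ->
    (forall k, L2 (b k)) -> L2 y -> L2 z ->
    L2norm (a k \- y) @[k --> \oo] --> 0 -> L2norm (b k \- z) @[k --> \oo] --> 0 ->
    L2norm ((fun x => a k x - b k x) \- (fun x => y x - z x)) @[k --> \oo] --> 0.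
  move=> a2 b2 y2 z2 ay bz.
  apply: (@squeeze_cvgr _ _ _ _ (fun=> 0) (fun k => L2norm (a k \- y) + L2norm (b k \- z))).
  - apply: nearW => k; rewrite L2norm_ge0/=.
    rewrite (_ : _ \- _ = (fun x => (a k x - y x) - (b k x - z x))); last first.
      by apply/funext => x /=; ring.
    by apply: L2normB; exact: L2B.
  - exact: cvg_cst.
  - by rewrite -[X in _ --> X]addr0; exact: cvgD.
split.
  split; [exact: L2B|by move=> i; exact: L2B|exact: weak_gradientB].
exists (fun k x => phi k x - psi k x); split.
- by move=> k; exact: test_functionB.
- by apply: cvg_sum => // k; exact: test_function_L2.
- move=> i; have pE k : partial i (fun x => phi k x - psi k x) =
      (fun x => partial i (phi k) x - partial i (psi k) x).
    exact: (test_function_partialB [:: i] (tphi k) (tpsi k)).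
  under eq_fun do rewrite pE.
  by apply: cvg_sum => // k; exact: test_function_partial_L2.
Qed.

End test_functions.

(** * Linearity of the elliptic form *)

Section pairing_bilinear.
Variables (R : realType) (d : nat) (Omega : set 'rV[R]_d) (L : operator R d).
Local Notation X := 'rV[R]_d.
Local Notation mu := (lebesgue_rV R d).
Local Notation L2 := (L2 Omega).
Hypothesis mO : measurable Omega.
Implicit Types (v w a : X -> R) (g h : 'I_d -> X -> R).

Lemma L2_measurable v : L2 v -> measurable_fun Omega v.
Proof. by move=> /Lfun2_measurable mv; apply/(measurable_restrictT _ mO). Qed.

Lemma L2_mul_integrable v w : L2 v -> L2 w ->
  mu.-integrable Omega (EFin \o (fun x => v x * w x)).
Proof.
move=> v2 w2; apply/integrable_mkcond => //; rewrite restrict_EFin.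
rewrite (_ : _ \_ _ = (fun x => (v \_ Omega) x * (w \_ Omega) x)).
  exact: L2inner_integrable.
by apply/funext => x; rewrite !patchE; case: ifP => // _; rewrite mulr0.
Qed.

Lemma Linf_mul_integrable a v w : Linf Omega a -> L2 v -> L2 w ->
  mu.-integrable Omega (EFin \o (fun x => a x * v x * w x)).
Proof.
move=> [ma [M aM]] v2 w2.
have ma' : measurable_fun Omega a by apply/(measurable_restrictT _ mO).
have mv := L2_measurable v2; have mw := L2_measurable w2.
have ivw := integrable_RZl `|M| mO (integrable_norm (L2_mul_integrable v2 w2)).
have mavw : measurable_fun Omega (fun x => a x * v x * w x).
  by apply: measurable_funM => //; apply: measurable_funM.
apply/integrableP; split; first exact/measurable_EFinP.
have [_ /= fin] := integrableP _ _ _ ivw.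
apply: le_lt_trans fin; apply: ae_ge0_le_integral => //=.
- by apply/measurable_EFinP; exact: measurableT_comp.
- by apply/measurable_EFinP; apply: measurableT_comp => //; exact: integrable_R_measurable ivw.
- apply: filterS aM => x aM Ox; rewrite lee_fin -mulrA normrM [leRHS]normrM.
  by rewrite normr_id normr_id ler_wpM2r// (le_trans (aM Ox))// ler_norm.
Qed.

Definition pairing_density v g w h x : R :=
  \sum_i (\sum_j op_a L i j x * g j x + op_e L i x * v x) * h i x
     + (\sum_i op_b L i x * g i x + op_c L x * v x) * w x.

Lemma integrable_Rsum (I : finType) (F : I -> X -> R) :
  (forall i, mu.-integrable Omega (EFin \o F i)) ->
  mu.-integrable Omega (EFin \o (fun x => \sum_i F i x)).
Proof.
move=> iF.
have -> : EFin \o (fun x => \sum_i F i x) = (fun x => \sum_i (F i x)%:E)%E.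
  by apply/funext => x /=; rewrite sumEFin.
by apply: (integrable_sum mO) => i _; exact: iF.
Qed.

Lemma pairing_density_integrable v g w h : elliptic Omega L ->
  L2 v -> (forall i, L2 (g i)) -> L2 w -> (forall i, L2 (h i)) ->
  mu.-integrable Omega (EFin \o pairing_density v g w h).
Proof.
move=> [La Le Lb Lc _] v2 g2 w2 h2.
have -> : pairing_density v g w h = (fun x =>
    \sum_i (\sum_j op_a L i j x * g j x * h i x + op_e L i x * v x * h i x)
     + (\sum_i op_b L i x * g i x * w x + op_c L x * v x * w x)).
  apply/funext => x; rewrite /pairing_density; congr (_ + _).
    by apply: eq_bigr => i _; rewrite mulrDl mulr_suml.
  by rewrite mulrDl mulr_suml.
apply: integrable_RD => //.
  apply: integrable_Rsum => i; apply: integrable_RD => //.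
    by apply: integrable_Rsum => j; exact: Linf_mul_integrable.
  exact: Linf_mul_integrable.
apply: integrable_RD => //; last exact: Linf_mul_integrable.
by apply: integrable_Rsum => i; exact: Linf_mul_integrable.
Qed.

Lemma pairingB v1 v2 g1 g2 w h : elliptic Omega L ->
  L2 v1 -> L2 v2 -> (forall i, L2 (g1 i)) -> (forall i, L2 (g2 i)) ->
  L2 w -> (forall i, L2 (h i)) ->
  pairing Omega L (fun x => v1 x - v2 x) (fun i x => g1 i x - g2 i x) w h =
  pairing Omega L v1 g1 w h - pairing Omega L v2 g2 w h.
Proof.
move=> eL v1L v2L g1L g2L wL hL.
have i1 := pairing_density_integrable eL v1L g1L wL hL.
have i2 := pairing_density_integrable eL v2L g2L wL hL.
rewrite -[RHS](RintegralB mO i1 i2) /pairing; apply: eq_Rintegral => x _.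
rewrite /pairing_density opprD addrACA -sumrB -mulrBl; congr (_ + _ * _).
  apply: eq_bigr => i _; rewrite -mulrBl; congr (_ * _).
  by rewrite opprD addrACA -sumrB -mulrBr; congr (_ + _); apply: eq_bigr => j _; rewrite mulrBr.
by rewrite opprD addrACA -sumrB -mulrBr; congr (_ + _); apply: eq_bigr => j _; rewrite mulrBr.
Qed.

End pairing_bilinear.

(** * Bochner integrals *)

Section lower_integral.
Context d (T : measurableType d) (R : realType).
Variable mu : {measure set T -> \bar R}.
Local Open Scope ereal_scope.
Import HBNNSimple.

(* [g] need not be measurable: the integral of a nonnegative function is the
   supremum of the integrals of the simple functions below it. *)
Lemma le_integral_nonmeasurable (D : set T) (f g : T -> \bar R) :
  measurable D -> measurable_fun D f ->
  (forall x, D x -> 0 <= f x) -> (forall x, D x -> 0 <= g x) ->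
  (\forall x \ae mu, D x -> f x <= g x) ->
  \int[mu]_(x in D) f x <= \int[mu]_(x in D) g x.
Proof.
move=> mD mf f0 g0 [N [mN N0 fgN]].
rewrite (ge0_negligible_integral _ _ _ _ N0)//.
rewrite !ge0_integralE//; last by move=> x [/f0].
apply: le_ereal_sup => _ [k kf <-]; exists k => // x.
apply: (le_trans (kf x)); rewrite !patchE.
case: ifPn => [/set_mem[Dx Nx]|_].
  rewrite mem_set//; apply: contrapT => nfg; apply: Nx; apply: fgN => /=.
  by move=> /(_ Dx).
by case: ifPn => // /set_mem /g0.
Qed.
End lower_integral.

Lemma ae_combine (R : realType) (P Q S : R -> Prop) :
  (forall s, P s -> Q s -> S s) ->
  (\forall s \ae @lebesgue_measure R, P s) -> (\forall s \ae @lebesgue_measure R, Q s) ->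
  \forall s \ae @lebesgue_measure R, S s.
Proof.
move=> PQS [N1 [m1 z1 s1]] [N2 [m2 z2 s2]]; exists (N1 `|` N2); split.
- exact: measurableU.
- by rewrite null_set_setU.
- move=> s /= nS; have [Ps|nP] := pselect (P s); last by left; exact: s1.
  by right; apply: s2 => /= Qs; apply: nS; exact: PQS.
Qed.

Section bochner_pairing.
Variables (R : realType) (d : nat) (Omega : set 'rV[R]_d).
Local Notation X := 'rV[R]_d.
Local Notation leb := (@lebesgue_measure R).
Local Notation L2 := (L2 Omega).
Local Notation L2norm := (L2norm Omega).
Local Notation L2inner := (L2inner Omega).
Implicit Types (F G : R -> X -> R) (phi w : X -> R).

Lemma L2_sum (n : nat) (c : 'I_n -> R) (v : 'I_n -> X -> R) :
  (forall i, L2 (v i)) -> L2 (fun x => \sum_i c i * v i x).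
Proof.
elim: n c v => [|n IH] c v v2.
  rewrite (_ : (fun x => _) = cst 0); first exact: L2_0.
  by apply/funext => x; rewrite big_ord0.
under eq_fun do rewrite big_ord_recl.
by apply: L2D; [exact: L2Z|exact: IH].
Qed.

Lemma L2inner_suml (n : nat) (c : 'I_n -> R) (v : 'I_n -> X -> R) phi :
  (forall i, L2 (v i)) -> L2 phi ->
  L2inner (fun x => \sum_i c i * v i x) phi = \sum_i c i * L2inner (v i) phi.
Proof.
move=> + p2; elim: n c v => [|n IH] c v v2.
  rewrite big_ord0 (_ : (fun x => _) = (fun x => 0 * phi x)).
    by rewrite L2innerZl// mul0r.
  by apply/funext => x; rewrite big_ord0 mul0r.
rewrite big_ord_recl -IH// -L2innerZl// -L2innerDl//; [|exact: L2Z|exact: L2_sum].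
by congr L2inner; apply/funext => x; rewrite big_ord_recl.
Qed.

Lemma sf_fun_L2 (S : simple_function Omega) s : L2 (sf_fun S s).
Proof. by apply: L2_sum; exact: sf_L2. Qed.

Lemma sf_integral_L2 a b (S : simple_function Omega) : L2 (sf_integral a b S).
Proof. by apply: L2_sum; exact: sf_L2. Qed.

Lemma sf_inner_integral (a b : R) (S : simple_function Omega) phi : L2 phi ->
  leb.-integrable `]a, b[ (EFin \o (fun s => L2inner (sf_fun S s) phi)) /\
  \int[leb]_(s in `]a, b[) L2inner (sf_fun S s) phi = L2inner (sf_integral a b S) phi.
Proof.
move=> p2.
pose I : set (measurableTypeR R) := `]a, b[%classic.
have mI : measurable I by exact: measurable_itv.
have Ioo : (leb I < +oo)%E by exact: lebesgue_oo_lty.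
have fE : (fun s => L2inner (sf_fun S s) phi) =
    (fun s => \sum_i \1_(sf_set (s := S) i) s * L2inner (sf_val (s := S) i) phi).
  by apply/funext => s; rewrite L2inner_suml//; exact: sf_L2.
have i1 i : leb.-integrable I (EFin \o (\1_(sf_set (s := S) i) : measurableTypeR R -> R)).
  apply: (@bounded_integrable _ _ _ leb I _ 1) => //.
    by apply: measurable_indic; exact: sf_measurable.
  by move=> s _; rewrite indicE; case: (_ \in _); rewrite ?normr1 ?normr0.
have i2 i : leb.-integrable I
    (EFin \o (fun s => \1_(sf_set (s := S) i) s * L2inner (sf_val (s := S) i) phi)).
  have := integrable_RZl (L2inner (sf_val (s := S) i) phi) mI (i1 i).
  by congr (_.-integrable _ _); apply/funext => s /=; rewrite mulrC.
rewrite fE L2inner_suml//; last by move=> i; exact: sf_L2.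
split.
  have -> : EFin \o (fun s => \sum_i \1_(sf_set (s := S) i) s * L2inner (sf_val (s := S) i) phi) =
    (fun s => \sum_i (\1_(sf_set (s := S) i) s * L2inner (sf_val (s := S) i) phi)%:E)%E.
    by apply/funext => s /=; rewrite sumEFin.
  by apply: (integrable_sum mI) => i _; exact: i2.
rewrite /Rintegral; under eq_integral do rewrite -sumEFin.
rewrite (integral_sum mI)//.
under eq_bigr => i _ do rewrite -(fineK (integrable_fin_num mI (i2 i))).
rewrite sumEFin /=; apply: eq_bigr => i _.
transitivity (\int[leb]_(s in I) (\1_(sf_set (s := S) i) s * L2inner (sf_val (s := S) i) phi)) => //.
rewrite (RintegralZr _ mI (i1 i)); congr (_ * _).
by rewrite /Rintegral integral_indic//; exact: sf_measurable.
Qed.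

(** The only access to Bochner integrals in what follows. A lower bound suffices: applied to [phi]
    and to its opposite it gives the value of the pairing, and applied to the opposite of the
    integral it gives a norm estimate. *)
Lemma bochner_integral_ge (a b : R) F w phi (c : R -> R) :
  bochner_integral Omega a b F w -> L2 phi ->
  leb.-integrable `]a, b[ (EFin \o c) ->
  (\forall s \ae leb, a < s < b -> c s <= L2inner (F s) phi) ->
  \int[leb]_(s in `]a, b[) c s <= L2inner w phi.
Proof.
move=> [[F2 _] w2 [S [SF Sw]]] p2 ic cF.
pose I : set (measurableTypeR R) := `]a, b[%classic.
have mI : measurable I by exact: measurable_itv.
(* The added 1 allows division by [C] even when [phi] has norm 0. The tolerance [e / (C + C)] then
   leaves [e / 2] for each of the two errors, that of the simple function and that of its
   integral. *)
pose C := L2norm phi + 1.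
have C0 : 0 < C by rewrite ltr_wpDl ?L2norm_ge0.
apply/ler_addgt0Pr => e e0.
have e1 : 0 < e / (C + C) by rewrite divr_gt0// addr_gt0.
have [k [nuk dk]] : exists k,
    (\int[leb]_(s in `]a, b[) (L2norm (sf_fun (S k) s \- F s))%:E <= (e / (C + C))%:E)%E /\
    L2norm (sf_integral a b (S k) \- w) <= e / (C + C).
  have : \forall k \near \oo,
      (\int[leb]_(s in `]a, b[) (L2norm (sf_fun (S k) s \- F s))%:E <= (e / (C + C))%:E)%E.
    have nb : nbhs 0%E [set x : \bar R | (x <= (e / (C + C))%:E)%E].
      apply: filterS (_ : nbhs 0%E [set x : \bar R | (x < (e / (C + C))%:E)%E]).
        by move=> x /= /ltW.
      by apply: open_nbhs_nbhs; split; [exact: open_ereal_lt_ereal|rewrite /= lte_fin].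
    exact: (SF _ nb).
  have : \forall k \near \oo, L2norm (sf_integral a b (S k) \- w) <= e / (C + C).
    have /cvgrPdist_le/(_ _ e1) := Sw; apply: filterS => k.
    by rewrite sub0r normrN ger0_norm ?L2norm_ge0.
  move=> [n1 _ H1] [n2 _ H2]; exists (maxn n1 n2); split.
    by apply: H2 => /=; exact: leq_maxr.
  by apply: H1 => /=; exact: leq_maxl.
have [id_ idE] := sf_inner_integral a b (S k) p2.
pose dd s := L2inner (sf_fun (S k) s) phi.
have icd := integrable_RB mI ic id_.
pose q s := Num.max (c s - dd s) 0.
have mq : measurable_fun I (q : measurableTypeR R -> R).
  by apply: measurable_maxr => //; exact: integrable_R_measurable icd.
have iq : leb.-integrable I (EFin \o q).
  apply: (integrable_domination mI mq (integrable_norm icd)) => s _ /=.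
  rewrite /q ger0_norm ?le_max ?lexx ?orbT//.
  by rewrite ge_max ler_norm normr_ge0.
have le1 : \int[leb]_(s in I) c s - \int[leb]_(s in I) dd s <= \int[leb]_(s in I) q s.
  rewrite -[leLHS](RintegralB mI ic id_); apply: (le_Rintegral mI icd iq) => s _.
  by rewrite /q le_max lexx.
have le2 : \int[leb]_(s in I) q s <= C * (e / (C + C)).
  have iq' := integrable_RZl C^-1 mI iq.
  rewrite -ler_pdivrMl// -[leLHS](RintegralZl C^-1 mI iq).
  rewrite -lee_fin /Rintegral fineK; last exact: integrable_fin_num.
  apply: le_trans nuk; apply: le_integral_nonmeasurable => //.
  - exact: measurable_int iq'.
  - by move=> s _; rewrite lee_fin mulr_ge0 ?invr_ge0 ?(ltW C0)// /q le_max lexx orbT.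
  - by move=> s _; rewrite lee_fin L2norm_ge0.
  - apply: (ae_combine _ F2 cF) => s F2s cFs; rewrite /I/= in_itv/= => sab.
    have {F2s}F2 := F2s sab; have {cFs}cF := cFs sab.
    have S2 := sf_fun_L2 (S k) s.
    rewrite lee_fin ler_pdivrMl// /q ge_max mulr_ge0 ?(ltW C0) ?L2norm_ge0// andbT.
    apply: (@le_trans _ _ (L2inner (F s) phi - dd s)); first by rewrite lerD2r.
    rewrite /dd -L2innerBl//.
    apply: (le_trans (ler_norm _)); apply: (le_trans (L2inner_le (L2B F2 S2) p2)).
    rewrite L2norm_distC// mulrC ler_wpM2r ?L2norm_ge0//.
    by rewrite /C lerDl.
have le3 : \int[leb]_(s in I) dd s - L2inner w phi <= C * (e / (C + C)).
  rewrite [X in X - _ <= _]idE -L2innerBl//; last exact: sf_integral_L2.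
  apply: (le_trans (ler_norm _)).
  apply: (le_trans (L2inner_le (L2B (sf_integral_L2 a b (S k)) w2) p2)).
  rewrite mulrC; apply: ler_pM; rewrite ?L2norm_ge0//.
  by rewrite /C lerDl.
have eC : C * (e / (C + C)) = e / 2.
  have C2 : C + C != 0 by rewrite gt_eqF// addr_gt0.
  apply: (mulIf C2); rewrite mulrA mulfVK//.
  by field.
rewrite eC in le2 le3; move: le1 le2 le3; rewrite -/I.
move: (\int[leb]_(s in I) c s) (\int[leb]_(s in I) dd s) (\int[leb]_(s in I) q s) (L2inner w phi).
by move=> x1 x2 x3 x4; lra.
Qed.

End bochner_pairing.

(** * Regular functions of time *)

Section tame.
Variables (R : realType) (alpha T : R).
Hypothesis alpha01 : 0 < alpha < 1.
Hypothesis T0 : 0 < T.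
Notation leb := (@lebesgue_measure R).
Implicit Types (h : R -> R) (s t : R).

(** What regularity in time leaves for scalar functions such as norms and inner products with a
    fixed element. The Lipschitz constant may blow up as [eps] tends to 0, and the value at 0 is
    unrestricted, so a jump there is allowed. *)
Definition tame h := (exists B, forall s, 0 < s <= T -> `|h s| <= B) /\
  forall eps, 0 < eps < T -> exists M, forall s t, eps <= s -> s < t -> t <= T ->
    `|h t - h s| <= M * (t - s).

Lemma tame_continuous h : tame h -> {in `]0, T[, continuous h}.
Proof.
move=> [_ hl] x; rewrite in_itv/= => /andP[x0 xT].
have [|M HM] := hl (x / 2); first by apply/andP; split; lra.
have M0 : 0 < `|M| + 1 by rewrite ltr_wpDl.
apply/cvgrPdist_le => e e0; near=> y.
have y1 : x / 2 < y.
  by near: y; apply: lt_nbhsr; lra.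
have y2 : y < T by near: y; exact: lt_nbhsl.
have yx : `|x - y| <= e / (`|M| + 1).
  near: y; apply/nbhs_ballP; exists (e / (`|M| + 1)); first by rewrite /= divr_gt0.
  by move=> z /= /ltW.
have HM' s t : x / 2 <= s -> s < t -> t <= T -> `|h t - h s| <= (`|M| + 1) * (t - s).
  move=> xs st tT; apply: (le_trans (HM _ _ xs st tT)).
  rewrite ler_wpM2r//; first by rewrite subr_ge0 ltW.
  by rewrite (le_trans (ler_norm _))// lerDl.
apply: (@le_trans _ _ ((`|M| + 1) * `|x - y|)); last by rewrite mulrC -ler_pdivlMr.
have [xy|yx'|->] := ltgtP x y.
- have yx0 : 0 <= y - x by rewrite subr_ge0 ltW.
  by rewrite distrC (distrC x) (ger0_norm yx0); apply: HM' => //; lra.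
- have xy0 : 0 <= x - y by rewrite subr_ge0 ltW.
  by rewrite (ger0_norm xy0); apply: HM' => //; lra.
- by rewrite !subrr normr0 mulr0.
Unshelve. all: by end_near.
Qed.

Lemma tame_measurable h : tame h ->
  measurable_fun (`]0, T[%classic : set (measurableTypeR R)) (h : measurableTypeR R -> R).
Proof.
move=> th; apply: open_continuous_measurable_fun => // x.
by rewrite inE; exact: tame_continuous.
Qed.

(** On [[t / 2, t[] the Lipschitz bound lowers the singularity to the integrable [(t - s)^-alpha];
    on []0, t / 2[] the power is bounded and boundedness of [h] is enough. *)
Lemma caputo_kernel_integrable h t : tame h -> 0 < t <= T ->
  leb.-integrable `]0, t[ (EFin \o caputo_kernel alpha h t).
Proof.
move=> th /andP[t0 tT]; have mh := tame_measurable th.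
have [al0 al1] := andP alpha01.
pose I : set (measurableTypeR R) := `]0, t[%classic.
have mI : measurable I by exact: measurable_itv.
have [[B HB] hl] := th.
have [|M HM] := hl (t / 2); first by apply/andP; split; lra.
have B0 : 0 <= B by apply: le_trans (HB t _); rewrite ?normr_ge0 ?t0.
pose g s := alpha * `|M| * (t - s) `^ (- alpha) + alpha * (t / 2) `^ (- alpha - 1) * (B + B).
have ig : leb.-integrable I (EFin \o g).
  apply: (integrable_RD mI).
    apply: (integrable_RZl _ mI); apply: integrable_powRB_oo => //.
    by rewrite ltrN2.
  apply: (@bounded_integrable _ _ _ leb I _ `|alpha * (t / 2) `^ (- alpha - 1) * (B + B)|) => //.
  exact: lebesgue_oo_lty.
apply: (integrable_domination mI _ ig).
  rewrite /caputo_kernel; apply: measurable_funM.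
    by apply: measurable_funM; [exact: measurable_cst|exact: measurable_powRB].
  apply: measurable_funB; first exact: measurable_cst.
  apply: measurable_funS mh => // s; rewrite /I/= !in_itv/= => /andP[-> st].
  exact: lt_le_trans tT.
move=> s; rewrite /I/= in_itv/= => /andP[s0 st].
have P0 r : 0 <= r `^ (- alpha - 1) by exact: powR_ge0.
have G1 : 0 <= alpha * `|M| * (t - s) `^ (- alpha) by rewrite !mulr_ge0 ?powR_ge0// ltW.
have G2 : 0 <= alpha * (t / 2) `^ (- alpha - 1) * (B + B).
  by rewrite !mulr_ge0 ?addr_ge0// ltW.
rewrite /caputo_kernel normrM normrM (ger0_norm (ltW al0)) (ger0_norm (P0 _)) /g.
have [ts|ts] := leP (t / 2) s.
  apply: ler_wpDr => //.
  apply: (@le_trans _ _ (alpha * (t - s) `^ (- alpha - 1) * (`|M| * (t - s)))).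
    apply: ler_wpM2l; first by rewrite mulr_ge0// ltW.
    apply: (le_trans (HM _ _ ts st tT)).
    by rewrite ler_wpM2r ?ler_norm// subr_ge0 ltW.
  have -> : (t - s) `^ (- alpha) = (t - s) * (t - s) `^ (- alpha - 1).
    by rewrite -powRS ?subr_gt0// subrK.
  by rewrite [leLHS](_ : _ = alpha * `|M| * ((t - s) * (t - s) `^ (- alpha - 1)))//; ring.
apply: ler_wpDl => //; apply: ler_pM => //.
- by rewrite mulr_ge0// ltW.
- by apply: ler_wpM2l; [exact: ltW|apply: le_powR_neg; lra].
- apply: (le_trans (ler_normB _ _)); apply: lerD; apply: HB; first by rewrite t0.
  by rewrite s0 ltW// (lt_le_trans st).
Qed.

End tame.

Section regular_functions.
Variables (R : realType) (d : nat) (Omega : set 'rV[R]_d) (T : R).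
Local Notation X := 'rV[R]_d.
Local Notation leb := (@lebesgue_measure R).
Local Notation L2 := (L2 Omega).
Local Notation L2norm := (L2norm Omega).
Local Notation L2inner := (L2inner Omega).
Implicit Types (v : R -> X -> R) (phi : X -> R).
Hypothesis T0 : 0 < T.

(** The increment [w] is the integral of the bounded derivative [G]. Testing it with [- w], the sign
    that [bochner_integral_ge] calls for, bounds [L2norm w ^+ 2] by [L2norm w] times the claimed
    quantity. *)
Lemma regular_lipschitz v : regular Omega T v ->
  forall eps, 0 < eps < T -> exists M, forall s t, eps <= s -> s < t -> t <= T ->
    L2norm (fun x => v t x - v s x) <= M * (t - s).
Proof.
have T0' := T0; move=> [_ rv _] eps /andP[e0 eT].
have [_ [_ [G [_ [M GM]] HG]]] := rv eps T e0 eT (lexx T).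
exists `|M| => s t es st tT.
have b := HG s t es st tT; have [[G2 _] w2 _] := b.
set w := (fun x => _) in w2 *; rewrite -/w.
have nw2 : L2 (fun x => - w x) by exact: L2N.
pose c : R -> R := cst (- (L2norm w * `|M|)).
have mI : measurable (`]s, t[%classic : set (measurableTypeR R)) by exact: measurable_itv.
have ic : leb.-integrable `]s, t[ (EFin \o c).
  apply: (@bounded_integrable _ _ _ leb _ _ (`| (L2norm w * `|M|) |)) => //.
  - exact: lebesgue_oo_lty.
  - exact: measurable_cst.
  - by move=> ? _; rewrite /c/= normrN.
have := bochner_integral_ge b nw2 ic.
have H : \forall s' \ae leb, s < s' < t -> c s' <= L2inner (G s') (fun x => - w x).
  apply: (ae_combine _ G2 GM) => s' G2s GMs ss't.
  have G2' := G2s ss't.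
  have := L2inner_le G2' nw2; rewrite L2normN// ler_norml => /andP[+ _].
  apply: le_trans; rewrite /c/= lerN2 mulrC ler_wpM2l ?L2norm_ge0//.
  have : eps < s' < T by case/andP: ss't => ? ?; apply/andP; split; lra.
  by move/GMs => /le_trans; apply; exact: ler_norm.
move=> /(_ H); rewrite (Rintegral_cst leb mI).
have -> : fine (leb `]s, t[%classic) = t - s.
  by rewrite lebesgue_measure_itv/= lte_fin st -EFinD.
rewrite (_ : L2inner _ _ = - L2norm w ^+ 2); last first.
  rewrite L2inner_sym (_ : (fun x => - w x) = (fun x => -1 * w x)).
    by rewrite L2innerZl// L2inner_self// mulN1r.
  by apply/funext => x; rewrite mulN1r.
rewrite mulNr lerN2 expr2 -mulrA.
have := L2norm_ge0 Omega w; rewrite le_eqVlt => /predU1P[<- _|w0].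
  by rewrite mulr_ge0// subr_ge0 ltW.
by rewrite ler_pM2l.
Qed.

Lemma ae_exists_between (P : R -> Prop) (a b : R) : a < b ->
  (\forall s \ae leb, P s) -> exists2 s, a < s < b & P s.
Proof.
move=> ab [N [mN N0 PN]]; apply: contrapT => nP.
have : (leb `]a, b[%classic <= leb N)%E.
  apply: le_measure; rewrite ?inE//.
  move=> s; rewrite /= in_itv/= => sab; apply: PN => /= Ps; apply: nP.
  by exists s.
by rewrite N0 lebesgue_measure_itv/= lte_fin ab -EFinD lee_fin subr_le0 leNgt ab.
Qed.

(** [Linf_time] controls only almost every time. Any [t] has a controlled time [s] within
    [(|K| + 1)^-1] to its left, over which the norm grows by at most 1. The constant [K] depends on
    [t], but the resulting bound [M + 1] does not. *)
Lemma regular_bounded v : regular Omega T v ->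
  exists B, forall s, 0 < s <= T -> L2norm (v s) <= B.
Proof.
have T0' := T0; move=> rv; have [v2 rv' _] := rv.
have hT1 : 0 < T / 2 by rewrite divr_gt0.
have hT2 : T / 2 < T by rewrite ltr_pdivrMr// ltr_pMr// ltr1n.
have [[_ [M vM]] _] := rv' (T / 2) T hT1 hT2 (lexx T); exists (M + 1) => t /andP[t0 tT].
have [|K HK] := regular_lipschitz rv (_ : 0 < t / 2 < T); first by apply/andP; split; lra.
have K0 : 0 < `|K| + 1 by rewrite ltr_wpDl.
pose a := Num.max (t / 2) (t - (`|K| + 1)^-1).
have at_ : a < t by rewrite /a gt_max; apply/andP; split; [lra|rewrite gtrBl invr_gt0].
have [s /andP[as_ st] Ms] := ae_exists_between at_ vM.
have s1 : t / 2 <= s by apply: ltW; apply: le_lt_trans as_; rewrite le_max lexx.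
have s2 : t - s <= (`|K| + 1)^-1.
  rewrite lerBlDr -lerBlDl; apply: ltW; apply: le_lt_trans as_.
  by rewrite le_max lexx orbT.
have vs : L2 (v s) by apply: v2; lra.
have vt : L2 (v t) by apply: v2; lra.
rewrite -lerBlDl; apply: (@le_trans _ _ (L2norm (v t) - L2norm (v s))).
  by rewrite lerB//; apply: Ms; lra.
apply: (le_trans (ler_norm _)); apply: (le_trans (L2norm_dist vt vs)).
apply: (le_trans (HK s t s1 st tT)).
apply: (@le_trans _ _ ((`|K| + 1) * (`|K| + 1)^-1)); last by rewrite divff// gt_eqF.
apply: (@le_trans _ _ ((`|K| + 1) * (t - s))).
  rewrite ler_wpM2r//; first by rewrite subr_ge0 ltW.
  by rewrite (le_trans (ler_norm _))// lerDl.
by rewrite ler_pM2l.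
Qed.

Lemma regular_tame_inner v phi : regular Omega T v -> L2 phi ->
  tame T (fun s => L2inner (v s) phi).
Proof.
have T0' := T0; move=> rv p2; have [v2 _ _] := rv; split.
  have [B HB] := regular_bounded rv; exists (B * L2norm phi) => s sT.
  have vs : L2 (v s) by apply: v2; case/andP: sT => /ltW -> ->.
  by apply: (le_trans (L2inner_le vs p2)); rewrite ler_wpM2r ?L2norm_ge0// HB.
move=> eps eT; have [M HM] := regular_lipschitz rv eT.
exists (M * L2norm phi) => s t es st tT; case/andP: eT => e0 _.
have vs : L2 (v s) by apply: v2; apply/andP; split; lra.
have vt : L2 (v t) by apply: v2; apply/andP; split; lra.
rewrite -L2innerBl//; apply: (le_trans (L2inner_le (L2B vt vs) p2)).
by rewrite mulrAC ler_wpM2r ?L2norm_ge0// HM.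
Qed.

Lemma regular_tame_dist v w : regular Omega T v -> regular Omega T w ->
  tame T (fun s => L2norm (fun x => v s x - w s x)).
Proof.
have T0' := T0; move=> rv rw; have [v2 _ _] := rv; have [w2 _ _] := rw; split.
  have [B HB] := regular_bounded rv; have [C HC] := regular_bounded rw.
  exists (B + C) => s sT; rewrite ger0_norm ?L2norm_ge0//.
  have s0T : 0 <= s <= T by case/andP: sT => /ltW -> ->.
  by apply: (le_trans (L2normB (v2 _ s0T) (w2 _ s0T))); apply: lerD; [exact: HB|exact: HC].
move=> eps eT; have [M HM] := regular_lipschitz rv eT.
have [N HN] := regular_lipschitz rw eT.
exists (M + N) => s t es st tT; case/andP: eT => e0 _.
have vs : L2 (v s) by apply: v2; apply/andP; split; lra.
have vt : L2 (v t) by apply: v2; apply/andP; split; lra.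
have ws : L2 (w s) by apply: w2; apply/andP; split; lra.
have wt : L2 (w t) by apply: w2; apply/andP; split; lra.
apply: (le_trans (L2norm_dist (L2B vt wt) (L2B vs ws))).
rewrite (_ : (fun x => _) = (fun x => (v t x - v s x) - (w t x - w s x))); last first.
  by apply/funext => x; ring.
apply: (le_trans (L2normB (L2B vt vs) (L2B wt ws))).
by rewrite mulrDl; apply: lerD; [exact: HM|exact: HN].
Qed.

End regular_functions.

(** * The Caputo derivative and the energy inequality *)

(** As [fine] sends an infinite integral to 0, positivity requires finiteness. The integrand is
    dominated by [s^(x-1)] on []0, 1[] and, as [x < 1], by [expR (- s)] on [[1, +oo[]. *)
Lemma Gamma_gt0 (R : realType) (x : R) : 0 < x < 1 -> 0 < Gamma x.
Proof.
move=> /andP[x0 x1]; rewrite /Gamma.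
set leb := lebesgue_measure.
pose f s : R := s `^ (x - 1) * expR (- s).
pose I : set (measurableTypeR R) := `]0, +oo[%classic.
pose I1 : set (measurableTypeR R) := `]0, 1[%classic.
pose I2 : set (measurableTypeR R) := `[1, +oo[%classic.
have mI : measurable I by exact: measurable_itv.
have mI1 : measurable I1 by exact: measurable_itv.
have mI2 : measurable I2 by exact: measurable_itv.
have mf (D : set (measurableTypeR R)) : measurable_fun D (f : measurableTypeR R -> R).
  apply: measurable_funTS; apply: measurable_funM; first exact: measurable_powR.
  by apply: measurableT_comp => //; exact: measurable_oppr.
have f0 s : 0 <= f s by rewrite mulr_ge0 ?powR_ge0 ?expR_ge0.
have II : I = I1 `|` I2.
  apply/seteqP; split => s; rewrite /I /I1 /I2/= !in_itv/= ?andbT.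
    by move=> s0; have [s1|s1] := ltP s 1; [left; rewrite s0|right].
  by move=> [/andP[]//|]; exact: lt_le_trans.
have fin1 : (\int[leb]_(s in I1) (f s)%:E < +oo)%E.
  apply: (@le_lt_trans _ _ (\int[leb]_(s in I1) (s `^ (x - 1))%:E)%E).
    apply: ge0_le_integral => //.
    - by move=> s _; rewrite lee_fin.
    - exact/measurable_EFinP.
    - by apply/measurable_EFinP; apply: measurable_funTS; exact: measurable_powR.
    - move=> s; rewrite /I1/= in_itv/= => /andP[s0 _]; rewrite lee_fin /f.
      by rewrite ler_piMr ?powR_ge0// -expR0 ler_expR oppr_le0 ltW.
  rewrite (@ge0_FTC2_oo R _ (fun s => (x - 1 + 1)^-1 * s `^ (x - 1 + 1))) ?ltry//.
  - move=> s; rewrite in_itv/= => /andP[s0 _]; apply: is_derive_primitive_powR => //.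
    by rewrite gt_eqF//; lra.
  - by move=> s; rewrite in_itv/= => /andP[s0 _]; exact: continuous_powR.
  - have := @within_continuous_powR R (x - 1 + 1) 0 1; rewrite subrK => /(_ x0 (lexx _) ltr01) H s.
    by apply: cvgMr; exact: H.
  - by move=> s _; exact: powR_ge0.
have fin2 : (\int[leb]_(s in I2) (f s)%:E < +oo)%E.
  apply: (@le_lt_trans _ _ (\int[leb]_(s in I2) (expR (- s))%:E)%E).
    apply: ge0_le_integral => //.
    - by move=> s _; rewrite lee_fin.
    - exact/measurable_EFinP.
    - by apply/measurable_EFinP; apply: measurable_funTS; apply: measurableT_comp => //; exact: measurable_oppr.
    - move=> s; rewrite /I2/= in_itv/= andbT => s1; rewrite lee_fin /f.
      rewrite ler_piMl ?expR_ge0// -[leRHS](powRr0 s).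
      by apply: ler_powR => //; lra.
  rewrite (@ge0_continuous_FTC2y R _ (fun s => - expR (- s)) 1 0) ?ltry//.
  - apply: continuous_subspaceT => s; apply: continuous_comp; first exact: opp_continuous.
    exact: continuous_expR.
  - by rewrite -oppr0; apply: cvgN; apply: cvgr_expR.
  - apply: cvgN; apply: cvg_at_right_filter.
    apply: continuous_comp; first exact: opp_continuous.
    exact: continuous_expR.
  - move=> s _; rewrite derive1E.
    have dN : is_derive s (1 : R) (fun y : R => - y) (-1) by apply: is_derive_eq.
    have dexpN : is_derive s (1 : R) (fun y : R => expR (- y)) (expR (- s) * -1).
      exact: is_derive1_comp.
    have dNexpN := is_deriveN dexpN.
    rewrite (_ : (fun s0 : R => _) = - (fun y : R => expR (- y)))//.
    by rewrite derive_val mulrN1 opprK.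
have fin : (\int[leb]_(s in I) (f s)%:E < +oo)%E.
  rewrite II ge0_integral_setU//.
  - by rewrite lte_add_pinfty.
  - exact/measurable_EFinP.
  - by move=> s _; rewrite lee_fin.
  - apply/disj_setPS => s; rewrite /I1 /I2/= !in_itv/= => -[/andP[_ s1]].
    by rewrite andbT leNgt s1.
rewrite -/I /Rintegral fine_gt0// fin andbT.
(* On []0, 1[] the power is at least 1 and the exponential at least [expR (-1)]. *)
apply: (@lt_le_trans _ _ (\int[leb]_(s in I1) (cst (expR (-1))%:E s))%E).
  have -> : (\int[leb]_(s in I1) (cst (expR (-1))%:E s) = (expR (-1))%:E)%E.
    have eI1 : leb I1 = 1%E.
      by rewrite /leb /I1 lebesgue_measure_itv/= lte_fin ltr01 -EFinD subr0.
    by transitivity ((expR (-1))%:E * leb I1)%E; [exact: (integral_cst leb mI1)|rewrite eI1 mule1].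
  by rewrite lte_fin expR_gt0.
apply: (@le_trans _ _ (\int[leb]_(s in I1) (f s)%:E)%E).
  apply: ge0_le_integral => //.
  - by move=> s _; rewrite lee_fin expR_ge0.
  - exact/measurable_EFinP.
  - move=> s; rewrite /I1/= in_itv/= => /andP[s0 s1]; rewrite lee_fin /f.
    apply: (@le_trans _ _ (1 * expR (- s))).
      by rewrite mul1r ler_expR lerN2 ltW.
    rewrite ler_wpM2r ?expR_ge0//.
    suff : 1 `^ (x - 1) <= s `^ (x - 1) by rewrite powR1.
    by apply: le_powR_neg; lra.
apply: ge0_subset_integral => //; first exact/measurable_EFinP.
- by move=> s _; rewrite lee_fin.
- by rewrite II; exact: subsetUl.
Qed.

Section caputo_pairing.
Variables (R : realType) (d : nat) (Omega : set 'rV[R]_d) (alpha T : R).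
Local Notation X := 'rV[R]_d.
Local Notation leb := (@lebesgue_measure R).
Local Notation L2 := (L2 Omega).
Local Notation L2norm := (L2norm Omega).
Local Notation L2inner := (L2inner Omega).
Implicit Types (v : R -> X -> R) (phi w : X -> R).
Hypothesis alpha01 : 0 < alpha < 1.
Hypothesis T0 : 0 < T.

(** Reduces the vector-valued derivative to a scalar one: the inner product passes under the Bochner
    integral, each of the two inequalities coming from [bochner_integral_ge], with [phi] and with
    its opposite. *)
Lemma caputo_inner v t w phi : regular Omega T v -> 0 < t <= T ->
  caputo Omega alpha v t w -> L2 phi ->
  L2inner w phi = scalar_caputo alpha (fun s => L2inner (v s) phi) t.
Proof.
move=> rv tT' [J bJ wE] p2; have [v2 _ _] := rv; have [t0 tT] := andP tT'.
have J2 : L2 J by case: bJ.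
have vt : L2 (v t) by apply: v2; rewrite ltW.
have vz : L2 (v 0) by apply: v2; rewrite lexx (le_trans (ltW t0)).
have np2 := L2N p2.
have inN u : L2 u -> L2inner u (fun x => - phi x) = - L2inner u phi.
  move=> u2; rewrite L2inner_sym (_ : (fun x => - phi x) = (fun x => -1 * phi x)).
    by rewrite L2innerZl// mulN1r L2inner_sym.
  by apply/funext => x; rewrite mulN1r.
pose I : set (measurableTypeR R) := `]0, t[%classic.
have mI : measurable I by exact: measurable_itv.
pose k s := caputo_kernel alpha (fun s => L2inner (v s) phi) t s.
have ik : leb.-integrable I (EFin \o k).
  exact: (caputo_kernel_integrable alpha01 (regular_tame_inner T0 rv p2) tT').
have kE s psi : L2 psi -> 0 < s < t -> L2inner
    (fun x => alpha * (t - s) `^ (- alpha - 1) * (v t x - v s x)) psi =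
    alpha * (t - s) `^ (- alpha - 1) * (L2inner (v t) psi - L2inner (v s) psi).
  move=> psi2 /andP[s0 st].
  have vs : L2 (v s) by apply: v2; rewrite ltW//= ltW// (lt_le_trans st).
  by rewrite L2innerZl ?L2innerBl//; exact: L2B.
have JE : L2inner J phi = \int[leb]_(s in I) k s.
  apply/eqP; rewrite eq_le; apply/andP; split; last first.
    apply: (bochner_integral_ge bJ p2 ik); apply: aeW => s st.
    by rewrite kE.
  rewrite -[leLHS]opprK -inN// lerNl -(RintegralN mI ik).
  have ink : leb.-integrable I (EFin \o (fun s => - k s)).
    have := integrable_RZl (-1) mI ik.
    by congr (_.-integrable _ _); apply/funext => s /=; rewrite mulN1r.
  apply: (bochner_integral_ge bJ np2 ink); apply: aeW => s st.
  have vs : L2 (v s).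
    by case/andP: st => s0 st; apply: v2; rewrite ltW//= ltW// (lt_le_trans st).
  rewrite kE// !inN// /k /caputo_kernel -mulrN.
  by rewrite opprD.
have -> : w = (fun x => (Gamma (1 - alpha))^-1 * (t `^ (- alpha) * (v t x - v 0 x) + J x)).
  exact/funext.
have v0t := L2B vt vz; have v0t' := L2Z (t `^ (- alpha)) v0t.
by rewrite L2innerZl ?L2innerDl ?L2innerZl ?L2innerBl ?JE//; exact: L2D.
Qed.

End caputo_pairing.

Section energy.
Variables (R : realType) (d : nat) (Omega : set 'rV[R]_d) (L : operator R d).
Variables (alpha lambda T : R) (f : R -> 'rV[R]_d -> R).
Local Notation X := 'rV[R]_d.
Local Notation leb := (@lebesgue_measure R).
Local Notation L2 := (L2 Omega).
Local Notation L2norm := (L2norm Omega).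
Local Notation L2inner := (L2inner Omega).
Implicit Types (u v : R -> X -> R).
Hypothesis alpha01 : 0 < alpha < 1.
Hypothesis T0 : 0 < T.
Hypothesis mO : measurable Omega.
Hypothesis eL : elliptic Omega L.
Hypothesis coercive_L : forall (v : X -> R) g, H10 Omega v g ->
  lambda * L2norm v ^+ 2 <= pairing Omega L v g v g.

Lemma residual_difference u v t r : is_residual Omega alpha L f v t r ->
  is_residual Omega alpha L f u t (cst 0) -> L2 r ->
  exists wv wu, [/\ caputo Omega alpha v t wv, caputo Omega alpha u t wu,
    L2 (fun x => v t x - u t x) &
    L2inner wv (fun x => v t x - u t x) - L2inner wu (fun x => v t x - u t x)
    + lambda * L2norm (fun x => v t x - u t x) ^+ 2
    <= L2norm r * L2norm (fun x => v t x - u t x)].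
Proof.
move=> [wv [gv [cv hv Rv]]] [wu [gu [cu hu Ru]]] r2.
have he := H10B hv hu; set e := (fun x => v t x - u t x) in he *.
have [[v2 gv2 _] _] := hv; have [[u2 gu2 _] _] := hu; have [[e2 ge2 _] _] := he.
exists wv, wu; split => //.
have := Rv _ _ he; have := Ru _ _ he; have := coercive_L he.
rewrite (pairingB mO eL v2 u2 gv2 gu2 e2 ge2).
have -> : L2inner (cst 0) e = 0.
  rewrite (_ : cst 0 = (fun x => 0 * e x)); first by rewrite L2innerZl// mul0r.
  by apply/funext => x; rewrite mul0r.
have := le_trans (ler_norm _) (L2inner_le r2 e2).
move: (pairing _ _ _ _ _ _) (pairing _ _ _ _ _ _) (L2inner r e) (L2norm r * L2norm e)
  (L2inner wv e) (L2inner wu e) (L2inner (f t) e) (lambda * _).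
by move=> *; lra.
Qed.

Lemma energy_inequality u v t r : regular Omega T u -> regular Omega T v ->
  L2norm (fun x => v 0 x - u 0 x) = 0 -> 0 < t <= T -> L2 r ->
  is_residual Omega alpha L f v t r -> is_residual Omega alpha L f u t (cst 0) ->
  0 < L2norm (fun x => v t x - u t x) ->
  scalar_caputo alpha (fun s => L2norm (fun x => v s x - u s x)) t
  + lambda * L2norm (fun x => v t x - u t x) <= L2norm r.
Proof.
move=> ru rv; set w := (fun s => L2norm _) => w0 tT r2 Rv Ru; rewrite -/(w t) => wt.
have {}w0 : w 0 = 0 by [].
have [u2 _ _] := ru; have [v2 _ _] := rv.
have [wv [wu [cv cu]]] := residual_difference Rv Ru r2.
rewrite -/(w t); set e := (fun x => v t x - u t x) => e2.
rewrite (caputo_inner alpha01 T0 rv tT cv e2) (caputo_inner alpha01 T0 ru tT cu e2).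
pose I : set (measurableTypeR R) := `]0, t[%classic.
have mI : measurable I by exact: measurable_itv.
pose kv s := caputo_kernel alpha (fun s => L2inner (v s) e) t s.
pose ku s := caputo_kernel alpha (fun s => L2inner (u s) e) t s.
pose kw s := caputo_kernel alpha w t s.
have ikv : leb.-integrable I (EFin \o kv).
  exact: (caputo_kernel_integrable alpha01 (regular_tame_inner T0 rv e2) tT).
have iku : leb.-integrable I (EFin \o ku).
  exact: (caputo_kernel_integrable alpha01 (regular_tame_inner T0 ru e2) tT).
have ikw : leb.-integrable I (EFin \o kw).
  exact: (caputo_kernel_integrable alpha01 (regular_tame_dist T0 rv ru) tT).
have [t0 tT'] := andP tT; have [al0 al1] := andP alpha01.
have in_t : L2inner (v t) e - L2inner (u t) e = w t ^+ 2.
  by rewrite -L2innerBl ?L2inner_self//; [apply: v2|apply: u2]; rewrite ltW.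
(* Cauchy-Schwarz, with equality at [s = t] by [in_t]. As the Caputo kernel puts a nonnegative
   weight on the difference between times [t] and [s], this is the direction in which the norm can
   replace the inner product. *)
have in_s s : 0 <= s <= T -> L2inner (v s) e - L2inner (u s) e <= w s * w t.
  move=> sT; rewrite -L2innerBl//; [|exact: v2|exact: u2].
  by apply: (le_trans (ler_norm _)); apply: L2inner_le => //; apply: L2B; [exact: v2|exact: u2].
have in_0 : L2inner (v 0) e - L2inner (u 0) e = 0.
  have T0' : 0 <= (0 : R) <= T by rewrite lexx ltW.
  have ve0 := L2B (v2 _ T0') (u2 _ T0').
  rewrite -L2innerBl//; [|exact: v2|exact: u2].
  by have := L2inner_le ve0 e2; rewrite -/(w 0) w0 mul0r normr_le0 => /eqP.
have kwE : w t * \int[leb]_(s in I) kw s <=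
    \int[leb]_(s in I) kv s - \int[leb]_(s in I) ku s.
  rewrite -[leRHS](RintegralB mI ikv iku) -[leLHS](RintegralZl (w t) mI ikw).
  apply: (le_Rintegral mI (integrable_RZl _ mI ikw) (integrable_RB mI ikv iku)) => s.
  rewrite /I/= in_itv/= => /andP[s0 st].
  have := in_s s; rewrite (ltW s0) (ltW (lt_le_trans st tT')) => /(_ isT).
  rewrite /kw /kv /ku /caputo_kernel -mulrBr mulrCA.
  have k0 : 0 <= alpha * (t - s) `^ (- alpha - 1) by rewrite mulr_ge0 ?powR_ge0// ltW.
  move=> in_s'; apply: ler_wpM2l => //; move: in_t in_s'.
  rewrite mulrBr -expr2 (mulrC (w t)).
  move: (L2inner _ _) (L2inner _ _) (L2inner _ _) (L2inner _ _) (w t ^+ 2) (w s * w t).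
  by move=> *; lra.
have G0 : 0 <= (Gamma (1 - alpha))^-1.
  by rewrite invr_ge0; apply/ltW/Gamma_gt0; rewrite subr_gt0 al1 gtrBl.
have P0 : 0 <= t `^ (- alpha) by exact: powR_ge0.
have GkwE := ler_wpM2l G0 kwE.
(* All terms so far carry a factor [w t], which is cancelled here; hence the hypothesis that it is
   positive. *)
move=> res; rewrite -(ler_pM2r wt); move: in_t in_0 GkwE res.
rewrite /scalar_caputo -/I w0 subr0 -/kv -/ku -/kw.
move: (L2inner (v t) e) (L2inner (u t) e) (L2inner (v 0) e) (L2inner (u 0) e).
move: (\int[leb]_(s in I) kv s) (\int[leb]_(s in I) ku s) (\int[leb]_(s in I) kw s).
move: (Gamma _)^-1 (t `^ (- alpha)) (w t) (L2norm r) => G P a rho A B C a1 a2 b1 b2.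
move=> /eqP; rewrite subr_eq => /eqP -> /eqP; rewrite subr_eq0 => /eqP ->.
by move=> *; lra.
Qed.

End energy.

(** * The positive part of w - E *)

Section positive_part.
Variables (R : realType) (alpha T : R).
Notation leb := (@lebesgue_measure R).
Implicit Types (E h w : R -> R).
Hypothesis alpha01 : 0 < alpha < 1.

Lemma caputo_kernel_ge0 t s : 0 <= alpha * (t - s) `^ (- alpha - 1).
Proof. by case/andP: alpha01 => a0 _; rewrite mulr_ge0 ?powR_ge0// ltW. Qed.

(** The barrier is known only through the integrability of its kernels; on []0, T[] the kernel at
    the final time can be solved for [E s], since its power does not vanish. *)
Lemma caputo_defined_measurable E : caputo_defined alpha E T ->
  measurable_fun (`]0, T[%classic : set (measurableTypeR R)) (E : measurableTypeR R -> R).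
Proof.
move=> iE; have [a0 _] := andP alpha01.
have mk := integrable_R_measurable iE.
apply: (@eq_measurable_fun _ _ _ _ _
    (fun s : measurableTypeR R => E T - alpha^-1 * (T - s) `^ (alpha + 1) * caputo_kernel alpha E T s)).
  move=> s; rewrite inE/= in_itv/= => /andP[s0 sT].
  have P1 : (T - s) `^ (- alpha - 1) != 0 by rewrite gt_eqF// powR_gt0// subr_gt0.
  rewrite -[alpha + 1]opprK opprD powRN /caputo_kernel.
  have a1 : alpha != 0 by rewrite gt_eqF.
  by move: ((T - s) `^ _) P1 => P P1; field; rewrite a1 P1.
apply: measurable_funB; first exact: measurable_cst.
apply: measurable_funM mk; apply: measurable_funM; first exact: measurable_cst.
exact: measurable_powRB.
Qed.

Lemma pos_part_dist (x y : R) : `|Num.max x 0 - Num.max y 0| <= `|x - y|.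
Proof.
by rewrite !maxEle; case: (leP x 0) => x0; case: (leP y 0) => y0;
  rewrite ler_norml; have := ler_norm (x - y); have := ler_norm (y - x);
  rewrite (distrC y x) => ? ?; apply/andP; split; lra.
Qed.

Lemma caputo_kernel_pos_part_integrable w E t : 0 < t <= T ->
  measurable_fun (`]0, T[%classic : set (measurableTypeR R)) (w : measurableTypeR R -> R) ->
  measurable_fun (`]0, T[%classic : set (measurableTypeR R)) (E : measurableTypeR R -> R) ->
  leb.-integrable `]0, t[ (EFin \o caputo_kernel alpha w t) ->
  leb.-integrable `]0, t[ (EFin \o caputo_kernel alpha E t) ->
  leb.-integrable `]0, t[
    (EFin \o caputo_kernel alpha (fun s => Num.max (w s - E s) 0) t).
Proof.
move=> /andP[t0 tT] mw mE iw iE.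
pose I : set (measurableTypeR R) := `]0, t[%classic.
have mI : measurable I by exact: measurable_itv.
have IT : I `<=` `]0, T[%classic.
  by move=> s; rewrite /I/= !in_itv/= => /andP[-> st]; exact: lt_le_trans tT.
apply: (integrable_domination mI _ (integrable_RD mI (integrable_norm iw) (integrable_norm iE))).
  apply: measurable_funM.
    by apply: measurable_funM; [exact: measurable_cst|exact: measurable_powRB].
  apply: measurable_funB; first exact: measurable_cst.
  apply: measurable_maxr; last exact: measurable_cst.
  by apply: measurable_funS (measurable_funB mw mE).
move=> s _ /=; rewrite /caputo_kernel normrM [X in _ <= X + _]normrM [X in _ <= _ + X]normrM.
rewrite -mulrDr; apply: ler_wpM2l => //.
apply: (le_trans (pos_part_dist _ _)).
rewrite (_ : _ - _ - _ = (w t - w s) - (E t - E s)); last by ring.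
exact: ler_normB.
Qed.

(** If [w t <= E t], the positive part vanishes at [t], so its kernel is nonpositive and the
    differential inequality is not called upon. Otherwise the positive part agrees with [w - E] at
    [t] and is no smaller at earlier times, so its kernel is at most the difference of the kernels.
    The term in [E 0 - w 0] is dropped by its sign, which is why no value at 0 appears in the
    conclusion. *)
Lemma caputo_pos_part_le w E (lambda : R) t : 0 < t <= T ->
  measurable_fun (`]0, T[%classic : set (measurableTypeR R)) (w : measurableTypeR R -> R) ->
  measurable_fun (`]0, T[%classic : set (measurableTypeR R)) (E : measurableTypeR R -> R) ->
  leb.-integrable `]0, t[ (EFin \o caputo_kernel alpha w t) ->
  leb.-integrable `]0, t[ (EFin \o caputo_kernel alpha E t) ->
  w 0 <= E 0 ->
  (E t < w t -> scalar_caputo alpha w t + lambda * w t <=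
                scalar_caputo alpha E t + lambda * E t) ->
  t `^ (- alpha) * Num.max (w t - E t) 0
  + \int[leb]_(s in `]0, t[) caputo_kernel alpha (fun s => Num.max (w s - E s) 0) t s
  <= `|lambda| * Gamma (1 - alpha) * Num.max (w t - E t) 0.
Proof.
move=> tT mw mE iw iE wE0 ineq.
pose I : set (measurableTypeR R) := `]0, t[%classic.
have mI : measurable I by exact: measurable_itv.
pose kp s := caputo_kernel alpha (fun s => Num.max (w s - E s) 0) t s.
have ip : leb.-integrable I (EFin \o kp) by exact: caputo_kernel_pos_part_integrable.
have [a0 a1] := andP alpha01.
have [wE|Ew] := leP (w t) (E t).
  have p0 : Num.max (w t - E t) 0 = 0 by apply/max_idPr; rewrite subr_le0.
  rewrite p0 !mulr0 add0r.
  have ic0 : leb.-integrable I (EFin \o (cst 0 : R -> R)).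
    apply: (@bounded_integrable _ _ _ leb I _ 0) => //.
    - exact: lebesgue_oo_lty.
    - by move=> s _; rewrite normr0.
  apply: (@le_trans _ _ (\int[leb]_(s in I) (cst 0 : R -> R) s)).
    apply: (le_Rintegral mI ip ic0) => s _.
    rewrite /kp /caputo_kernel p0 sub0r mulrN oppr_le0 mulr_ge0 ?caputo_kernel_ge0//.
    by rewrite le_max lexx orbT.
  by rewrite (Rintegral_cst leb mI) mul0r.
have pE : Num.max (w t - E t) 0 = w t - E t by apply/max_idPl; rewrite subr_ge0 ltW.
have kpE : \int[leb]_(s in I) kp s <=
    \int[leb]_(s in I) caputo_kernel alpha w t s - \int[leb]_(s in I) caputo_kernel alpha E t s.
  rewrite -[leRHS](RintegralB mI iw iE).
  apply: (le_Rintegral mI ip (integrable_RB mI iw iE)) => s _.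
  rewrite /kp /caputo_kernel -mulrBr; apply: ler_wpM2l; first exact: caputo_kernel_ge0.
  have : w s - E s <= Num.max (w s - E s) 0 by rewrite le_max lexx.
  by rewrite pE; move: (Num.max _ _) => m ?; lra.
have G0 : 0 < Gamma (1 - alpha) by apply: Gamma_gt0; rewrite subr_gt0 a1 gtrBl.
have P0 : 0 <= t `^ (- alpha) by exact: powR_ge0.
have := ineq Ew; rewrite pE -/I.
have lamE : - `|lambda| * (w t - E t) <= lambda * (w t - E t).
  rewrite ler_wpM2r//; first by rewrite subr_ge0 ltW.
  by rewrite lerNl -normrN ler_norm.
have P0E : 0 <= t `^ (- alpha) * (E 0 - w 0) by rewrite mulr_ge0// subr_ge0.
move: kpE P0E lamE; rewrite /scalar_caputo -/I -/kp.
move: (\int[leb]_(s in I) kp s) (\int[leb]_(s in I) caputo_kernel alpha w t s)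
  (\int[leb]_(s in I) caputo_kernel alpha E t s) (t `^ (- alpha)) (E 0) (w 0) (w t) (E t)
  `|lambda| (Gamma _) G0 => kp' kw kE P e0 w0 wt Et lam G G0 H1 H2 H3 H4.
have : G * (G^-1 * (P * (wt - w0) + kw) + lambda * wt) <=
    G * (G^-1 * (P * (Et - e0) + kE) + lambda * Et) by rewrite ler_pM2l.
rewrite !(mulrDr G) !mulVKf ?gt_eqF//.
have := ler_wpM2l (ltW G0) H3.
by move: H1 H2 => *; lra.
Qed.

End positive_part.

(** * A comparison principle for bounded measurable functions *)

(* Unification would otherwise unfold the integrals. *)
#[local] Opaque Rintegral conv.

Section volterra.
Variable R : realType.
Notation leb := (@lebesgue_measure R).
Implicit Types a b c s t h : R.
Variables (alpha Lam T M : R) (p : R -> R).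
Hypothesis alpha01 : 0 < alpha < 1.
Hypothesis Lam0 : 0 <= Lam.
Hypothesis T0 : 0 < T.
Let D : set (measurableTypeR R) := `]0, T[%classic.
Hypothesis mp : measurable_fun D (p : measurableTypeR R -> R).
Hypothesis p0 : forall s, 0 < s < T -> 0 <= p s.
Hypothesis pM : forall s, 0 < s < T -> p s <= M.

Let mD : measurable D. Proof. exact: measurable_itv. Qed.
Let al0 : 0 < alpha. Proof. by case/andP: alpha01. Qed.
Let al1 : alpha < 1. Proof. by case/andP: alpha01. Qed.
Let a1 : 0 < (1 - alpha)^-1. Proof. by rewrite invr_gt0 subr_gt0. Qed.

(** The function Q of the overview: with exponent 0 the convolution is the integral of [p] over []0,
    t[]. *)
Definition fracQ t := conv T p (- alpha) t - Lam * conv T p 0 t.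
(* the primitive of [fracQ] *)
Definition fracV t := (1 - alpha)^-1 * conv T p (1 - alpha) t - Lam * conv T p 1 t.

Let integ b t : -1 < b -> 0 <= t <= T ->
  leb.-integrable D (EFin \o (fun s => cut t b t s * p s)).
Proof. move=> b1 tT; exact: (@integrable_conv R T M). Qed.

Lemma fracQ_int t : 0 <= t <= T -> leb.-integrable D
    (EFin \o (fun s => (cut t (- alpha) t s - Lam * cut t 0 t s) * p s)) /\
  fracQ t = \int[leb]_(s in D) ((cut t (- alpha) t s - Lam * cut t 0 t s) * p s).
Proof.
move=> tT.
have i1 : leb.-integrable D (EFin \o (fun s => cut t (- alpha) t s * p s)).
  by apply: integ => //; rewrite ltrN2.
have i2 : leb.-integrable D (EFin \o (fun s => cut t 0 t s * p s)).
  by apply: integ.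
have i2' := integrable_RZl Lam mD i2.
have e : (fun s => (cut t (- alpha) t s - Lam * cut t 0 t s) * p s) =
   (fun s => cut t (- alpha) t s * p s - Lam * (cut t 0 t s * p s)).
  by apply/funext => s; ring.
split; first by rewrite e; exact: (integrable_RB mD i1 i2').
by rewrite e RintegralB// RintegralZl.
Qed.

Lemma fracV_int t : 0 <= t <= T -> leb.-integrable D (EFin \o
    (fun s => ((1 - alpha)^-1 * cut t (1 - alpha) t s - Lam * cut t 1 t s) * p s)) /\
  fracV t = \int[leb]_(s in D)
    (((1 - alpha)^-1 * cut t (1 - alpha) t s - Lam * cut t 1 t s) * p s).
Proof.
move=> tT.
have i1 : leb.-integrable D (EFin \o (fun s => cut t (1 - alpha) t s * p s)).
  by apply: integ => //; have := al1; lra.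
have i2 : leb.-integrable D (EFin \o (fun s => cut t 1 t s * p s)).
  by apply: integ => //; lra.
have i1' := integrable_RZl (1 - alpha)^-1 mD i1.
have i2' := integrable_RZl Lam mD i2.
have e : (fun s => ((1 - alpha)^-1 * cut t (1 - alpha) t s - Lam * cut t 1 t s) * p s) =
   (fun s => (1 - alpha)^-1 * (cut t (1 - alpha) t s * p s) - Lam * (cut t 1 t s * p s)).
  by apply/funext => s; ring.
split; first by rewrite e; exact: (integrable_RB mD i1' i2').
by rewrite e RintegralB// !RintegralZl.
Qed.

(** That Q is the derivative of V enters only in this form. For [s < t] the kernels are compared by
    concavity ([powR_increment]), the part with [Lam] being exact; the new times [t <= s < t'] give
    the error term, through [p <= M]. *)
Lemma fracV_increment t t' : 0 <= t -> t < t' -> t' <= T ->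
  fracV t' - fracV t <=
  (t' - t) * (fracQ t + M * ((1 - alpha)^-1 * (t' - t) `^ (1 - alpha))).
Proof.
move=> t0 tt' t'T.
have tT : 0 <= t <= T by lra.
have t'0 : 0 <= t' <= T by lra.
have [iV ->] := fracV_int tT.
have [iV' ->] := fracV_int t'0.
have [iQ ->] := fracQ_int tT.
have ie : leb.-integrable D (EFin \o cut t 0 t) by apply: integrable_cut; lra.
have ie' : leb.-integrable D (EFin \o cut t' 0 t') by apply: integrable_cut; lra.
have iee : leb.-integrable D (EFin \o (fun s => cut t' 0 t' s - cut t 0 t s)).
  exact: (integrable_RB mD ie' ie).
set N := (1 - alpha)^-1 * (t' - t) `^ (1 - alpha).
have N0 : 0 <= N by rewrite mulr_ge0 ?powR_ge0// ltW.
have iQ' := integrable_RZl (t' - t) mD iQ.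
have iE' := integrable_RZl (N * M) mD iee.
rewrite -[leLHS](RintegralB mD iV' iV).
(* The error is written as an integral too, [cut t' 0 t' s - cut t 0 t s] being the indicator of
   [[t, t'[], so that the inequality can be checked pointwise in [s]. *)
have -> : (t' - t) * (\int[leb]_(s in D) ((cut t (- alpha) t s - Lam * cut t 0 t s) * p s)
    + M * N) = \int[leb]_(s in D)
  ((t' - t) * ((cut t (- alpha) t s - Lam * cut t 0 t s) * p s) +
   N * M * (cut t' 0 t' s - cut t 0 t s)).
  rewrite (RintegralD mD iQ' iE') (RintegralZl (t' - t) mD iQ) (RintegralZl (N * M) mD iee).
  rewrite (RintegralB mD ie' ie).
  rewrite !Rintegral_cut//; [|lra..].
  by rewrite !subrr !add0r invr1 !mul1r !powRr1 ?subr0//; [ring|lra..].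
apply: (le_Rintegral mD (integrable_RB mD iV' iV) (integrable_RD mD iQ' iE')).
move=> s; rewrite /D/= in_itv/= => sT.
have ps0 := p0 sT; have psM := pM sT.
rewrite /cut !powRr0; case: ifPn => st'; last first.
  have -> : (s < t) = false by apply/negbTE; move: st'; rewrite -!leNgt; lra.
  by rewrite !(mulr0, mul0r, oppr0, subr0, addr0).
case: ifPn => st; last first.
  rewrite !(mulr0, subr0, oppr0, mul0r, add0r, mulr1) addr0 mulr1.
  have ts : 0 <= Lam * (t' - s) `^ 1 by rewrite mulr_ge0 ?powR_ge0.
  have : (1 - alpha)^-1 * (t' - s) `^ (1 - alpha) <= N.
    rewrite ler_pM2l//; move: st; rewrite -leNgt => st.
    by apply: le_powR; have := al1; lra.
  set A := _ * _ `^ (1 - alpha) => AN.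
  apply: (@le_trans _ _ (N * p s)); last exact: ler_wpM2l.
  by apply: ler_wpM2r => //; lra.
rewrite subrr mulr0 addr0 mulrA -mulrBl; apply: ler_wpM2r => //.
have := @powR_increment R alpha alpha01 (t - s) (t' - t).
have -> : t - s + (t' - t) = t' - s by ring.
rewrite subr_gt0 subr_ge0 => /(_ st (ltW tt')).
by rewrite !powRr1; lra.
Qed.

Lemma fracQ_continuous t1 : 0 < t1 <= T -> {within `[0, t1], continuous fracQ}.
Proof.
move=> /andP[t10 t1T].
have M0 : 0 <= M := M_ge0 p0 pM T0.
have key x y : 0 <= x <= t1 -> 0 <= y <= t1 -> `|fracQ x - fracQ y| <=
    M * (2 * (1 - alpha)^-1) * `|x - y| `^ (1 - alpha) + Lam * (M * 2) * `|x - y|.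
  wlog xy : x y / y <= x.
    move=> H xt yt; have [yx|/ltW xy] := leP y x; first exact: H.
    by rewrite distrC (distrC x); exact: H.
  move=> xt yt; rewrite /fracQ (ger0_norm (_ : 0 <= x - y)) ?subr_ge0//.
  have c1 : -1 < - alpha <= 0 by have := al1; have := al0; lra.
  have c2 : -1 < (0 : R) <= 0 by rewrite ltrN10 lexx.
  have y0 : 0 <= y by case/andP: yt.
  have xT : x <= T by case/andP: xt => _ /le_trans; apply.
  have H1 : `|conv T p (- alpha) x - conv T p (- alpha) y| <=
      M * (2 * (1 - alpha)^-1) * (x - y) `^ (1 - alpha).
    have := conv_holder mp p0 pM c1 y0 xy xT T0.
    by rewrite [- alpha + 1]addrC !mulrA.
  have H2 : `|conv T p 0 x - conv T p 0 y| <= M * 2 * (x - y).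
    have := conv_holder mp p0 pM c2 y0 xy xT T0.
    by rewrite add0r invr1 mul1r powRr1 ?subr_ge0// mulrA.
  move: H1 H2; move: (conv T p (- alpha) x) (conv T p (- alpha) y)
    (conv T p 0 x) (conv T p 0 y) => q1 q2 q3 q4 H1 H2.
  have -> : q1 - Lam * q3 - (q2 - Lam * q4) = (q1 - q2) - Lam * (q3 - q4) by ring.
  apply: (le_trans (ler_normB _ _)); apply: lerD => //.
  by rewrite normrM (ger0_norm Lam0) -[leRHS]mulrA; apply: ler_wpM2l.
apply/subspace_continuousP => x; rewrite /= in_itv/= => xt.
apply/cvgrPdist_le => e e0.
pose om (r : R) := M * (2 * (1 - alpha)^-1) * r `^ (1 - alpha) + Lam * (M * 2) * r.
have omc : om r @[r --> 0^'+] --> 0.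
  rewrite -[X in _ --> X](_ : M * (2 * (1 - alpha)^-1) * 0 + Lam * (M * 2) * 0 = 0); last by ring.
  apply: cvgD; apply: cvgMr; first by apply: powR_cvg0; rewrite subr_gt0.
  exact: cvg_at_right_filter cvg_id.
have /cvgrPdist_le/(_ e e0) := omc.
rewrite near_withinE => /nbhs_ballP[r /= r0 Hr].
rewrite /prop_near1 /within/=; apply/nbhs_ballP; exists r => //= y xy yt.
rewrite in_itv/= in yt.
have := key x y xt yt; move=> /le_trans; apply.
(* The modulus [om] is controlled only to the right of 0, so coinciding points are treated apart. *)
have [->|nxy] := eqVneq x y.
  by rewrite subrr normr0 powR0 ?mulr0 ?addr0 ?ltW// subr_eq0 gt_eqF.
have nxy0 : 0 < `|x - y| by rewrite normr_gt0 subr_eq0.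
have := Hr `|x - y|; rewrite /ball/= sub0r normrN normr_id => /(_ xy nxy0).
by rewrite sub0r normrN; apply: le_trans; exact: ler_norm.
Qed.

(** Linearity of the integral alone: in the variable [r = t - s] the cutoff at [t - h] becomes the
    condition [h < r] in [kern] and [tent]. *)
Lemma fracQV_kernel t h : 0 < h <= t -> t <= T ->
  let k := fun s => (kern alpha h (t - s) - Lam * tent h (t - s)) * p s in
  leb.-integrable `]0, t[ (EFin \o k) /\
  h * fracQ t - (fracV t - fracV (t - h)) = \int[leb]_(s in `]0, t[) k s.
Proof.
move=> /andP[h0 ht] tT k.
have tT' : 0 <= t <= T by lra.
have thT : 0 <= t - h <= T by lra.
have [iV ->] := fracV_int tT'.
have [iV' ->] := fracV_int thT.
have [iQ ->] := fracQ_int tT'.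
have iQ' := integrable_RZl h mD iQ.
have iVV := integrable_RB mD iV iV'.
have iA := integrable_RB mD iQ' iVV.
rewrite -(RintegralZl h mD iQ) -(RintegralB mD iV iV') -(RintegralB mD iQ' iVV).
set f := (X in leb.-integrable D (EFin \o X)) in iA.
have fE : f = k \_ `]-oo, t[.
  apply/funext => s; rewrite patchE /f /k /cut /tent /kern !powRr0.
  have [st|ts] := ltP s t; last first.
    rewrite memNset/=; last by rewrite in_itv/= ltNge ts.
    have -> : (s < t - h) = false by apply/negbTE; rewrite -leNgt; lra.
    by rewrite !(mulr0, subr0, mul0r).
  rewrite mem_set/=; last by rewrite in_itv/= st.
  have -> : (s < t - h) = (h < t - s) by rewrite ltrBrDl addrC -ltrBrDl.
  have -> : t - h - s = t - s - h by ring.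
  have ts0 : 0 <= t - s by rewrite subr_ge0 ltW.
  rewrite [(t - s) `^ 1]powRr1//; case: ifP => hs; last by ring.
  by rewrite powRr1 ?subr_ge0 1?ltW//; ring.
have DE : D `&` `]-oo, t[%classic = `]0, t[%classic by exact: setI_oo_Ny.
split; last by rewrite -DE Rintegral_mkcondr -fE.
rewrite -DE; apply/integrable_restrict => //.
by rewrite restrict_EFin -fE.
Qed.

Lemma omega_cvg (C t : R) : 0 < t ->
  C * ((1 - alpha)^-1 * (t / n.+1%:R) `^ (1 - alpha)) @[n --> \oo] --> (0 : R).
Proof.
move=> t0.
rewrite -[X in _ --> X](mulr0 (C * (1 - alpha)^-1)).
under eq_fun do rewrite mulrA.
apply: cvgMr.
have b0 : 0 < 1 - alpha by rewrite subr_gt0; exact: al1.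
have /cvg_at_rightP := powR_cvg0 b0; apply; split=> [n|]; first by rewrite divr_gt0.
by rewrite -[X in _ --> X](mulr0 t); apply: cvgMr; exact: cvg_harmonic.
Qed.

Lemma fracQ_maximum_point t1 : 0 < t1 <= T -> 0 < fracQ t1 ->
  exists t e, [/\ 0 < t <= T, 0 < e & forall h, 0 < h <= t ->
    e * h ^+ 2 / 2 <= h * fracQ t - (fracV t - fracV (t - h))].
Proof.
move=> t1T Q1; have [t10 t1T'] := andP t1T.
have Q0 : fracQ 0 = 0.
  rewrite (fracQ_int _).2 ?lexx ?ltW//.
  rewrite (_ : \int[_]_(_ in _) _ = \int[leb]_(s in D) (cst 0 s)).
    by rewrite Rintegral_cst// mul0r.
  apply: eq_Rintegral => s /set_mem; rewrite /D/= in_itv/= => /andP[s0 _].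
  by rewrite /cut ltNge (ltW s0)/= mulr0 subrr mul0r.
have H a b : 0 <= a -> a < b -> b <= t1 -> fracV b - fracV a <=
    (b - a) * (fracQ a + M * ((1 - alpha)^-1 * (b - a) `^ (1 - alpha))).
  by move=> a0 ab bt; apply: fracV_increment => //; exact: le_trans t1T'.
have om h : 0 < h ->
    M * ((1 - alpha)^-1 * (h / n.+1%:R) `^ (1 - alpha)) @[n --> \oo] --> (0 : R).
  exact: omega_cvg.
have [t [e [/andP[t0 tt1] e0 He]]] := @left_second_difference R fracV fracQ
  (fun r => M * ((1 - alpha)^-1 * r `^ (1 - alpha))) t1
  t10 (fracQ_continuous t1T) Q0 Q1 H om.
by exists t, e; split => //; rewrite t0 (le_trans tt1).
Qed.

End volterra.

Section volterra_comparison.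
Variable R : realType.
Notation leb := (@lebesgue_measure R).
Implicit Types a b c s t h : R.
Variables (alpha Lam T M : R) (p : R -> R).
Hypothesis alpha01 : 0 < alpha < 1.
Hypothesis Lam0 : 0 <= Lam.
Hypothesis T0 : 0 < T.
Let D : set (measurableTypeR R) := `]0, T[%classic.
Hypothesis mp : measurable_fun D (p : measurableTypeR R -> R).
Hypothesis p0 : forall s, 0 < s <= T -> 0 <= p s.
Hypothesis pM : forall s, 0 < s < T -> p s <= M.
Hypothesis ip : forall t, 0 < t <= T ->
  leb.-integrable `]0, t[ (EFin \o caputo_kernel alpha p t).
Hypothesis hp : forall t, 0 < t <= T ->
  t `^ (- alpha) * p t + \int[leb]_(s in `]0, t[) caputo_kernel alpha p t s
  <= Lam * p t.

Let b3 : -1 < 1 - alpha.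
Proof. by case/andP: alpha01 => ? ?; lra. Qed.
Let mD : measurable D. Proof. exact: measurable_itv. Qed.
Let p0' : forall s, 0 < s < T -> 0 <= p s.
Proof. by move=> s /andP[s0 sT]; apply: p0; rewrite s0 ltW. Qed.

(** Dividing by [h^2] and letting [h] tend to 0 along a sequence bounds [e] by [t^-alpha p(t)] plus
    the kernel integral minus [Lam * p t], which [hp] makes nonpositive. *)
Lemma no_second_difference t e : 0 < t <= T -> 0 < e ->
  (forall h, 0 < h <= t -> e * h ^+ 2 / 2 <=
     h * fracQ alpha Lam T p t - (fracV alpha Lam T p t - fracV alpha Lam T p (t - h))) ->
  False.
Proof.
move=> tT' e0 He; have [t0 tT] := andP tT'.
(* The denominator starts at 2 to keep [h n < t], so that [(t - h n)^-alpha] is taken at a positive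
   argument. *)
pose h n : R := t / n.+2%:R.
have h0 n : 0 < h n by rewrite divr_gt0.
have ht n : h n < t by rewrite /h ltr_pdivrMr// ltr_pMr// ltr1n.
have hc : h n @[n --> \oo] --> (0 : R).
  rewrite -[X in _ --> X](mulr0 t); apply: cvgMr.
  by have := @cvg_harmonic R; rewrite -(cvg_shiftn 1) /=; under eq_fun do rewrite addn1.
pose I : set (measurableTypeR R) := `]0, t[%classic.
have mI : measurable I by exact: measurable_itv.
pose ker s := caputo_kernel alpha p t s.
have iker : leb.-integrable I (EFin \o ker) by exact: ip.
pose kk n s := kern alpha (h n) (t - s) - Lam * tent (h n) (t - s).
have iI1 n : leb.-integrable I (EFin \o (fun s => kk n s * p s)) /\
    e * h n ^+ 2 / 2 <= \int[leb]_(s in I) (kk n s * p s).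
  have hn : 0 < h n <= t by rewrite h0 ltW.
  have [i1 e1] := fracQV_kernel Lam alpha01 mp p0' pM hn tT.
  by split => //; rewrite -[X in _ <= X]e1; exact: He.
(* The identity of [fracQV_kernel] is used once more, with the density 1 in place of [p], to bound
   the integral of the kernel itself. *)
have iI2 n : leb.-integrable I (EFin \o kk n) /\
    \int[leb]_(s in I) kk n s <= h n ^+ 2 / 2 * ((t - h n) `^ (- alpha) - Lam).
  have hn : 0 < h n <= t by rewrite h0 ltW.
  have m1 : measurable_fun (D : set (measurableTypeR R)) (cst 1 : measurableTypeR R -> R).
    exact: measurable_cst.
  have [i1 e1] := @fracQV_kernel R alpha Lam T 1 (cst 1) alpha01 m1
    (fun _ _ => ler01) (fun _ _ => lexx 1) t (h n) hn tT.
  have kE : (fun s => (kern alpha (h n) (t - s) - Lam * tent (h n) (t - s)) * cst 1 s) = kk n.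
    by apply/funext => s; rewrite mulr1.
  rewrite kE in i1; split => //.
  have -> : \int[leb]_(s in I) kk n s = \int[leb]_(s in I)
    ((kern alpha (h n) (t - s) - Lam * tent (h n) (t - s)) * cst 1 s) by rewrite kE.
  rewrite -[X in X <= _]e1 /fracQ /fracV.
  have t1 : 0 <= t <= T by rewrite ltW.
  have t2 : 0 <= t - h n <= T.
    by rewrite subr_ge0 ltW//=; apply: le_trans tT; rewrite gerBl ltW.
  have [al0 al1] := andP alpha01.
  have b1 : -1 < - alpha by rewrite ltrN2.
  have b2 : -1 < (0 : R) by rewrite ltrN10.
  have b4 : -1 < (1 : R) by rewrite (lt_trans b2).
  rewrite (conv_cst1 b1 t1) (conv_cst1 b2 t1) (conv_cst1 b3 t1) (conv_cst1 b4 t1).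
  rewrite (conv_cst1 b3 t2) (conv_cst1 b4 t2).
  have -> : 1 - alpha + 1 = 2 - alpha by ring.
  rewrite [- alpha + 1]addrC add0r invr1 mul1r -[1 + 1]/(2 : R).
  have t0' : 0 <= t by exact: ltW.
  have th0 : 0 <= t - h n by rewrite subr_ge0 ltW.
  rewrite powRr1// !powR_mulrn//.
  by apply: second_primitive_bound => //; rewrite h0 ht.
(* This is what remains of [kk n s * p s] after subtracting [p t * kk n s], divided by [h n ^+ 2].
   The difference [p t - p s] lets a multiple of the integrable function [|ker s|] dominate it for
   all [n]. *)
pose g n s := (h n ^+ 2)^-1 * kk n s * - (p t - p s).
have ig n : leb.-integrable I (EFin \o g n) /\
    \int[leb]_(s in I) g n s = (h n ^+ 2)^-1 *
      (\int[leb]_(s in I) (kk n s * p s) - p t * \int[leb]_(s in I) kk n s).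
  have [i1 _] := iI1 n; have [i2 _] := iI2 n.
  have i2' := integrable_RZl (p t) mI i2.
  have i12 := integrable_RB mI i1 i2'.
  have -> : g n = fun s => (h n ^+ 2)^-1 * (kk n s * p s - p t * kk n s).
    by apply/funext => s; rewrite /g; ring.
  split; first exact: (integrable_RZl _ mI i12).
  by rewrite (RintegralZl _ mI i12) (RintegralB mI i1 i2') (RintegralZl _ mI i2).
(* Replacing the integral of [kk n] by its upper bound is legitimate because its coefficient [p t]
   is nonnegative. *)
have lower n : e / 2 <= p t / 2 * ((t - h n) `^ (- alpha) - Lam) + \int[leb]_(s in I) g n s.
  have [_ ->] := ig n; have [_ +] := iI1 n; have [_ +] := iI2 n.
  move: (\int[leb]_(s in I) kk n s) (\int[leb]_(s in I) (kk n s * p s)) => J1 J2.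
  have pt0 : 0 <= p t by exact: p0.
  have h2 : 0 < h n ^+ 2 by rewrite exprn_gt0.
  set X := _ - Lam => H1 H2.
  have H3 : p t * J1 <= p t * (h n ^+ 2 / 2 * X) by rewrite ler_wpM2l.
  rewrite -(ler_pM2l h2) mulrDr mulVKf ?gt_eqF//.
  by lra.
have limg : \int[leb]_(s in I) g n s @[n --> \oo] --> \int[leb]_(s in I) (2^-1 * ker s).
  have [C C0 CP] := kern_sub_tent_bound alpha01 Lam0 t0.
  have inorm := integrable_norm iker.
  apply: (@Rintegral_dominated_cvg _ _ _ leb I g (fun s => 2^-1 * ker s)
    (fun s => C * `|ker s|) mI).
  - by move=> n; have [i _] := ig n; exact: integrable_R_measurable i.
  - apply: measurable_funM; first exact: measurable_cst.
    exact: integrable_R_measurable iker.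
  - move=> s; rewrite /I/= in_itv/= => /andP[s0 st].
    have ts : 0 < t - s by rewrite subr_gt0.
    have := kern_sub_tent_cvg alpha01 Lam ts h0 hc => c.
    have -> : 2^-1 * ker s = - (alpha * (t - s) `^ (- alpha - 1)) / 2 * - (p t - p s).
      by rewrite /ker /caputo_kernel; ring.
    by apply: cvgMl; exact: c.
  - exact: (integrable_RZl _ mI inorm).
  - move=> n s; rewrite /I/= in_itv/= => /andP[s0 st].
    have ts : 0 < t - s <= t by apply/andP; split; lra.
    have h2 : 0 < h n ^+ 2 by rewrite exprn_gt0.
    rewrite /g /ker /caputo_kernel !normrM normrN mulrA.
    rewrite ler_wpM2r// normfV (ger0_norm (ltW h2)) ler_pdivrMl//.
    apply: (le_trans (CP _ _ (h0 n) ts)).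
    rewrite -normrM ger0_norm; first by rewrite mulrCA.
    by rewrite mulr_ge0 ?powR_ge0// ltW; case/andP: alpha01.
have limr : p t / 2 * ((t - h n) `^ (- alpha) - Lam) + \int[leb]_(s in I) g n s @[n --> \oo] -->
    p t / 2 * (t `^ (- alpha) - Lam) + \int[leb]_(s in I) (2^-1 * ker s).
  apply: cvgD; last exact: limg.
  apply: cvgMr; apply: cvgB; last exact: cvg_cst.
  have ct : t - h n @[n --> \oo] --> t.
    by rewrite -[X in _ --> X]subr0; apply: cvgB => //; exact: cvg_cst.
  exact: (cvg_comp _ _ ct (@continuous_powR R (- alpha) t t0)).
have ev : \forall n \near \oo, e / 2 <=
    p t / 2 * ((t - h n) `^ (- alpha) - Lam) + \int[leb]_(s in I) g n s.
  exact: nearW.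
have H2 : e / 2 <= p t / 2 * (t `^ (- alpha) - Lam) + \int[leb]_(s in I) (2^-1 * ker s).
  by apply: cvgr_to_ge limr ev.
move: H2; rewrite (RintegralZl _ mI iker); have := hp tT'; rewrite -/I -/ker.
move: (\int[leb]_(s in I) ker s) => J.
by lra.
Qed.

Lemma fracQ_le0 t : 0 < t <= T -> fracQ alpha Lam T p t <= 0.
Proof.
move=> tT; rewrite leNgt; apply/negP => Q0.
have [t' [e [t'T e0 He]]] := fracQ_maximum_point alpha01 Lam0 T0 mp p0' pM tT Q0.
exact: no_second_difference He.
Qed.

Lemma integral_density_eq0 : \int[leb]_(s in D) p s = 0.
Proof.
have [al0 al1] := andP alpha01.
have i1 : leb.-integrable D (EFin \o (fun s => 1 * p s)).
  apply: (integrable_mulp mp p0' pM).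
  apply: (@bounded_integrable _ _ _ leb D (cst 1) 1) => //.
  - exact: lebesgue_oo_lty.
  - by move=> s _; rewrite normr1.
have ipD : leb.-integrable D (EFin \o p).
  by move: i1; congr (_.-integrable _ _); apply/funext => s /=; rewrite mul1r.
pose P b := conv T p 0 b.
have iP b : 0 <= b <= T -> leb.-integrable D (EFin \o (fun s => cut b 0 b s * p s)).
  by move=> bT; apply: (integrable_conv mp p0' pM) => //.
have P0 b : 0 <= P b.
  rewrite /P convE.
  apply: Rintegral_ge0 => s; rewrite /D/= in_itv/= => sT.
  by rewrite mulr_ge0 ?cut_ge0 ?p0'.
(* The solution of tau^-alpha = Lam + 1: for lags up to [tau] the kernel [r^-alpha - Lam] of Q is at
   least 1. *)
pose tau : R := (Lam + 1) `^ (- alpha^-1).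
have L1 : 0 < Lam + 1 by rewrite ltr_wpDl.
have tau0 : 0 < tau by rewrite powR_gt0.
have tauE r : 0 < r <= tau -> Lam + 1 <= r `^ (- alpha).
  move=> /andP[r0 rt]; apply: (@le_trans _ _ (tau `^ (- alpha))).
    by rewrite /tau -powRrM mulrNN mulVf ?gt_eqF// powRr1// ltW.
  by apply: le_powR_neg => //; rewrite oppr_le0 ltW.
(* The kernel of Q may be negative at times before [a]. Adding [Lam + 1] times the integral of [p]
   up to [a], which is zero, makes the whole kernel at least 1 up to [b], so that [P b] is at most
   Q(b), which is nonpositive. *)
have step a b : 0 <= a -> a < b -> b <= a + tau -> b <= T -> P a = 0 -> P b = 0.
  move=> a0 ab bt bT Pa.
  have aT : 0 <= a <= T by lra.
  have bT' : 0 <= b <= T by lra.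
  apply/eqP; rewrite eq_le P0 andbT.
  have b0T : 0 < b <= T by lra.
  apply: le_trans (fracQ_le0 b0T).
  have [iQ ->] := fracQ_int Lam alpha01 mp p0' pM bT'.
  have iA := integrable_RZl (Lam + 1) mD (iP a aT).
  have iS := integrable_RD mD iQ iA.
  have -> : \int[leb]_(s in D) ((cut b (- alpha) b s - Lam * cut b 0 b s) * p s) =
    \int[leb]_(s in D) ((cut b (- alpha) b s - Lam * cut b 0 b s) * p s
       + (Lam + 1) * (cut a 0 a s * p s)).
    rewrite (RintegralD mD iQ iA) (RintegralZl _ mD (iP a aT)).
    have Pa' : \int[leb]_(x in D) (cut a 0 a x * p x) = 0 by rewrite -convE.
    by rewrite Pa' mulr0 addr0.
  apply: (le_Rintegral mD (iP b bT') iS) => s; rewrite /D/= in_itv/= => sT.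
  have ps := p0' sT.
  rewrite mulrA -mulrDl ler_wpM2r// /cut !powRr0.
  case: ifPn => sb; last first.
    have -> : (s < a) = false by apply/negbTE; move: sb; rewrite -!leNgt; lra.
    by rewrite !mulr0 subrr addr0.
  case: ifPn => sa; first by have := powR_ge0 (b - s) (- alpha); lra.
  have := tauE (b - s); rewrite -leNgt in sa.
  have -> : 0 < b - s <= tau by apply/andP; split; lra.
  by move=> /(_ isT); lra.
have all n : P (Num.min (n%:R * tau) T) = 0.
  elim: n => [|n IH].
    rewrite mul0r min_l ?ltW// /P convE.
    rewrite (_ : \int[_]_(_ in _) _ = \int[leb]_(s in D) (cst 0 s)).
      by rewrite Rintegral_cst// mul0r.
    apply: eq_Rintegral => s /set_mem; rewrite /D/= in_itv/= => /andP[s0 _].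
    by rewrite /cut ltNge (ltW s0)/= mul0r.
  have [|Tn] := leP T (n%:R * tau).
    move=> Tn; rewrite min_r; last first.
      by apply: (le_trans Tn); rewrite ler_pM2r// ler_nat.
    by move: IH; rewrite min_r.
  move: IH; rewrite (min_l (ltW Tn)) => IH.
  apply: (step (n%:R * tau)) => //.
  - by rewrite mulr_ge0// ltW.
  - by rewrite lt_min Tn andbT ltr_pM2r// ltr_nat.
  - by rewrite ge_min -natr1 mulrDl mul1r lexx.
  - by rewrite ge_min lexx orbT.
have [n nT] : exists n, T <= n%:R * tau.
  exists (Num.bound (T / tau)); rewrite -ler_pdivrMr//; apply/ltW.
  by apply: archi_boundP; rewrite divr_ge0// ltW.
have := all n; rewrite min_r// /P convE.
move=> <-; apply: eq_Rintegral => s /set_mem; rewrite /D/= in_itv/= => /andP[_ sT].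
by rewrite /cut sT powRr0 mul1r.
Qed.

(** The divergence is made quantitative: if [p t > 0], a multiple of [h^-alpha] stays below the
    finite integral [B] for all small [h]. *)
Lemma volterra_eq0 t : 0 < t <= T -> p t = 0.
Proof.
move=> tT; have [t0 tT'] := andP tT; have [al0 al1] := andP alpha01.
apply/eqP; rewrite eq_le p0// andbT leNgt; apply/negP => pt.
pose I : set (measurableTypeR R) := `]0, t[%classic.
have mI : measurable I by exact: measurable_itv.
have iker : leb.-integrable I (EFin \o caputo_kernel alpha p t) by exact: ip.
pose B := \int[leb]_(s in I) `|caputo_kernel alpha p t s|.
have inorm := integrable_norm iker.
have ipD : leb.-integrable D (EFin \o p).
  have i1 : leb.-integrable D (EFin \o (fun s => 1 * p s)).
    apply: (integrable_mulp mp p0' pM).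
    apply: (@bounded_integrable _ _ _ leb D (cst 1) 1) => //.
    - exact: lebesgue_oo_lty.
    - by move=> s _; rewrite normr1.
  by move: i1; congr (_.-integrable _ _); apply/funext => s /=; rewrite mul1r.
(* On []t - h, t[] the density has integral 0, so [p t - p s] has integral [p t * h], while the
   kernel weight is at least [alpha * h^(-alpha-1)]. *)
have main h : 0 < h < t -> alpha * p t * h `^ (- alpha) <= B.
  move=> /andP[h0 ht].
  pose J : set (measurableTypeR R) := `]t - h, t[%classic.
  have mJ : measurable J by exact: measurable_itv.
  have JI : J `<=` I by move=> s; rewrite /J /I/= !in_itv/= => /andP[? ?]; lra.
  have JD : J `<=` D by move=> s; rewrite /J /D/= !in_itv/= => /andP[? ?]; lra.
  have ipJ := integrable_Rsub mD mJ JD ipD.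
  have icJ : leb.-integrable J (EFin \o (fun=> p t)).
    apply: (@bounded_integrable _ _ _ leb J _ `|p t|) => //.
    exact: lebesgue_oo_lty.
  have iS := integrable_RB mJ icJ ipJ.
  have PJ : \int[leb]_(s in J) p s <= 0.
    rewrite -integral_density_eq0; apply: (le_Rintegral_subset mJ mD JD ipD).
    by move=> s; rewrite /D/= in_itv/=; exact: p0'.
  have e1 : \int[leb]_(s in J) (p t - p s) = p t * h - \int[leb]_(s in J) p s.
    rewrite (RintegralB mJ icJ ipJ) (Rintegral_cst leb mJ); congr (_ * _ - _).
    have eJ : leb `]t - h, t[%classic = h%:E.
      rewrite lebesgue_measure_itv/= lte_fin ltrBlDr ltrDl h0 -EFinD.
      by congr EFin; ring.
    transitivity (fine h%:E); last by [].
    by congr fine; exact: eJ.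
  have P1 : 0 < alpha * h `^ (- alpha - 1) by rewrite mulr_gt0// powR_gt0.
  apply: (@le_trans _ _ (\int[leb]_(s in J) (alpha * h `^ (- alpha - 1) * (p t - p s)))).
    rewrite (RintegralZl _ mJ iS) e1.
    have -> : h `^ (- alpha) = h * h `^ (- alpha - 1) by rewrite -powRS// subrK.
    move: (\int[leb]_(s in J) p s) PJ => X X0.
    by rewrite mulrBr; nra.
  apply: (@le_trans _ _ (\int[leb]_(s in J) `|caputo_kernel alpha p t s|)); last first.
    by apply: (le_Rintegral_subset mJ mI JI inorm) => s _; exact: normr_ge0.
  apply: (le_Rintegral mJ (integrable_RZl _ mJ iS) (integrable_Rsub mI mJ JI inorm)) => s.
  rewrite /J/= in_itv/= => /andP[hs st].
  have k0 : 0 <= alpha * (t - s) `^ (- alpha - 1) by rewrite mulr_ge0 ?powR_ge0// ltW.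
  rewrite /caputo_kernel normrM (ger0_norm k0).
  apply: (@le_trans _ _ (alpha * h `^ (- alpha - 1) * `|p t - p s|)).
    by rewrite ler_wpM2l ?ler_norm//; exact: ltW.
  rewrite ler_wpM2r// ler_wpM2l//; first exact: ltW.
  by apply: le_powR_neg; lra.
have B0 : 0 <= B by apply: Rintegral_ge0 => s _; exact: normr_ge0.
have ap : 0 < alpha * p t by rewrite mulr_gt0.
(* Chosen so that [h^-alpha >= X] turns [main] into [B + 1 <= B]; this holds once
   [h <= X^(-1/alpha)]. *)
pose X := (B + 1) / (alpha * p t).
have X0 : 0 < X by rewrite divr_gt0// ltr_wpDl.
pose h := Num.min (t / 2) (X `^ (- alpha^-1)).
have h0 : 0 < h by rewrite lt_min divr_gt0//= powR_gt0.
have ht : h < t by rewrite gt_min; apply/orP; left; lra.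
have := main h; rewrite h0 ht => /(_ isT).
have : X <= h `^ (- alpha).
  apply: (@le_trans _ _ ((X `^ (- alpha^-1)) `^ (- alpha))).
    by rewrite -powRrM mulrNN mulVf ?gt_eqF// powRr1// ltW.
  by apply: le_powR_neg => //; [rewrite oppr_le0 ltW|rewrite /h ge_min lexx orbT].
rewrite -(ler_pM2l ap) {1}/X mulrCA divff ?gt_eqF// mulr1 => H1 H2.
by have := le_trans H1 H2; lra.
Qed.

End volterra_comparison.

Unset Implicit Arguments.
Set Strict Implicit.

Theorem corollary2p3 (R : realType) (alpha T lambda : R) (d : nat)
  (Omega : set 'rV[R]_d) (L : operator R d)
  (f : R -> 'rV[R]_d -> R) (u0 : 'rV[R]_d -> R)
  (u uh Rh : R -> 'rV[R]_d -> R) (E : R -> R) :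
  0 < alpha < 1 -> 0 < T ->
  d \in [:: 1; 2; 3]%N -> bounded_lipschitz_domain Omega ->
  elliptic Omega L ->
  (forall v g, H10 Omega v g ->
    lambda * L2norm Omega v ^+ 2 <= pairing Omega L v g v g) ->
  (forall t : R, 0 < t <= T -> L2 Omega (f t)) -> L2 Omega u0 ->
  is_unique_solution Omega alpha T L f u0 u ->
  regular Omega T u -> regular Omega T uh ->
  initial_value Omega uh u0 ->
  (forall t : R, 0 < t <= T ->
    L2 Omega (Rh t) /\ is_residual Omega alpha L f uh t (Rh t)) ->
  (forall t : R, 0 <= t <= T -> 0 <= E t) ->
  (forall t : R, 0 < t <= T -> caputo_defined alpha E t) ->
  (forall t : R, 0 < t <= T ->
    L2norm Omega (Rh t) <= scalar_caputo alpha E t + lambda * E t) ->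
  forall t : R, 0 <= t <= T -> L2norm Omega (uh t \- u t) <= E t.
Proof.
move=> alpha01 T0 _ [oO _ _ _ _] eL coercive_L f2 u02 [[iu su] _] ru rv iv res E0 Ed bound.
have mO := open_measurable_rV oO; have [u2 _ _] := ru; have [v2 _ _] := rv.
pose w s := L2norm Omega (fun x => uh s x - u s x).
have w0 : w 0 = 0.
  apply: L2_ae_eq; [by apply: v2; rewrite lexx ltW|by apply: u2; rewrite lexx ltW|].
  by apply: filterS2 iv iu => x vx ux Ox; rewrite vx// ux.
have w_ge0 s : 0 <= w s by exact: L2norm_ge0.
have tw : tame T w by exact: regular_tame_dist.
have mw := tame_measurable tw.
have TT : 0 < T <= T by rewrite T0 lexx.
have mE := caputo_defined_measurable alpha01 (Ed T TT).
have iw t : 0 < t <= T -> (@lebesgue_measure R).-integrable `]0, t[ (EFin \o caputo_kernel alpha w t).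
  exact: caputo_kernel_integrable.
have [[B wB] _] := tw.
pose p s := Num.max (w s - E s) 0.
have p0 t : 0 < t <= T -> p t = 0.
  apply: (@volterra_eq0 _ alpha (`|lambda| * Gamma (1 - alpha)) T B p) => //.
  - case/andP: alpha01 => a0 a1; rewrite mulr_ge0//; apply/ltW/Gamma_gt0.
    by rewrite subr_gt0 a1 gtrBl.
  - apply: measurable_maxr; last exact: measurable_cst.
    exact: measurable_funB.
  - by move=> s _; rewrite /p le_max lexx orbT.
  - move=> s /andP[s0 sT].
    have sTT : 0 < s <= T by rewrite s0 ltW.
    have Es : 0 <= E s by apply: E0; rewrite !ltW.
    have := wB s sTT; rewrite ger0_norm// => ws.
    by rewrite /p ge_max (le_trans (w_ge0 s) ws) andbT lerBlDr (le_trans ws)// lerDl.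
  - by move=> s sT; exact: (caputo_kernel_pos_part_integrable sT mw mE (iw s sT) (Ed s sT)).
  - move=> s sT; apply: (caputo_pos_part_le alpha01 sT mw mE (iw s sT) (Ed s sT)).
      by rewrite w0; apply: E0; rewrite lexx ltW.
    (* At such a time [0 <= E s < w s], which provides the positivity of the error norm that the
       energy inequality demands. *)
    move=> Ews; have [Rs2 Rs] := res s sT; apply: le_trans (bound s sT).
    apply: (energy_inequality alpha01 T0 mO eL coercive_L ru rv w0 sT Rs2 Rs (su s sT)).
    by apply: le_lt_trans Ews; apply: E0; case/andP: sT => s0 ->; rewrite ltW.
(* Time 0 is outside the range of [p0]; there the error vanishes by the common initial value. *)
move=> t /andP[]; rewrite le_eqVlt => /predU1P[<- _|t0 tT].
  by rewrite [leLHS]w0; apply: E0; rewrite lexx ltW.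
have tT' : 0 < t <= T by rewrite t0.
by have /max_idPr := p0 t tT'; rewrite subr_le0.
Qed.
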